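(* Let $q\ge1$ and $n\ge2$. Let $\widehat f_n^{(block)}$ be a block estimator on the lattice design $V=[\mathbf 1,\mathbf n]$, with $\max_{1\le j\le d}n_j\lesssim_dn^{1/d}$. Assume the $\varepsilon_i$ are independent with $\mathbb E\varepsilon_i=0$ and $\mathbb E|\varepsilon_i|^{q\vee2}\le\sigma^{q\vee2}$, and that $f$ is non-decreasing and depends only on an unknown set $S\subseteq\{1,\ldots,d\}$ of $s$ variables, $f(x)=f_S(x_S)$, $1\le s\le d$. Let $\sigma_S=\sigma/(\prod_{j\notin S}n_j)^{1/2}$ (so $\sigma_S\le C_d\sigma/n^{(1-s/d)/2}$) and $\Delta(\mathbf f_n/\sigma_S)=\{f(\mathbf n)-f(\mathbf 1)\}/\sigma_S$. Then for all $1\le s\le d$ and $\Delta_{n,S}^*\ge0$, $$\sup\Big\{R_q(\widehat{\mathbf f}_n^{(block)},\mathbf f_n):\mathbf f_n\in\mathscr F_n,\ f(x)=f_S(x_S),\ \Delta(\mathbf f_n/\sigma_S)\le\Delta_{n,S}^*\Big\}$$ $$\lesssim_{q,d}\sigma_S^q\min\bigg\{\Lambda_{s,1}^{(select)},\ \Lambda_{s,2}^{(select)}\big(\Delta_{n,S}^*/n^{1/d}\big)^{\min\{1,\frac{qs}{s+2}\}}+\Lambda_{s,1}^{(select)}\big(n^{s/d}\big)^{-\min\{1,q/2\}}(\log n)^{sI\{q=2\}}\bigg\},$$ where $$\Lambda_{s,1}^{(select)}=\Big(\sum_{j=1}^{n^{1/d}}j^{-q/2}\Big/(n^{1/d})^{1-q/2}\Big)^{d-s},$$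 $$\Lambda_{s,2}^{(select)}=\Big(\sum_{j=1}^{n^{1/d}}j^{\min\{\frac{1-q}2,-\frac q{s+2}\}}\Big/(n^{1/d})^{\min\{\frac{1-q}2,-\frac q{s+2}\}+1}\Big)^{d-s}(\log n)^{I\{\frac{qs}{s+2}=1\}}.$$ In particular, for $q=2$ and such $f$ with $\Delta(\mathbf f_n/\sigma_S)\le\Delta_{n,S}^*$, $$R_2(\widehat{\mathbf f}_n^{(block)},\mathbf f_n)\lesssim_d\begin{cases}\sigma^2n^{s/d-1}\min\Big\{(\log n)^{d-s},\ \Delta_{n,S}^*n^{-1/d}(\log n)^{I\{s=2\}}+n^{-s/d}(\log n)^d\Big\},&s\ge2,\\ \sigma^2n^{s/d-1}\min\Big\{(\log n)^{d-1},\ (\Delta_{n,S}^*/n^{1/d})^{2/3}+n^{-1/d}(\log n)^d\Big\},&s=1.\end{cases}$$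
   Context: Lattice design: for positive integers $n_1,\ldots,n_d$, $V=[\mathbf 1,\mathbf n]=\prod_{j=1}^d\{1,\ldots,n_j\}$, $n=\prod_jn_j$; the design points $x_1,\ldots,x_n$ enumerate $V$, each once. We observe $y_i=f(x_i)+\varepsilon_i$. For $S\subseteq\{1,\ldots,d\}$, $x_S=(x_j,j\in S)^T$. Vectors are ordered coordinatewise; $[u,v]=\{x\in V:u\le x\le v\}$; $\overline y_{[u,v]}$ is the average of the $y_i$ with $x_i\in[u,v]$. $\mathscr F$ is the class of functions on $V$ non-decreasing in each coordinate, $\mathbf f_n=(f(x_1),\ldots,f(x_n))^T$, $\mathscr F_n=\{\mathbf f_n:f\in\mathscr F\}$, and $R_q(\widehat{\mathbf f}_n,\mathbf f_n)=n^{-1}\sum_{i=1}^n\mathbb E|\widehat f_n(x_i)-f(x_i)|^q$. Max-min and min-max estimators: $\widehat f_n^{(max-min)}(x)=\max_{u\le x}\min_{v\ge x}\overline y_{[u,v]}$, $\widehat f_n^{(min-max)}(x)=\min_{v\ge x}\max_{u\le x}\overline y_{[u,v]}$ ($u,v\in V$). A block estimator is any estimator $\widehat f_n^{(block)}$ lying, for every $x\in V$, between the minimum and the maximum of these two (it does not use knowledge of $S$). $a\vee b=\max(a,b)$; $I\{\cdot\}$ is an indicator; sums $\sum_{j=1}^{n^{1/d}}$ are over integers $1\le j\le n^{1/d}$. $A\lesssim_{\rm index}B$ means $A\le C_{\rm index}B$ with $C_{\rm index}$ depending only on the index; the implied constants in the conclusions may depend on the constant in $\max_jn_j\lesssim_dn^{1/d}$.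 *)

(* Defs.v *)
From HB Require Import structures.
From mathcomp Require Import all_boot all_order all_algebra.
From mathcomp Require Import all_classical all_reals all_analysis.

Set Implicit Arguments.
Unset Strict Implicit.
Unset Printing Implicit Defensive.

Import Order.TTheory GRing.Theory Num.Theory.
Import numFieldNormedType.Exports.

Local Open Scope classical_set_scope.
Local Open Scope ring_scope.

(* V = [1, n] = \prod_j {1, ..., n_j}.  The ordinal k : 'I_(nn j) encodes the
   coordinate value k + 1; only the order and the equality of coordinates are
   ever used, so the shift is immaterial. *)
Definition lattice (d : nat) (nn : 'I_d -> nat) : finType :=
  {dffun forall j : 'I_d, 'I_(nn j)}.

Definition lattice_size (d : nat) (nn : 'I_d -> nat) : nat :=
  (\prod_(j < d) nn j)%N.

Section Lattice.
Variables (d : nat) (nn : 'I_d -> nat).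
Implicit Types u v x : lattice nn.

Definition lat_le u v : bool := [forall j, (u j <= v j)%N].

Definition in_block u v x : bool := lat_le u x && lat_le x v.

Definition lat_one (hn : forall j, (0 < nn j)%N) : lattice nn :=
  [ffun j : 'I_d => (Ordinal (hn j) : 'I_(nn j))].

Definition lat_top (hn : forall j, (0 < nn j)%N) : lattice nn :=
  [ffun j : 'I_d =>
     (Ordinal (etrans (ltn_predL (nn j)) (hn j)) : 'I_(nn j))].

(* x_S = (x_j, j \in S) *)
Definition restr (S : {set 'I_d}) x :
    {dffun forall j : {j : 'I_d | j \in S}, 'I_(nn (val j))} :=
  [ffun j : {j : 'I_d | j \in S} => (x (val j) : 'I_(nn (val j)))].

Definition depends_on (R : realType) (S : {set 'I_d}) (f : lattice nn -> R) :=
  exists fS : {dffun forall j : {j : 'I_d | j \in S}, 'I_(nn (val j))} -> R,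
    forall x, f x = fS (restr S x).

Definition lat_nondecreasing (R : realType) (f : lattice nn -> R) :=
  forall u v, lat_le u v -> f u <= f v.

End Lattice.

Section Estimators.
Variables (R : realType) (d : nat) (nn : 'I_d -> nat).
Local Notation n := (lattice_size nn).
Variable design : 'I_n -> lattice nn.
Implicit Types (u v x : lattice nn) (y : n.-tuple R).

Definition block_mean y u v : R :=
  (\sum_(i < n | in_block u v (design i)) tnth y i) /
  #|[pred i : 'I_n | in_block u v (design i)]|%:R.

(* In each iterated max/min below the initial value of the big operator is the
   member of the family indexed by u = x or v = x, so it adds no new value. *)

Definition min_above y u x : R :=
  \big[Num.min/block_mean y u x]_(v : lattice nn | lat_le x v) block_mean y u v.

Definition max_below y v x : R :=
  \big[Num.max/block_mean y x v]_(u : lattice nn | lat_le u x) block_mean y u v.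

Definition maxmin_est y x : R :=
  \big[Num.max/min_above y x x]_(u : lattice nn | lat_le u x) min_above y u x.

Definition minmax_est y x : R :=
  \big[Num.min/max_below y x x]_(v : lattice nn | lat_le x v) max_below y v x.

(* An estimator is a measurable function of the data y; it does not see the
   regression function nor the set of relevant variables. *)
Definition block_estimator (est : n.-tuple R -> lattice nn -> R) : Prop :=
  (forall x, measurable_fun [set: n.-tuple R] (fun y => est y x)) /\
  (forall y x,
     Num.min (maxmin_est y x) (minmax_est y x) <= est y x
       <= Num.max (maxmin_est y x) (minmax_est y x)).

End Estimators.

Section Risk.
Variables (R : realType) (dO : measure_display) (Omega : measurableType dO).
Variable P : probability Omega R.

(* Mutual independence of a finite family: product rule over every subfamily. *)
Definition mutually_independent (I : finType) (X : I -> {RV P >-> R}) : Prop :=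
  forall (J : {set I}) (A : I -> set R), (forall i, measurable (A i)) ->
    P (\bigcap_(i in [set` J]) (X i @^-1` A i)) =
    (\prod_(i in J) P (X i @^-1` A i))%E.

Variables (d : nat) (nn : 'I_d -> nat).
Local Notation n := (lattice_size nn).
Variables (design : 'I_n -> lattice nn) (eps : 'I_n -> {RV P >-> R}).

Definition noise_condition (q sigma : R) : Prop :=
  [/\ mutually_independent eps,
      (forall i, 'E_P[eps i] = 0)%E &
      forall i, ('E_P[(fun w => `|eps i w| `^ Num.max q 2)%R]
                  <= (sigma `^ Num.max q 2)%:E)%E].

Definition observation (f : lattice nn -> R) (w : Omega) : n.-tuple R :=
  [tuple f (design i) + eps i w | i < n].

Definition risk (q : R) (est : n.-tuple R -> lattice nn -> R)
    (f : lattice nn -> R) : \bar R :=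
  ((n%:R^-1)%:E * \sum_(i < n)
    'E_P[(fun w => `|est (observation f w) (design i) - f (design i)| `^ q)%R])%E.

End Risk.

Section Rates.
Variable R : realType.

Section FunctionClass.
Variables (d : nat) (nn : 'I_d -> nat).

Definition sigma_sub (S : {set 'I_d}) (sigma : R) : R :=
  sigma / Num.sqrt (\prod_(j | j \notin S) (nn j)%:R).

Definition Delta (hn : forall j, (0 < nn j)%N) (f : lattice nn -> R) (tau : R) : R :=
  (f (lat_top hn) - f (lat_one hn)) / tau.

Definition select_class (hn : forall j, (0 < nn j)%N) (S : {set 'I_d})
    (sigma Dstar : R) : set (lattice nn -> R) :=
  [set f | [/\ lat_nondecreasing f, depends_on S f &
               Delta hn f (sigma_sub S sigma) <= Dstar]].

End FunctionClass.

Variables (d n s : nat).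

Definition root_n : R := n%:R `^ d%:R^-1.

(* The sums run over the integers 1 <= j <= n^{1/d}. *)
Definition Lambda1 (q : R) : R :=
  ((\sum_(1 <= j < (Num.truncn root_n).+1) j%:R `^ (- (q / 2)))
     / root_n `^ (1 - q / 2)) ^+ (d - s).

Definition Lambda2_exp (q : R) : R :=
  Num.min ((1 - q) / 2) (- (q / (s%:R + 2))).

Definition Lambda2 (q : R) : R :=
  ((\sum_(1 <= j < (Num.truncn root_n).+1) j%:R `^ Lambda2_exp q)
     / root_n `^ (Lambda2_exp q + 1)) ^+ (d - s)
  * ln n%:R ^+ (q * s%:R / (s%:R + 2) == 1 :> R).

Definition select_rate (q Dstar : R) : R :=
  Num.min (Lambda1 q)
    (Lambda2 q * (Dstar / root_n) `^ Num.min 1 (q * s%:R / (s%:R + 2))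
     + Lambda1 q * (n%:R `^ (s%:R / d%:R)) `^ (- Num.min 1 (q / 2))
       * ln n%:R ^+ (s * (q == 2))).

End Rates.

(* Main.v *)
Require Import Defs.
From HB Require Import structures.
From mathcomp Require Import all_boot all_order all_algebra.
From mathcomp Require Import all_classical all_reals all_analysis.
From mathcomp Require Import measurable_realfun.
From mathcomp Require Import ring lra zify.
Import Order.TTheory GRing.Theory Num.Theory.
Import numFieldNormedType.Exports.
Local Open Scope classical_set_scope.
Local Open Scope ring_scope.
Set Implicit Arguments.
Unset Strict Implicit.
Unset Printing Implicit Defensive.

(** The argument has a probabilistic and a deterministic half.

Probabilistic half.  Whatever [v >= x] is, a block estimator at [x] is at most
the largest block mean over [[u, v]] with [u <= x], and by monotonicity that
is at most [f v] plus the largest mean of the noise over such blocks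
([block_estimator_le], [block_mean_le]).  The supremum over [u] costs no more
than a constant: its moments are those of the mean over [[x, v]] alone, of
order [sigma / #[x, v] ^ (1/2)] ([kernel_moment]).  This is shown one
coordinate at a time.  In one direction, averages over [[u_j, v_j]] with a
moving left end point are truncations of one fixed harmonic weight, up to a
monotone factor ([average_kernel_tail]); Abel summation and Doob's maximal
inequality then remove the truncation ([directional_maximal]).  The maximal
inequality is applied to the supremum over all the other coordinates, which is
still a submartingale, so the steps can be iterated.  After [d] steps a single
linear form in independent noise variables remains, with moments given by its
variance ([linear_form_moment]).  Reflecting the lattice and changing signs
turns this into a lower bound, so for all [u <= x <= v] the [q]-th moment of
the error at [x] is at most a constant times the bias and noise of the blocks
[[x, v]] and [[u, x]] ([block_error_moment]).  The problem is thereby reduced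
to a choice of [v] for every [x], made with full knowledge of [f] and [S]
although the estimator knows neither.

Deterministic half.  Outside [S] the block may always extend to the top of the
lattice, since [f] does not vary there; the noise of such a block is at most
[local_noise], the noise of the average over the fiber above [x].  Stopping
there gives the first term of the minimum ([select_complement]).  For the
second term take inside [S] a dyadic cube that is good while the next larger one
is not, good meaning that it fits and that its bias is below its noise, or the
whole block above [x] when the total increase of [f] is smaller still
([select_pointwise]).  That the next larger cube is not good means that it
leaves the lattice or that [f] jumps much along it; on every fiber the
proportion of such points is bounded by telescoping and Markov's inequality
([sum_bad_min]).  Weighting the loss at scale [2^i] by this proportion gives
the minimum of two geometric sequences in [i], summed by [dyadic_min_sum];
the exponent [q s / (s + 2)] comes from the scale at which the two cross, and
the logarithm arises when the second sequence is constant.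

What is left are sums over the lattice of products over the coordinates, that
is products of sums of powers.  All sides of the lattice are comparable with
[n ^ (1/d)] ([side_comparable]), so these are the factors in the rates
([selection_rate]); for [q = 2] they are evaluated in [select_rate_two]. *)

(** * Scalar inequalities *)

Section Scalar.
Context {R : realType}.
Implicit Types x y z c t r p : R.

(** Young's inequality for [z] and 1 with the conjugate exponents [r] and
    [r / (r - 1)]. *)
Lemma powR_bernoulli r z : 1 <= r -> 0 <= z -> r * z <= z `^ r + (r - 1).
Proof.
move=> r1 z0; have r0 : 0 < r by lra.
case: (ltrP 1 r) => [r1'|r1']; last first.
  have -> : r = 1 by lra.
  by rewrite powRr1 //; lra.
have q0 : 0 < r / (r - 1) by apply: divr_gt0 => //; lra.
have := @conjugate_powR R z 1 r (r / (r - 1)) z0 ler01 r0 q0.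
rewrite invf_div powR1 mulr1.
have -> : r^-1 + (r - 1) / r = 1 by field; lra.
move=> /(_ erefl) h.
rewrite mulrC -ler_pdivlMr //; apply: (le_trans h).
by rewrite le_eqVlt; apply/orP; left; apply/eqP; field; lra.
Qed.

(** Bernoulli's inequality at [x / y], scaled by [y ^ r]. *)
Lemma powR_tangent r x y : 1 <= r -> 0 < y -> 0 <= x ->
  y `^ r + r * y `^ (r - 1) * (x - y) <= x `^ r.
Proof.
move=> r1 y0 x0.
have h := powR_bernoulli r1 (divr_ge0 x0 (ltW y0)).
have yr : y `^ r = y * y `^ (r - 1) by rewrite mulr_powRB1 ?ltW//; lra.
have xr : x `^ r = y `^ r * (x / y) `^ r.
  have yx0 : 0 <= x / y by rewrite divr_ge0 // ltW.
  by rewrite -(powRM _ (ltW y0) yx0) mulrC divfK // gt_eqF.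
rewrite xr; apply: (@le_trans _ _ (y `^ r * (r * (x / y) - (r - 1)))); last first.
  by rewrite ler_wpM2l ?powR_ge0//; lra.
by rewrite yr le_eqVlt; apply/orP; left; apply/eqP; field; lra.
Qed.

Lemma mulr_powRB2 p c : 2 <= p -> 0 <= c -> c `^ p = c ^+ 2 * c `^ (p - 2).
Proof.
move=> p2 c0; rewrite -(@mulr_powRB1 _ c p) //; last by lra.
rewrite -(@mulr_powRB1 _ c (p - 1)) //; last by lra.
by rewrite mulrA expr2; congr (_ * _ `^ _); lra.
Qed.

(** Only the existence of a slope matters: a linear term integrates to zero
    against a centred variable, so this yields Jensen's inequality. *)
Lemma norm_tangent r c : 1 <= r ->
  exists L, forall t, `|c| `^ r + L * t <= `|c + t| `^ r.
Proof.
move=> r1; have [->|c0] := eqVneq c 0.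
  by exists 0 => t; rewrite normr0 powR0 ?mul0r ?addr0 ?powR_ge0//; lra.
exists (r * `|c| `^ (r - 1) * Num.sg c) => t.
have cp : 0 < `|c| by rewrite normr_gt0.
apply: le_trans (powR_tangent r1 cp (normr_ge0 _)).
rewrite lerD2l -mulrA ler_wpM2l ?mulr_ge0 ?powR_ge0//; first lra.
rewrite lerBrDl.
have [c1|c1|] := ltrgtP c 0; last by move=> /eqP; rewrite (negbTE c0).
  by rewrite ltr0_sg // ltr0_norm //; have := ler_norm (- (c + t)); rewrite normrN; lra.
by rewrite gtr0_sg // gtr0_norm //; have := ler_norm (c + t); lra.
Qed.

(** From [exp (- x) >= 1 - x], hence [exp x <= 1 / (1 - x)]. *)
Lemma expR_le_quad x : x <= 2^-1 -> expR x <= 1 + x + 2 * x ^+ 2.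
Proof.
move=> x2; have h := expR_ge1Dx (- x).
have e0 := expR_gt0 x.
have : expR x * (1 - x) <= 1.
  by rewrite -[leRHS](@expRxMexpNx_1 R x) ler_pM2l //; lra.
move=> h1; have x1 : 0 < 1 - x by lra.
rewrite -(ler_pM2r x1); apply: (le_trans h1); nra.
Qed.

(** A second-order expansion whose remainder needs no moments beyond the
    [p]-th.  The slope [L] depends on [c] and the constant [C] does not. *)
Lemma norm_taylor p : 2 <= p -> exists2 C, 0 < C &
  forall c, exists L, forall t,
    `|c + t| `^ p <= `|c| `^ p + L * t + C * (`|c| `^ (p - 2) * t ^+ 2 + `|t| `^ p).
Proof.
move=> p2; have p0 : 0 < p by lra.
set C := (2 * p + 1) `^ p + 2 * p ^+ 2.
have C1 : 1 <= C.
  rewrite /C; have := powR_ge0 (2 * p + 1) p; nra.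
exists C; first by lra.
move=> c; have [->|c0] := eqVneq c 0.
  exists 0 => t; rewrite normr0 powR0 ?gt_eqF// mul0r !add0r.
  have tp := powR_ge0 `|t| p.
  have ht : 0 <= 0 `^ (p - 2) * t ^+ 2 by rewrite mulr_ge0 ?powR_ge0 ?sqr_ge0.
  by apply: (@le_trans _ _ (1 * (0 `^ (p - 2) * t ^+ 2 + `|t| `^ p)));
    [lra | rewrite ler_wpM2r //; lra].
(* By homogeneity c may be taken to be 1. Up to 1 / (2 p) the exponential
   series is used, beyond it the power `|z| `^ p dominates everything. *)
have key z : `|1 + z| `^ p <= 1 + p * z + C * (z ^+ 2 + `|z| `^ p).
  have zp := powR_ge0 `|z| p; have z2 := sqr_ge0 z.
  have k0 := powR_ge0 (2 * p + 1) p.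
  have [zle|zgt] := lerP `|z| (2 * p)^-1.
    have hz : p * z <= 2^-1.
      apply: (@le_trans _ _ (p * (2 * p)^-1)); last by rewrite invfM mulrCA divff ?gt_eqF ?mulr1.
      by rewrite ler_pM2l //; apply: le_trans zle; exact: ler_norm.
    have z1 : 0 <= 1 + z.
      have : (2 * p)^-1 <= 1 by rewrite invf_le1; lra.
      have := ler_norm (- z); rewrite normrN; lra.
    rewrite ger0_norm //.
    apply: (@le_trans _ _ (expR (p * z))).
      rewrite mulrC expRM; apply: ge0_ler_powR; rewrite ?nnegrE ?expR_ge0 ?(ltW p0)//.
      exact: expR_ge1Dx.
    apply: (le_trans (expR_le_quad hz)).
    rewrite lerD2l exprMn /C; nra.
  have zz : 1 <= 2 * p * `|z| by rewrite -ler_pdivrMl ?mulr1 ?ltW//; lra.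
  have : `|1 + z| `^ p <= (2 * p + 1) `^ p * `|z| `^ p.
    rewrite -powRM //; last lra.
    apply: ge0_ler_powR; rewrite ?nnegrE ?(ltW p0)//; first by nra.
    by apply: (le_trans (ler_normD _ _)); rewrite normr1; lra.
  move=> h; apply: (le_trans h).
  have hz : - (p * z) <= 2 * p ^+ 2 * z ^+ 2.
    rewrite -[z ^+ 2]real_normK ?num_real//.
    have := ler_norm (- z); rewrite normrN => hn; nra.
  rewrite /C; nra.
exists (p * `|c| `^ p / c) => t.
have -> : c + t = c * (1 + t / c) by field.
have cp : `|c| `^ p = `|c| `^ (p - 2) * c ^+ 2.
  by rewrite mulr_powRB2 // mulrC real_normK ?num_real.
rewrite normrM powRM //.
apply: (@le_trans _ _ (`|c| `^ p * (1 + p * (t / c) + C * ((t / c) ^+ 2 + `|t / c| `^ p)))).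
  by rewrite ler_wpM2l ?powR_ge0.
have h : `|c| `^ p * `|t / c| `^ p = `|t| `^ p.
  by rewrite -powRM // -normrM mulrC divfK.
rewrite le_eqVlt; apply/orP; left; apply/eqP.
transitivity (`|c| `^ p + p * `|c| `^ p / c * t + C * (`|c| `^ p * (t / c) ^+ 2 + `|c| `^ p * `|t / c| `^ p)); first by ring.
by rewrite h {3}cp; congr (_ + C * (_ + _)); field.
Qed.

(** Compare [c ^+ 2] with [W]: each of the two terms is sufficient on one side. *)
Lemma powR_young W c p : 2 <= p -> 0 < W -> 0 <= c ->
  c `^ (p - 2) <= W `^ (p / 2 - 1) + W^-1 * c `^ p.
Proof.
move=> p2 W0 c0.
have Wc : 0 <= W^-1 * c `^ p by rewrite mulr_ge0 ?powR_ge0 ?invr_ge0 ?ltW.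
have Wp := powR_ge0 W (p / 2 - 1).
have cc : c `^ (p - 2) = (c ^+ 2) `^ (p / 2 - 1).
  by rewrite -powR_mulrn // -powRrM; congr (_ `^ _); field.
have [h|h] := lerP (c ^+ 2) W.
  have : c `^ (p - 2) <= W `^ (p / 2 - 1).
    by rewrite cc; apply: ge0_ler_powR; rewrite ?nnegrE ?sqr_ge0 ?(ltW W0)//; lra.
  lra.
have c1 : c != 0 by apply/eqP => c1; move: h; rewrite c1 expr0n /=; lra.
rewrite (@mulr_powRB2 p c) //.
have h1 : 1 <= W^-1 * c ^+ 2 by rewrite ler_pdivlMl // mulr1 ltW.
have := ler_wpM2r (powR_ge0 c (p - 2)) h1; rewrite mul1r; lra.
Qed.

(** Superadditivity of the power, of which only halves are needed: they
    pay for the cross term and for the pure power in [moment_step]. *)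
Lemma powR_superadd r x y : 1 <= r -> 0 <= x -> 0 <= y ->
  x `^ r + 2^-1 * (y * x `^ (r - 1)) + 2^-1 * y `^ r <= (x + y) `^ r.
Proof.
move=> r1 x0 y0.
have e u : 0 <= u -> u `^ r = u * u `^ (r - 1).
  by move=> u0; rewrite mulr_powRB1 //; lra.
rewrite !e ?addr_ge0//.
have hx : x `^ (r - 1) <= (x + y) `^ (r - 1).
  by apply: ge0_ler_powR; rewrite ?nnegrE //; lra.
have hy : y `^ (r - 1) <= (x + y) `^ (r - 1).
  by apply: ge0_ler_powR; rewrite ?nnegrE //; lra.
nra.
Qed.

(** [W] bounds the variance so far and [al] is the variance of one more summand.
    Entering the new variance with a large factor [be] absorbs the constant [C]
    of the expansion once and for all, so that it does not grow along an
    induction on the number of summands. *)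
Lemma moment_step (C W al p be : R) : 2 <= p -> 0 < C -> 0 < W -> 0 <= al ->
  1 <= be -> 4 * C <= be ->
  W `^ (p / 2) * (1 + C * al / W) + C * (W `^ (p / 2 - 1) * al + al `^ (p / 2))
   <= (W + be * al) `^ (p / 2).
Proof.
move=> p2 C0 W0 al0 be1 be4.
have r1 : 1 <= p / 2 by lra.
have ba : 0 <= be * al by rewrite mulr_ge0 //; lra.
apply: le_trans (powR_superadd r1 (ltW W0) ba).
have -> : W `^ (p / 2) * (1 + C * al / W) = W `^ (p / 2) + C * al * W `^ (p / 2 - 1).
  rewrite -(@mulr_powRB1 _ W (p / 2)) ?ltW//; last by lra.
  by field; lra.
have bb : be <= be `^ (p / 2).
  by rewrite -{1}(powRr1 (_ : 0 <= be)) ?ler_powR //; lra.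
rewrite powRM //; last lra.
have u0 : 0 <= al * W `^ (p / 2 - 1) by rewrite mulr_ge0 ?powR_ge0.
have v0 := powR_ge0 al (p / 2).
set u := W `^ (p / 2 - 1) in u0 *; set v := al `^ (p / 2) in v0 *.
have h1 : 2 * C * (al * u) <= 2^-1 * (be * al * u).
  by rewrite -[be * al * u]mulrA; nra.
have h2 : C * v <= 2^-1 * (be `^ (p / 2) * v) by nra.
lra.
Qed.

End Scalar.

(** * Resampling one noise variable *)

Section Resampling.
Context {R : realType} {dO : measure_display} {Omega : measurableType dO}.
Variable P : probability Omega R.
Variables (n : nat) (eps : 'I_n -> {RV P >-> R}).

Definition noise (w : Omega) : n.-tuple R := [tuple eps i w | i < n].

Definition replace_at (i : 'I_n) (e : n.-tuple R) (t : R) : n.-tuple R :=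
  [tuple if k == i then t else tnth e k | k < n].

Lemma measurable_noise : measurable_fun setT noise.
Proof.
apply/measurable_fun_tnthP => i.
apply: (eq_measurable_fun (eps i)) => [w _ /=|]; first by rewrite tnth_mktuple.
exact: measurable_funPT.
Qed.

Lemma measurable_replace i :
  measurable_fun setT (fun z : Omega * Omega =>
    replace_at i (noise z.1) (eps i z.2)).
Proof.
apply/measurable_fun_tnthP => k.
apply: (eq_measurable_fun (if k == i then fun z : Omega * Omega => eps i z.2
    else fun z => eps k z.1)) => [z _ /=|].
  by rewrite tnth_mktuple; case: eqP => // _; rewrite tnth_mktuple.
by case: ifP => _; apply: measurableT_comp.
Qed.

Lemma measurable_replace_at i (e : n.-tuple R) :
  measurable_fun setT (fun w => replace_at i e (eps i w)).
Proof.
apply/measurable_fun_tnthP => k.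
apply: (eq_measurable_fun (if k == i then (eps i : Omega -> R)
    else cst (tnth e k))) => [w _ /=|].
  by rewrite tnth_mktuple; case: eqP.
by case: ifP => _; [exact: measurable_funPT|exact: measurable_cst].
Qed.

Definition boxes : set (set (n.-tuple R)) :=
  [set B | exists2 A : 'I_n -> set R, (forall i, measurable (A i)) &
     B = [set e | forall i, A i (tnth e i)]].

Lemma setI_closed_boxes : setI_closed boxes.
Proof.
move=> _ _ [A mA ->] [B mB ->]; exists (fun i => A i `&` B i).
  by move=> i; apply: measurableI.
apply/seteqP; split => [e [ha hb] i|e h]; first by split.
by split => i; have [] := h i.
Qed.

Lemma measurable_boxes : boxes `<=` measurable.
Proof.
move=> _ [A mA ->].
rewrite (_ : [set e | _] = \big[setI/setT]_(i < n)
   ((fun e : n.-tuple R => tnth e i) @^-1` A i)).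
  apply: bigsetI_measurable => i _.
  by rewrite -[X in measurable X]setTI; exact: (measurable_tnth i).
rewrite -bigcap_seq; apply/seteqP; split => [e h i _|e h i]; first exact: h.
by apply: h => /=; rewrite mem_index_enum.
Qed.

Lemma boxes_generate (B : set (n.-tuple R)) : measurable B -> <<s boxes >> B.
Proof.
apply: smallest_sub; first exact: smallest_sigma_algebra.
rewrite -bigcup_seq => D /= [i _ [A mA <-]]; apply: sub_sigma_algebra.
exists (fun k => if k == i then A else setT) => [k|]; first by case: ifP.
rewrite setTI; apply/seteqP; split => [e he k|e he] /=.
  by case: eqP => // ->.
by have := he i; rewrite eqxx.
Qed.

Hypothesis indep : mutually_independent eps.

Lemma noise_box (A : 'I_n -> set R) (mA : forall i, measurable (A i)) :
  P (noise @^-1` [set e | forall i, A i (tnth e i)]) =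
  (\prod_(i < n) P (eps i @^-1` A i))%E.
Proof.
have := indep [set: 'I_n]%SET mA; under [in RHS]eq_bigl do rewrite inE.
move=> <-; congr (P _); apply/seteqP; split => [w h i _|w h i] /=.
  by have := h i; rewrite /= tnth_mktuple.
by rewrite tnth_mktuple; apply: h => /=; rewrite inE.
Qed.

Lemma replace_box i (A : 'I_n -> set R) (mA : forall i, measurable (A i)) :
  (P \x P)%E ((fun z => replace_at i (noise z.1) (eps i z.2)) @^-1`
     [set e | forall i, A i (tnth e i)]) =
  (\prod_(i < n) P (eps i @^-1` A i))%E.
Proof.
have mpre k : measurable (eps k @^-1` A k).
  by rewrite -[X in measurable X]setTI; exact: measurable_funPT.
rewrite (_ : _ @^-1` _ =
   (\bigcap_(k in [set` [set~ i]%SET]) (eps k @^-1` A k)) `*` (eps i @^-1` A i)).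
  rewrite product_measure1E //.
    transitivity ((\prod_(k in [set~ i]%SET) P (eps k @^-1` A k))
        * P (eps i @^-1` A i))%E.
      by congr (_ * _)%E; exact: (indep [set~ i]%SET mA).
    rewrite [RHS](bigD1 i) //= muleC; congr (_ * _)%E.
    by apply: eq_bigl => k; rewrite !inE.
  by apply: fin_bigcap_measurable => [|k _]; [exact: finite_finset|exact: mpre].
apply/seteqP; split => [[w w'] h|[w w'] [h1 h2] k] /=.
  split=> [k /=|/=]; last by have := h i; rewrite /= tnth_mktuple eqxx.
  by rewrite !inE => /negbTE ki; have := h k; rewrite /= !tnth_mktuple ki.
rewrite tnth_mktuple; case: eqP => [->//|/eqP ki]; rewrite tnth_mktuple.
by apply: h1 => /=; rewrite !inE.
Qed.

(** This is the form in which independence is used: the inner integral is the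
    conditional expectation given all noise variables except the [i]-th.  The
    law of the noise vector and that of its resampled version agree on boxes by
    the product rule, and boxes form a generating pi-system. *)
Lemma resample (i : 'I_n) (F : n.-tuple R -> \bar R) :
  measurable_fun [set: n.-tuple R] F -> (forall e, 0 <= F e)%E ->
  (\int[P]_w F (noise w) =
   \int[P]_w \int[P]_w' F (replace_at i (noise w) (eps i w')))%E.
Proof.
move=> mF F0.
have mr := measurable_replace i; have mn := measurable_noise.
transitivity (\int[P \x P]_z F (replace_at i (noise z.1) (eps i z.2)))%E; last first.
  by rewrite fubini_tonelli1 //; exact: measurableT_comp.
have := @ge0_integral_pushforward _ _ _ _ R _ mn P setT F measurableT mF (fun y _ => F0 y).
rewrite preimage_setT => <-.
have := @ge0_integral_pushforward _ _ _ _ R _ mr (P \x P)%E setT F measurableT mF (fun y _ => F0 y).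
rewrite preimage_setT => <-.
apply: eq_measure_integral => B mB _.
apply: (@g_sigma_algebra_measure_unique _ _ _ boxes measurable_boxes (fun=> setT)) => //.
- by exists (fun=> setT) => //; apply/seteqP; split.
- by rewrite bigcup_const.
- exact: setI_closed_boxes.
- by move=> _ [A mA ->]; rewrite /= /pushforward noise_box // replace_box.
- by move=> k; rewrite /= /pushforward preimage_setT probability_setT ltry.
- exact: boxes_generate.
Qed.

Lemma measurable_resampled (i : 'I_n) (F : n.-tuple R -> \bar R) :
  measurable_fun [set: n.-tuple R] F -> (forall e, 0 <= F e)%E ->
  measurable_fun [set: Omega]
    (fun w => \int[P]_w' F (replace_at i (noise w) (eps i w')))%E.
Proof.
move=> mF F0.
apply: (@measurable_fun_fubini_tonelli_F _ _ _ _ _ P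
  (fun z => F (replace_at i (noise z.1) (eps i z.2)))) => //.
exact: (measurableT_comp mF (measurable_replace i)).
Qed.

End Resampling.

(** * Moments of affine functions of one centred variable *)

Section Moments.
Context {R : realType} {dO : measure_display} {Omega : measurableType dO}.
Variable P : probability Omega R.

Local Notation Ex g := (\int[P]_w (g w)%:E)%E.

Lemma integral_constant (c : R) : (\int[P]_w c%:E)%E = c%:E.
Proof. by rewrite integral_cst //= probability_setT mule1. Qed.

Lemma integral_le_scale (f g : Omega -> R) (c : R) : 0 <= c ->
  measurable_fun setT f -> measurable_fun setT g ->
  (forall w, 0 <= f w) -> (forall w, 0 <= g w) ->
  (forall w, f w <= c * g w) -> (Ex f <= c%:E * Ex g)%E.
Proof.
move=> c0 mf mg f0 g0 fg.
have h : (Ex f <= \int[P]_w (c%:E * (g w)%:E))%E.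
  apply: ge0_le_integral => //.
  - by move=> w _; rewrite lee_fin.
  - exact/measurable_EFinP.
  - by apply/measurable_EFinP; exact: measurable_funM.
  - by move=> w _; rewrite -EFinM lee_fin.
apply: (le_trans h); rewrite ge0_integralZl_EFin //.
  by move=> w _; rewrite lee_fin.
exact/measurable_EFinP.
Qed.

Lemma integral_le_affine (f g : Omega -> R) (a b : R) : 0 <= a -> 0 <= b ->
  measurable_fun setT f -> measurable_fun setT g ->
  (forall w, 0 <= f w) -> (forall w, 0 <= g w) ->
  (forall w, f w <= a + b * g w) -> (Ex f <= a%:E + b%:E * Ex g)%E.
Proof.
move=> a0 b0 mf mg f0 g0 fg.
have h : (Ex f <= \int[P]_w (a%:E + (b * g w)%:E))%E.
  apply: ge0_le_integral => //.
  - by move=> w _; rewrite lee_fin.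
  - exact/measurable_EFinP.
  - by apply/measurable_EFinP; apply: measurable_funD => //; exact: measurable_funM.
  - by move=> w _; rewrite -EFinD lee_fin.
apply: (le_trans h); rewrite ge0_integralD //.
- rewrite integral_constant leeD2l //; apply: integral_le_scale => //.
    exact: measurable_funM.
  by move=> w; exact: mulr_ge0.
- by move=> w _; rewrite lee_fin mulr_ge0.
- by apply/measurable_EFinP; exact: measurable_funM.
Qed.

(** The integrals of [f] and [g] may be infinite, so the linear term cannot be
    integrated separately.  Its positive and negative parts have the same finite
    integral; one part is added on each side and cancelled at the end. *)
Lemma integral_le_tangent (X : Omega -> R) (f g : Omega -> R) (L : R) :
  P.-integrable setT (EFin \o X) -> (\int[P]_w (X w)%:E = 0)%E ->
  measurable_fun setT f -> measurable_fun setT g ->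
  (forall w, 0 <= f w) -> (forall w, 0 <= g w) ->
  (forall w, f w + L * X w <= g w) -> (Ex f <= Ex g)%E.
Proof.
move=> iX X0 mf mg f0 g0 fg.
have mX : measurable_fun setT X by apply/measurable_EFinP; exact: measurable_int iX.
have iLX : P.-integrable setT (EFin \o (fun w => L * X w)).
  rewrite (_ : _ \o _ = fun w => (L%:E * (X w)%:E)%E) //.
  exact: integrableZl.
have mLX : measurable_fun setT (fun w => L * X w) by exact: measurable_funM.
pose A w := Num.max (L * X w) 0; pose B w := Num.max (- (L * X w)) 0.
have mA : measurable_fun setT A by apply: measurable_maxr.
have mB : measurable_fun setT B.
  by apply: measurable_maxr => //; exact: measurableT_comp.
have AB w : A w = L * X w + B w.
  by rewrite /A /B; case: leP => h1; case: leP => h2; lra.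
have B0 w : 0 <= B w by rewrite /B le_max lexx orbT.
have A0 w : 0 <= A w by rewrite /A le_max lexx orbT.
have iB : P.-integrable setT (EFin \o B).
  apply: le_integrable iLX => //=; first exact/measurable_EFinP.
  move=> w _; rewrite lee_fin (ger0_norm (B0 w)) /B ge_max normr_ge0 andbT.
  by rewrite -normrN ler_norm.
have intA : Ex A = Ex B.
  rewrite (eq_integral (fun w => ((L * X w)%:E + (B w)%:E)%E)); last first.
    by move=> w _; rewrite AB EFinD.
  rewrite integralD //; rewrite (_ : (fun w => (L * X w)%:E) = fun w => (L%:E * (X w)%:E)%E) //.
  by rewrite integralZl // X0 mule0 add0e.
have finB : (Ex B \is a fin_num)%E by exact: integrable_fin_num.
rewrite -(@leeD2rE _ (Ex B)) // -[X in (X <= _)%E](_ : Ex f + Ex A = _)%E; last by rewrite intA.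
rewrite -!ge0_integralD //; try by move=> *; rewrite lee_fin.
all: try exact/measurable_EFinP.
apply: ge0_le_integral => //.
- by move=> w _; rewrite -EFinD lee_fin addr_ge0.
- by apply/measurable_EFinP; exact: measurable_funD.
- by apply/measurable_EFinP; exact: measurable_funD.
- by move=> w _; rewrite -!EFinD lee_fin AB; have := fg w; lra.
Qed.

Lemma integrable_of_moment (X : {RV P >-> R}) (p K : R) : 1 <= p ->
  (Ex (fun w => `|X w| `^ p)%R <= K%:E)%E -> P.-integrable setT (EFin \o X).
Proof.
move=> p1 hX.
have mp : measurable_fun setT (fun w => `|X w| `^ p).
  by apply: (measurableT_comp (measurable_powR p)); exact: measurableT_comp.
have ip : P.-integrable setT (EFin \o (fun w => 1 + `|X w| `^ p)).
  apply/integrableP; split.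
    by apply/measurable_EFinP; exact: measurable_funD.
  rewrite (eq_integral (fun w => (1%:E + (`|X w| `^ p)%:E)%E)); last first.
    by move=> w _ /=; rewrite ger0_norm ?addr_ge0 ?powR_ge0.
  rewrite ge0_integralD //; last exact/measurable_EFinP.
  rewrite integral_constant.
  by apply: (@le_lt_trans _ _ (1%:E + K%:E)%E); [rewrite leeD2l|rewrite -EFinD ltry].
apply: le_integrable ip => //=; first exact/measurable_EFinP.
move=> w _; rewrite lee_fin [leRHS]ger0_norm ?addr_ge0 ?powR_ge0//.
have [h|h] := lerP `|X w| 1; first by have := powR_ge0 `|X w| p; lra.
by have := le1r_powR (ltW h) p1; lra.
Qed.

Section Single.
Variables (X : {RV P >-> R}) (p sigma : R).
Hypotheses (p2 : 2 <= p) (sigma0 : 0 < sigma).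
Hypothesis X0 : (\int[P]_w (X w)%:E = 0)%E.
Hypothesis Xp : (Ex (fun w => `|X w| `^ p)%R <= (sigma `^ p)%:E)%E.

Let iX : P.-integrable setT (EFin \o X).
Proof. by apply: integrable_of_moment Xp; move: p2; lra. Qed.

Lemma measurable_affine_powR (c a r : R) :
  measurable_fun setT (fun w => `|c + a * X w| `^ r).
Proof.
apply: (measurableT_comp (measurable_powR r)); apply: measurableT_comp => //.
by apply: measurable_funD => //; exact: measurable_funM.
Qed.

(** Lyapunov's inequality, through Bernoulli's at [X ^+ 2 / sigma ^+ 2]. *)
Lemma second_moment : (Ex (fun w => X w ^+ 2)%R <= (sigma ^+ 2)%:E)%E.
Proof.
have p2' := p2; have s0 := sigma0.
have s2 : 0 < sigma ^+ 2 by rewrite exprn_gt0.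
have r1 : 1 <= p / 2 by lra.
have mX2 : measurable_fun setT (fun w => X w ^+ 2) by exact: measurable_funX.
have mXp : measurable_fun setT (fun w => `|X w| `^ p).
  by apply: (measurableT_comp (measurable_powR p)); exact: measurableT_comp.
(* Coefficients of the affine bound of X^2 by |X|^p that Bernoulli's
   inequality gives. *)
pose k := (p / 2 - 1) / (p / 2) * sigma ^+ 2.
have k0 : 0 <= k.
  by rewrite mulr_ge0 ?(ltW s2) // divr_ge0 //; lra.
pose h := sigma ^+ 2 / (p / 2) / sigma `^ p.
have h0 : 0 <= h by rewrite !divr_ge0 ?powR_ge0 ?(ltW s2) //; lra.
have sp := powR_gt0 p sigma0.
have pt w : X w ^+ 2 <= h * `|X w| `^ p + k.
  have := powR_bernoulli r1 (divr_ge0 (sqr_ge0 (X w)) (ltW s2)).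
  have -> : (X w ^+ 2 / sigma ^+ 2) `^ (p / 2) = `|X w| `^ p / sigma `^ p.
    rewrite -[X w ^+ 2]real_normK ?num_real// -expr_div_n -powR_mulrn ?divr_ge0 ?(ltW sigma0)//.
    rewrite -powRrM (_ : 2%:R * (p / 2) = p); last by field.
    rewrite powRM ?invr_ge0 ?(ltW sigma0) //; congr (_ * _).
    by rewrite -(powR_inv1 (ltW s0)) powRAC powR_inv1 ?powR_ge0.
  rewrite mulrC -ler_pdivlMr; last lra.
  rewrite ler_pdivrMr // => H; apply: (le_trans H).
  rewrite le_eqVlt; apply/orP; left; apply/eqP; rewrite /h /k; field.
  by rewrite (gt_eqF sp) /=; lra.
apply: (@le_trans _ _ (Ex (fun w => h * `|X w| `^ p + k)%R)).
  apply: ge0_le_integral => //.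
  - by move=> w _; rewrite lee_fin sqr_ge0.
  - exact/measurable_EFinP.
  - by apply/measurable_EFinP; apply: measurable_funD => //; exact: measurable_funM.
  - by move=> w _; rewrite lee_fin.
rewrite (eq_integral (fun w => ((h * `|X w| `^ p)%:E + k%:E)%E)) //.
rewrite ge0_integralD //; [|by move=> w _; rewrite lee_fin mulr_ge0 ?powR_ge0
  |by apply/measurable_EFinP; exact: measurable_funM].
rewrite integral_constant.
under eq_integral do rewrite EFinM.
rewrite ge0_integralZl_EFin //; last exact/measurable_EFinP.
apply: (@le_trans _ _ (h%:E * (sigma `^ p)%:E + k%:E)%E).
  by rewrite leeD2r // lee_wpmul2l.
rewrite -EFinM -EFinD lee_fin le_eqVlt; apply/orP; left; apply/eqP.
by rewrite /h /k; field; rewrite (gt_eqF sp) /=; lra.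
Qed.

(** Jensen's inequality; it makes the suprema of linear forms submartingales. *)
Lemma shift_moment_ge (r c a : R) : 1 <= r ->
  ((`|c| `^ r)%:E <= Ex (fun w => `|c + a * X w| `^ r)%R)%E.
Proof.
move=> r1; have [L hL] := norm_tangent c r1.
have := @integral_le_tangent X (fun=> `|c| `^ r) (fun w => `|c + a * X w| `^ r) (L * a) iX X0.
rewrite integral_constant; apply => //; first exact: measurable_affine_powR.
by move=> w; rewrite -mulrA.
Qed.

Lemma shift_moment_le (C : R) : 0 < C ->
  (forall c, exists L, forall t,
    `|c + t| `^ p <= `|c| `^ p + L * t + C * (`|c| `^ (p - 2) * t ^+ 2 + `|t| `^ p)) ->
  forall c a, (Ex (fun w => `|c + a * X w| `^ p)%R <=
   (`|c| `^ p + C * (`|c| `^ (p - 2) * (a * sigma) ^+ 2 + ((a * sigma) ^+ 2) `^ (p / 2)))%:E)%E.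
Proof.
move=> C0 HC c a; have p2' := p2; have [L hL] := HC c.
have mX2 : measurable_fun setT (fun w => X w ^+ 2) by exact: measurable_funX.
have mXp : measurable_fun setT (fun w => `|X w| `^ p).
  by apply: (measurableT_comp (measurable_powR p)); exact: measurableT_comp.
pose k := C * `|c| `^ (p - 2) * a ^+ 2; pose h := C * `|a| `^ p.
have k0 : 0 <= k.
  by apply: mulr_ge0; [apply: mulr_ge0; [exact: ltW|exact: powR_ge0]|exact: sqr_ge0].
have h0 : 0 <= h by apply: mulr_ge0; [exact: ltW|exact: powR_ge0].
have c0 := powR_ge0 `|c| p.
have mg : measurable_fun setT (fun w => `|c| `^ p + (k * X w ^+ 2 + h * `|X w| `^ p)).
  apply: measurable_funD => //.
  by apply: measurable_funD; exact: measurable_funM.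
apply: (@le_trans _ _ (Ex (fun w => `|c| `^ p + (k * X w ^+ 2 + h * `|X w| `^ p))%R)).
  apply: (@integral_le_tangent X _ _ (- (L * a)) iX X0 _ mg).
  - exact: measurable_affine_powR.
  - by move=> w; exact: powR_ge0.
  - move=> w; apply: addr_ge0 => //; apply: addr_ge0; apply: mulr_ge0 => //.
    exact: sqr_ge0.
  - move=> w; have := hL (a * X w); rewrite normrM powRM // exprMn /k /h; lra.
rewrite (eq_integral (fun w => ((`|c| `^ p)%:E + ((k * X w ^+ 2)%:E + (h * `|X w| `^ p)%:E))%E)) //.
have m1 : measurable_fun setT (fun w => (k * X w ^+ 2)%:E).
  by apply/measurable_EFinP; exact: measurable_funM.
have m2 : measurable_fun setT (fun w => (h * `|X w| `^ p)%:E).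
  by apply/measurable_EFinP; exact: measurable_funM.
have n1 w : (0 <= (k * X w ^+ 2)%:E)%E by rewrite lee_fin mulr_ge0 ?sqr_ge0.
have n2 w : (0 <= (h * `|X w| `^ p)%:E)%E by rewrite lee_fin mulr_ge0 ?powR_ge0.
rewrite ge0_integralD //; [|by move=> w _; rewrite adde_ge0|exact: emeasurable_funD].
rewrite integral_constant ge0_integralD //.
under eq_integral do rewrite EFinM.
rewrite ge0_integralZl_EFin //; [|by move=> w _; rewrite lee_fin sqr_ge0
  |exact/measurable_EFinP].
under [X in (_ + (_ + X) <= _)%E]eq_integral do rewrite EFinM.
rewrite ge0_integralZl_EFin //; last exact/measurable_EFinP.
apply: (@le_trans _ _ ((`|c| `^ p)%:E + (k%:E * (sigma ^+ 2)%:E + h%:E * (sigma `^ p)%:E))%E).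
  by rewrite leeD2l // leeD // lee_wpmul2l // second_moment.
rewrite -!EFinM -!EFinD lee_fin lerD2l le_eqVlt; apply/orP; left; apply/eqP.
rewrite -[(a * sigma) ^+ 2 in X in _ = X](@real_normK _ (a * sigma)) ?num_real//.
have -> : (`|a * sigma| ^+ 2) `^ (p / 2) = `|a| `^ p * sigma `^ p.
  rewrite -powR_mulrn // -powRrM (_ : 2%:R * (p / 2) = p); last by field.
  by rewrite normrM powRM // (gtr0_norm sigma0).
by rewrite real_normK ?num_real // /k /h exprMn; ring.
Qed.

End Single.

End Moments.

(** * Moments of linear forms in the noise *)

Section LinearForms.
Context {R : realType} {n : nat}.
Implicit Types (l : seq 'I_n) (a : 'I_n -> R) (e : n.-tuple R).

(** Indexed by a list because the moment bound and the maximal inequality both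
    adjoin the noise variables one at a time, at the head. *)
Definition linear_form l a e : R := \sum_(i <- l) a i * tnth e i.

Lemma linear_form_cons i l a e :
  linear_form (i :: l) a e = linear_form l a e + a i * tnth e i.
Proof. by rewrite /linear_form big_cons addrC. Qed.

Lemma linear_form_replace i l a e t : i \notin l ->
  linear_form l a (replace_at i e t) = linear_form l a e.
Proof.
move=> il; rewrite /linear_form !big_seq; apply: eq_bigr => k kl.
by rewrite tnth_mktuple; case: eqP => // ki; move: il; rewrite -ki kl.
Qed.

Lemma measurable_linear_form l a :
  measurable_fun [set: n.-tuple R] (linear_form l a).
Proof.
apply: measurable_sum => i; apply: measurable_funM => //; exact: measurable_tnth.
Qed.

Lemma measurable_norm_powR d (T : measurableType d) (g : T -> R) (r : R) :
  measurable_fun setT g -> measurable_fun setT (fun x => `|g x| `^ r).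
Proof.
move=> mg; apply: (measurableT_comp (measurable_powR r)).
exact: measurableT_comp.
Qed.

Lemma measurable_bigmax d (T : measurableType d) (I : Type) (s : seq I)
    (h : I -> T -> R) : (forall i, measurable_fun setT (h i)) ->
  measurable_fun setT (fun x => \big[Num.max/0]_(i <- s) h i x).
Proof.
move=> mh; elim: s => [|i s IH].
  by under eq_fun do rewrite big_nil; exact: measurable_cst.
apply: (eq_measurable_fun (h i \max (fun x => \big[Num.max/0]_(i <- s) h i x))).
  by move=> x _; rewrite big_cons.
exact: measurable_maxr.
Qed.

End LinearForms.

(** Marcinkiewicz-Zygmund for weighted sums, by induction on the list.
    Resampling the head and expanding around the value [c] of the tail leaves
    [`|c| `^ (p - 2)], which [powR_young] bounds with the variance [W] of the
    tail as weight; [moment_step] closes the induction.  The summand [eta]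
    keeps [W] positive. *)
Lemma linear_form_moment (R : realType) (p : R) : 2 <= p ->
  exists2 be : R, 1 <= be &
  forall (dO : measure_display) (Omega : measurableType dO)
    (P : probability Omega R) (n : nat) (eps : 'I_n -> {RV P >-> R}) (sigma : R),
  0 < sigma -> mutually_independent eps ->
  (forall i, \int[P]_w (eps i w)%:E = 0)%E ->
  (forall i, \int[P]_w (`|eps i w| `^ p)%:E <= (sigma `^ p)%:E)%E ->
  forall (l : seq 'I_n) (a : 'I_n -> R) (eta : R), uniq l -> 0 < eta ->
  (\int[P]_w (`|linear_form l a (noise eps w)| `^ p)%:E <=
    ((be * (eta + \sum_(i <- l) a i ^+ 2) * sigma ^+ 2) `^ (p / 2))%:E)%E.
Proof.
move=> p2; have [C C0 HC] := norm_taylor p2.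
(* The factor required by moment_step. *)
pose be := 1 + 4 * C; have be1 : 1 <= be by rewrite /be; lra.
exists be => // dO Omega P n eps sigma s0 ind m0 mp l a eta ul eta0.
elim: l ul => [|i l IH] /= => [_|/andP[il ul]].
  have p0 : p != 0 by rewrite gt_eqF //; lra.
  under eq_integral do rewrite /linear_form big_nil normr0 powR0 //.
  by rewrite integral0 lee_fin powR_ge0.
set W := be * (eta + \sum_(j <- l) a j ^+ 2) * sigma ^+ 2.
have W0 : 0 < W.
  apply: mulr_gt0; last by rewrite exprn_gt0.
  apply: mulr_gt0; first by lra.
  by rewrite ltr_wpDr // sumr_ge0 // => j _; exact: sqr_ge0.
set al := (a i * sigma) ^+ 2; have al0 : 0 <= al := sqr_ge0 _.
have mS := measurable_linear_form l a.
have mN := measurable_noise eps.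
have mSn : measurable_fun setT (fun w => linear_form l a (noise eps w)).
  exact: (measurableT_comp mS mN).
have mSp := measurable_norm_powR p mSn.
rewrite (@resample _ _ _ P n eps ind i
   (fun e => (`|linear_form (i :: l) a e| `^ p)%:E)) //; last first.
  apply/measurable_EFinP; apply: measurable_norm_powR.
  exact: measurable_linear_form.
(* Conditionally on the tail, the p-th moment is an affine function of its
   p-th power, with these coefficients. *)
pose k := 1 + C * al / W; pose h := C * (W `^ (p / 2 - 1) * al + al `^ (p / 2)).
have k0 : 0 <= k.
  by apply: addr_ge0 => //; apply: divr_ge0; [apply: mulr_ge0 => //|]; exact: ltW.
have h0 : 0 <= h.
  apply: mulr_ge0; first exact: ltW.
  by apply: addr_ge0; rewrite ?powR_ge0 // mulr_ge0 ?powR_ge0.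
apply: (@le_trans _ _ (\int[P]_w (k * `|linear_form l a (noise eps w)| `^ p + h)%:E)%E).
  apply: ge0_le_integral => //.
  - by move=> w _; apply: integral_ge0.
  - apply: (@measurable_resampled _ _ _ P n eps i
      (fun e => (`|linear_form (i :: l) a e| `^ p)%:E)) => //.
    by apply/measurable_EFinP; apply: measurable_norm_powR; exact: measurable_linear_form.
  - apply/measurable_EFinP; apply: measurable_funD => //.
    exact: measurable_funM.
  move=> w _; set c := linear_form l a (noise eps w).
  under eq_integral do rewrite linear_form_cons linear_form_replace// tnth_mktuple eqxx -/c.
  apply: (le_trans (shift_moment_le p2 s0 (m0 i) (mp i) C0 HC c (a i))).
  rewrite lee_fin -/al.
  have := powR_young p2 W0 (normr_ge0 c); rewrite /k /h => hy.
  have := ler_wpM2l al0 hy => hy2.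
  have := ler_wpM2l (ltW C0) hy2 => hy3.
  have -> : (1 + C * al / W) * `|c| `^ p = `|c| `^ p + C * (al * (W^-1 * `|c| `^ p)) by ring.
  lra.
under eq_integral do rewrite EFinD.
rewrite ge0_integralD //; [|by move=> w _; rewrite lee_fin mulr_ge0 ?powR_ge0
  |by apply/measurable_EFinP; exact: measurable_funM].
rewrite integral_constant.
under eq_integral do rewrite EFinM.
rewrite ge0_integralZl_EFin //; last exact/measurable_EFinP.
apply: (@le_trans _ _ (k%:E * (W `^ (p / 2))%:E + h%:E)%E).
  by rewrite leeD2r // lee_wpmul2l // IH.
rewrite -EFinM -EFinD lee_fin big_cons.
have hb : 4 * C <= be by rewrite /be; lra.
have hs := moment_step p2 C0 W0 al0 be1 hb.
rewrite mulrC; apply: (le_trans hs).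
by rewrite le_eqVlt; apply/orP; left; apply/eqP; congr (_ `^ _); rewrite /W /al exprMn; ring.
Qed.

(** * The maximal inequality for suprema of linear forms *)

Section Maximal.
Context {R : realType} {n : nat} {K : finType}.
Variables (a : K -> 'I_n -> R) (r : R).
Implicit Types (l : seq 'I_n) (e : n.-tuple R).

(** A maximum over [k] of convex functions of the partial sums: as a process in
    [l] it is again a submartingale, so one maximal inequality controls all
    [k] at once. *)
Definition sup_form l e : R :=
  \big[Num.max/0]_(k : K) `|linear_form l (a k) e| `^ r.

(** The maximum over all suffixes of [l].  The filtration runs from the end of
    the list to its head. *)
Fixpoint running_sup l e : R :=
  if l is i :: l' then Num.max (running_sup l' e) (sup_form l e) else 0.

Lemma sup_form_ge0 l e : 0 <= sup_form l e.
Proof.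
rewrite /sup_form; apply: (big_ind (fun x => 0 <= x)) => // x y x0 _.
by rewrite le_max x0.
Qed.

Lemma running_sup_ge0 l e : 0 <= running_sup l e.
Proof. by elim: l => //= i l IH; rewrite le_max IH. Qed.

Lemma sup_form_ge l e k : `|linear_form l (a k) e| `^ r <= sup_form l e.
Proof. exact: (@le_bigmax _ R K 0 (fun k => `|linear_form l (a k) e| `^ r)). Qed.

Lemma sup_form_ex l e :
  sup_form l e = 0 \/ exists k, sup_form l e = `|linear_form l (a k) e| `^ r.
Proof.
rewrite /sup_form; apply: (big_ind (fun x => x = 0 \/ exists k, x = `|linear_form l (a k) e| `^ r)); first by left.
  by move=> x y [->|[k ->]] [->|[k' ->]]; case: leP => _;
    (by left) || (by right; exists k) || (by right; exists k').
by move=> k _; right; exists k.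
Qed.

Lemma sup_form_replace i l e t : i \notin l ->
  sup_form l (replace_at i e t) = sup_form l e.
Proof. by move=> il; apply: eq_bigr => k _; rewrite linear_form_replace. Qed.

Lemma running_sup_replace i l e t : i \notin l ->
  running_sup l (replace_at i e t) = running_sup l e.
Proof.
elim: l => //= k l IH; rewrite inE negb_or => /andP[ik il].
by rewrite IH // sup_form_replace // inE negb_or ik.
Qed.

Lemma measurable_sup_form l : measurable_fun [set: n.-tuple R] (sup_form l).
Proof.
apply: measurable_bigmax => k; apply: measurable_norm_powR.
exact: measurable_linear_form.
Qed.

Lemma measurable_running_sup l :
  measurable_fun [set: n.-tuple R] (running_sup l).
Proof.
elim: l => [|i l IH] /=; first exact: measurable_cst.
by apply: measurable_maxr => //; exact: (measurable_sup_form (i :: l)).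
Qed.

Lemma running_sup_drop l m e : 0 < r -> sup_form (drop m l) e <= running_sup l e.
Proof.
move=> r0.
have nil0 : sup_form [::] e <= 0.
  rewrite /sup_form; apply: (big_ind (fun x => x <= 0)) => // [x y|k _]; first by rewrite ge_max => -> ->.
  by rewrite /linear_form big_nil normr0 powR0 ?gt_eqF.
elim: l m => [|i l IH] m //=; case: m => [|m]; first by rewrite le_max lexx orbT.
by rewrite le_max IH.
Qed.

End Maximal.

Lemma max_sqr_le (R : realType) (m s : R) : 0 <= m -> 0 <= s ->
  Num.max m s ^+ 2 <= m ^+ 2 + s ^+ 2.
Proof. by move=> m0 s0; case: (leP m s) => _; have := sqr_ge0 m; have := sqr_ge0 s; lra. Qed.

(** With [M] the maximum of [m] and [s], half the increment of the square is at
    most [s] times the increment: [(M ^+ 2 - m ^+ 2) / 2 <= s * (M - m)]. *)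
Lemma max_potential (R : realType) (m s : R) : 0 <= m -> 0 <= s ->
  2^-1 * Num.max m s ^+ 2 + s * m <= 2^-1 * m ^+ 2 + s * Num.max m s.
Proof. by move=> m0 s0; case: (leP m s) => h; have := sqr_ge0 (s - m); lra. Qed.

(** Doob's inequality in [L^2].  With [S] the last value and [M] the running
    maximum, induction gives [E M^2 / 2 <= E (S M)]: pathwise this is
    [max_potential], and passing from the previous value of the process to the
    next one in front of the old maximum is the submartingale property.  Then
    [S M <= S^2 + M^2 / 4] yields the constant 4. *)
Lemma maximal_inequality (R : realType) (r : R) (dO : measure_display)
    (Omega : measurableType dO) (P : probability Omega R) (n : nat)
    (eps : 'I_n -> {RV P >-> R}) (sigma : R) (K : finType) (a : K -> 'I_n -> R)
    (l : seq 'I_n) :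
  1 <= r -> 0 < sigma -> mutually_independent eps ->
  (forall i, \int[P]_w (eps i w)%:E = 0)%E ->
  (forall i, \int[P]_w (`|eps i w| `^ (2 * r))%:E <= (sigma `^ (2 * r))%:E)%E ->
  uniq l ->
  (\int[P]_w (running_sup a r l (noise eps w) ^+ 2)%:E <=
   4%:E * \int[P]_w (sup_form a r l (noise eps w) ^+ 2)%:E)%E.
Proof.
move=> r1 s0 ind m0 mp.
have p2 : 2 <= 2 * r by lra.
have mN := measurable_noise eps.
have mS l' : measurable_fun setT (fun w => sup_form a r l' (noise eps w)).
  exact: (measurableT_comp (measurable_sup_form a r l') mN).
have mM l' : measurable_fun setT (fun w => running_sup a r l' (noise eps w)).
  exact: (measurableT_comp (measurable_running_sup a r l') mN).
pose S l' w := sup_form a r l' (noise eps w).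
pose M l' w := running_sup a r l' (noise eps w).
have mS2 l' : measurable_fun setT (fun w => S l' w ^+ 2) by apply: (measurable_funX 2 (mS l')).
have mM2 l' : measurable_fun setT (fun w => M l' w ^+ 2) by apply: (measurable_funX 2 (mM l')).
have S0 l' w : 0 <= S l' w by exact: sup_form_ge0.
have M0 l' w : 0 <= M l' w by exact: running_sup_ge0.
have mE (g : Omega -> R) : measurable_fun setT g -> measurable_fun setT (fun w => (g w)%:E).
  by move=> mg; exact/measurable_EFinP.
(* Finiteness allows the cancellations below; a supremum is at most a sum. *)
have finS l' : uniq l' -> (\int[P]_w (S l' w ^+ 2)%:E < +oo)%E.
  move=> ul; have [be be1 /(_ _ _ _ _ _ _ s0 ind m0 mp l') H] := linear_form_moment p2.
  apply: (@le_lt_trans _ _ (\int[P]_w (\sum_(k : K)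
      (`|linear_form l' (a k) (noise eps w)| `^ (2 * r))%:E))%E).
    apply: ge0_le_integral => //.
    - by move=> w _; rewrite lee_fin sqr_ge0.
    - exact: mE.
    - apply: emeasurable_sum => k; apply: mE; apply: measurable_norm_powR.
      exact: (measurableT_comp (measurable_linear_form l' (a k)) mN).
    move=> w _; rewrite sumEFin lee_fin /S.
    case: (sup_form_ex a r l' (noise eps w)) => [->|[k ->]].
      by rewrite expr0n /=; apply: sumr_ge0 => k _; exact: powR_ge0.
    rewrite (bigD1 k) //= -powR_mulrn ?powR_ge0 // -powRrM mulrC lerDl.
    by apply: sumr_ge0 => k' _; exact: powR_ge0.
  rewrite ge0_integral_sum //; last first.
    move=> k; apply: mE; apply: measurable_norm_powR.
    exact: (measurableT_comp (measurable_linear_form l' (a k)) mN).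
  apply: lte_sum_pinfty => k _.
  by apply: (le_lt_trans (H (a k) 1 ul ltr01)); rewrite ltry.
have finM l' : uniq l' -> (\int[P]_w (M l' w ^+ 2)%:E < +oo)%E.
  elim: l' => [|i l' IH] ul.
    rewrite (_ : (fun w => (M [::] w ^+ 2)%:E) = fun=> 0%E); last first.
      by apply/funext => w; rewrite /M /= expr0n.
    by rewrite integral0.
  have ul' : uniq l' by case/andP: ul.
  apply: (@le_lt_trans _ _ (\int[P]_w ((M l' w ^+ 2)%:E + (S (i :: l') w ^+ 2)%:E))%E).
    apply: ge0_le_integral => //.
    - by move=> w _; rewrite lee_fin sqr_ge0.
    - exact: mE.
    - by apply: emeasurable_funD; exact: mE.
    - move=> w _; rewrite -EFinD lee_fin.
      exact: (max_sqr_le (M0 l' w) (S0 (i :: l') w)).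
  rewrite ge0_integralD //; [|by move=> w _; rewrite lee_fin sqr_ge0|exact: mE
    |by move=> w _; rewrite lee_fin sqr_ge0|exact: mE].
  by apply: lte_add_pinfty; [exact: IH|exact: finS].
have half l' : uniq l' ->
    (\int[P]_w (2^-1 * M l' w ^+ 2)%:E <= \int[P]_w (S l' w * M l' w)%:E)%E.
  elim: l' => [_|i l' IH /= /andP[il ul]].
    under eq_integral do rewrite /M /= expr0n /= mulr0.
    by rewrite integral0; apply: integral_ge0 => w _; rewrite lee_fin /M /= mulr0.
  (* The submartingale property, against the previous maximum, which does not
     involve the i-th noise variable: resample that variable and apply
     Jensen's inequality to the form attaining the supremum. *)
  have msub : (\int[P]_w (S l' w * M l' w)%:E <= \int[P]_w (S (i :: l') w * M l' w)%:E)%E.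
    rewrite [leRHS](@resample _ _ _ P n eps ind i
      (fun e => (sup_form a r (i :: l') e * running_sup a r l' e)%:E)); last 2 first.
    - apply/measurable_EFinP; apply: measurable_funM; [exact: measurable_sup_form|exact: measurable_running_sup].
    - by move=> e; rewrite lee_fin mulr_ge0 ?sup_form_ge0 ?running_sup_ge0.
    apply: ge0_le_integral => //.
    - by move=> w _; rewrite lee_fin; apply: mulr_ge0; [exact: S0|exact: M0].
    - by apply: mE; apply: (measurable_funM (mS l') (mM l')).
    - apply: (@measurable_resampled _ _ _ P n eps i
        (fun e => (sup_form a r (i :: l') e * running_sup a r l' e)%:E)).
      + by apply/measurable_EFinP; apply: measurable_funM; [exact: measurable_sup_form|exact: measurable_running_sup].
      + by move=> e; rewrite lee_fin mulr_ge0 ?sup_form_ge0 ?running_sup_ge0.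
    move=> w _; under eq_integral do rewrite running_sup_replace // mulrC EFinM.
    have mR : measurable_fun setT
        (fun w' => sup_form a r (i :: l') (replace_at i (noise eps w) (eps i w'))).
      exact: (measurableT_comp (measurable_sup_form a r (i :: l')) (measurable_replace_at eps i _)).
    rewrite ge0_integralZl_EFin //; [|by move=> w' _; rewrite lee_fin sup_form_ge0|exact: mE
      |exact: M0].
    rewrite mulrC EFinM lee_wpmul2l //; first by rewrite lee_fin; exact: M0.
    rewrite /S; case: (sup_form_ex a r l' (noise eps w)) => [->|[k ->]].
      by apply: integral_ge0 => w' _; rewrite lee_fin sup_form_ge0.
    apply: (le_trans (shift_moment_ge p2 (m0 i) (mp i) (linear_form l' (a k) (noise eps w)) (a k i) r1)).
    apply: ge0_le_integral => //.
    - exact/mE/measurable_affine_powR.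
    - exact: mE.
    - move=> w' _; rewrite lee_fin.
      apply: le_trans (sup_form_ge _ _ _ _ k).
      by rewrite linear_form_cons linear_form_replace // tnth_mktuple eqxx.
  have finl := finM _ ul.
  have fin2 : (\int[P]_w (2^-1 * M l' w ^+ 2)%:E \is a fin_num)%E.
    rewrite ge0_fin_numE; last by apply: integral_ge0 => w _; rewrite lee_fin mulr_ge0 ?sqr_ge0.
    under eq_integral do rewrite EFinM.
    rewrite ge0_integralZl_EFin //; [|by move=> w _; rewrite lee_fin sqr_ge0|exact: mE].
    by rewrite lte_mul_pinfty.
  rewrite -(@leeD2rE _ (\int[P]_w (2^-1 * M l' w ^+ 2)%:E)) //.
  apply: (@le_trans _ _ (\int[P]_w (2^-1 * M (i :: l') w ^+ 2)%:E + \int[P]_w (S (i :: l') w * M l' w)%:E)%E).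
    by rewrite leeD2l // (le_trans (IH ul)).
  have mh l'' : measurable_fun setT (fun w => (2^-1 * M l'' w ^+ 2)%:E).
    by apply: mE; apply: measurable_funM => //; exact: mM2.
  have mSM l1 l2 : measurable_fun setT (fun w => (S l1 w * M l2 w)%:E).
    by apply: mE; apply: (measurable_funM (mS l1) (mM l2)).
  have nh l'' w : (0 <= (2^-1 * M l'' w ^+ 2)%:E)%E.
    by rewrite lee_fin; apply: mulr_ge0 => //; exact: sqr_ge0.
  have nSM l1 l2 w : (0 <= (S l1 w * M l2 w)%:E)%E by rewrite lee_fin; apply: mulr_ge0; [exact: S0|exact: M0].
  rewrite -!ge0_integralD //.
  apply: ge0_le_integral => //.
  - by move=> w _; rewrite adde_ge0.
  - exact: emeasurable_funD.
  - exact: emeasurable_funD.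
  move=> w _; rewrite -!EFinD lee_fin.
  rewrite [leRHS]addrC; exact: (max_potential (M0 l' w) (S0 (i :: l') w)).
move=> ul; have H := half l ul; have fM := finM l ul; have fS := finS l ul.
have H2 : (\int[P]_w (2^-1 * M l w ^+ 2)%:E <=
   \int[P]_w ((S l w ^+ 2)%:E + (4^-1 * M l w ^+ 2)%:E))%E.
  apply: (le_trans H); apply: ge0_le_integral => //.
  - by move=> w _; rewrite lee_fin; apply: mulr_ge0; [exact: S0|exact: M0].
  - by apply: mE; apply: (measurable_funM (mS l) (mM l)).
  - apply: emeasurable_funD; first exact: mE.
    by apply: mE; apply: measurable_funM => //; exact: mM2.
  - move=> w _; rewrite -EFinD lee_fin.
    (* S M <= S^2 + M^2 / 4. *)
    by have := sqr_ge0 (S l w - 2^-1 * M l w); lra.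
move: H2; rewrite ge0_integralD //; [|by move=> w _; rewrite lee_fin sqr_ge0|exact: mE
  |by move=> w _; rewrite lee_fin; apply: mulr_ge0 => //; exact: sqr_ge0
  |by apply: mE; apply: measurable_funM => //; exact: mM2].
have scale c : 0 <= c ->
    (\int[P]_w (c * M l w ^+ 2)%:E = c%:E * \int[P]_w (M l w ^+ 2)%:E)%E.
  move=> c0; under eq_integral do rewrite EFinM.
  rewrite ge0_integralZl_EFin //; last exact: mE.
  by move=> w _; rewrite lee_fin sqr_ge0.
rewrite !scale //.
rewrite -/(M l) -/(S l).
have nM : (0 <= \int[P]_w (M l w ^+ 2)%:E)%E by apply: integral_ge0 => w _; rewrite lee_fin sqr_ge0.
have nS : (0 <= \int[P]_w (S l w ^+ 2)%:E)%E by apply: integral_ge0 => w _; rewrite lee_fin sqr_ge0.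
rewrite -(@fineK _ (\int[P]_w (M l w ^+ 2)%:E)%E) ?ge0_fin_numE //.
rewrite -(@fineK _ (\int[P]_w (S l w ^+ 2)%:E)%E) ?ge0_fin_numE //.
rewrite -!EFinM -EFinD !lee_fin; set x := fine _; set y := fine _ => h.
lra.
Qed.

(** * Maximal inequalities along one lattice direction *)

(** Summation by parts for nonincreasing weights.  The difference from
    [c * \sum b] is what an induction from the head of the list can carry. *)
Lemma abel_bound (R : realType) (I : Type) (l : seq I) (rho b : I -> R) (B c : R) :
  (forall m, `|\sum_(i <- drop m l) b i| <= B) -> 0 <= c ->
  path (fun x y => (0 <= y) && (y <= x)) c [seq rho i | i <- l] ->
  `|\sum_(i <- l) rho i * b i - c * \sum_(i <- l) b i| <= c * B.
Proof.
elim: l c => [|i l IH] c hB c0 /=.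
  move=> _; rewrite !big_nil mulr0 subr0 normr0 mulr_ge0 //.
  exact: le_trans (normr_ge0 _) (hB 0).
move=> /andP[/andP[rho0 rhoc] pl].
have hB' m : `|\sum_(i <- drop m l) b i| <= B by exact: (hB m.+1).
have := IH _ hB' rho0 pl; have := hB 0; rewrite drop0 !big_cons.
set S := \sum_(j <- l) b j; set T := \sum_(j <- l) _ => h1 h2.
have -> : rho i * b i + T - c * (b i + S) = (T - rho i * S) - (c - rho i) * (b i + S) by ring.
apply: (le_trans (ler_normB _ _)); rewrite normrM (ger0_norm (_ : 0 <= c - rho i)) ?subr_ge0//.
have : (c - rho i) * `|b i + S| <= (c - rho i) * B by rewrite ler_wpM2l ?subr_ge0.
lra.
Qed.

(** Truncating at a threshold amounts to taking a suffix, once the list is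
    sorted: a supremum over thresholds is then a running supremum. *)
Lemma filter_sorted_drop (I : Type) (lev : I -> nat) (l : seq I) (t : nat) :
  sorted (fun i j => (lev i <= lev j)%N) l ->
  exists m, [seq i <- l | (t <= lev i)%N] = drop m l.
Proof.
elim: l => [|i l IH] sl; first by exists 0%N.
have sl' : sorted (fun i j => (lev i <= lev j)%N) l by exact: (path_sorted sl).
have [ti|ti] := boolP (t <= lev i)%N; last first.
  by have [m hm] := IH sl'; exists m.+1; rewrite /= (negbTE ti).
exists 0%N; rewrite drop0; apply/all_filterP => /=; rewrite ti /=.
have tr : transitive (fun i j : I => (lev i <= lev j)%N) by move=> ? ? ?; exact: leq_trans.
have := order_path_min tr sl; apply: sub_all => j ij; exact: leq_trans ti ij.
Qed.

Section Directional.
Context {R : realType} {n : nat} {K : finType}.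
Variables (a : K -> 'I_n -> R) (lev : 'I_n -> nat) (t : K -> nat) (rho : nat -> R).
Variable r : R.

(** The shape taken by averages over intervals with moving left end point:
    truncation at a threshold that varies with [k], and a weight normalised to
    be 1 at the threshold. *)
Definition tail_weight k i : R :=
  a k i * (rho (lev i) / rho (t k) * (t k <= lev i)%N%:R).

Definition by_level : seq 'I_n :=
  sort (fun i j => (lev i <= lev j)%N) (enum 'I_n).

(** Pathwise.  On the suffix above the threshold the weights [rho] are
    nonincreasing, so Abel summation bounds the weighted sum by twice the
    largest tail sum, which the running supremum dominates. *)
Lemma tail_sup_le e : 1 <= r -> (forall k, 0 < rho (t k)) ->
  (forall i, 0 <= rho i) -> (forall i j, (i <= j)%N -> rho j <= rho i) ->
  sup_form tail_weight r (enum 'I_n) e <= 2 `^ r * running_sup a r by_level e.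
Proof.
move=> r1 rt rho0 rhoD; have r0 : 0 < r by lra.
set M := running_sup a r by_level e.
have M0 : 0 <= M by exact: running_sup_ge0.
have srt : sorted (fun i j => (lev i <= lev j)%N) by_level.
  by apply: sort_sorted => i j; exact: leq_total.
rewrite /sup_form; apply: bigmax_le; first by rewrite mulr_ge0 ?powR_ge0.
move=> k _; set B := M `^ r^-1.
have B0 : 0 <= B by exact: powR_ge0.
have BM : B `^ r = M by rewrite /B -powRrM mulVf ?powRr1 // gt_eqF.
rewrite -BM -powRM //.
apply: ge0_ler_powR; rewrite ?nnegrE ?(ltW r0) ?mulr_ge0 //.
pose b i := a k i * tnth e i.
have [m hm] := filter_sorted_drop (t k) srt.
have hB m' : `|\sum_(i <- drop m' (drop m by_level)) b i| <= B.
  rewrite drop_drop -[leLHS](@powRr1 R) // -(@mulfV _ r) ?gt_eqF // powRrM.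
  apply: ge0_ler_powR; rewrite ?nnegrE ?invr_ge0 ?(ltW r0) ?powR_ge0//.
  apply: le_trans (running_sup_drop a _ _ _ r0).
  exact: sup_form_ge.
have pth : path (fun x y => (0 <= y) && (y <= x)) (rho (t k))
    [seq rho (lev i) | i <- drop m by_level].
  (* The weights are nonincreasing along a sorted suffix. *)
  have key (s : seq 'I_n) t' : sorted (fun i j => (lev i <= lev j)%N) s ->
      all (fun i => (t' <= lev i)%N) s ->
      path (fun x y => (0 <= y) && (y <= x)) (rho t') [seq rho (lev i) | i <- s].
    elim: s t' => [|i s IH] t' //= sl /andP[ti al].
    rewrite rho0 rhoD //=; apply: IH; first exact: path_sorted sl.
    by apply: (order_path_min _ sl) => ? ? ?; exact: leq_trans.
  rewrite -hm; apply: key; last exact: filter_all.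
  by apply: sorted_filter => // ? ? ?; exact: leq_trans.
have := abel_bound hB (rho0 (t k)) pth.
set S := \sum_(i <- _) b i; set T := \sum_(i <- _) _ => hT.
have hS : `|S| <= B by have := hB 0%N; rewrite drop0.
have -> : linear_form (enum 'I_n) (tail_weight k) e = T / rho (t k).
  have pe : perm_eq by_level (enum 'I_n) by rewrite /by_level perm_sort.
  rewrite /linear_form /T -hm [in RHS]big_filter (perm_big _ pe) /=.
  rewrite [in RHS]big_mkcond /= mulr_suml; apply: eq_bigr => i _.
  by rewrite /tail_weight /b; case: ifP => _; [rewrite mulr1; ring|rewrite !mulr0 !mul0r].
rewrite normrM normfV (gtr0_norm (rt k)) ler_pdivrMr //.
have hcS : `|rho (t k) * S| <= rho (t k) * B.
  by rewrite normrM (gtr0_norm (rt k)) ler_pM2l.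
have -> : T = (T - rho (t k) * S) + rho (t k) * S by ring.
by apply: (le_trans (ler_normD _ _)); lra.
Qed.

End Directional.

(** Truncation and monotone reweighting in one direction cost a constant, even
    if the threshold depends on the member [k] of the family.  The noise is
    listed by level and revealed from the highest level downwards. *)
Lemma directional_maximal (R : realType) (r : R) (dO : measure_display)
    (Omega : measurableType dO) (P : probability Omega R) (n : nat)
    (eps : 'I_n -> {RV P >-> R}) (sigma : R) (K : finType) (a : K -> 'I_n -> R)
    (lev : 'I_n -> nat) (t : K -> nat) (rho : nat -> R) :
  1 <= r -> 0 < sigma -> mutually_independent eps ->
  (forall i, \int[P]_w (eps i w)%:E = 0)%E ->
  (forall i, \int[P]_w (`|eps i w| `^ (2 * r))%:E <= (sigma `^ (2 * r))%:E)%E ->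
  (forall k, 0 < rho (t k)) ->
  (forall i, 0 <= rho i) -> (forall i j, (i <= j)%N -> rho j <= rho i) ->
  (\int[P]_w (sup_form (tail_weight a lev t rho) r (enum 'I_n) (noise eps w) ^+ 2)%:E <=
   (4 * (2 `^ r) ^+ 2)%:E *
   \int[P]_w (sup_form a r (enum 'I_n) (noise eps w) ^+ 2)%:E)%E.
Proof.
move=> r1 s0 ind m0 mp rt rho0 rhoD.
have mN := measurable_noise eps.
have mE (g : Omega -> R) : measurable_fun setT g -> measurable_fun setT (fun w => (g w ^+ 2)%:E).
  by move=> mg; apply/measurable_EFinP; apply: (measurable_funX 2 mg).
have mM : measurable_fun setT (fun w => running_sup a r (by_level lev) (noise eps w)).
  exact: (measurableT_comp (measurable_running_sup a r _) mN).
have ul : uniq (by_level lev) by rewrite sort_uniq enum_uniq.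
have H := maximal_inequality a r1 s0 ind m0 mp ul.
have eS : (\int[P]_w (sup_form a r (by_level lev) (noise eps w) ^+ 2)%:E =
   \int[P]_w (sup_form a r (enum 'I_n) (noise eps w) ^+ 2)%:E)%E.
  apply: eq_integral => w _; congr ((_ ^+ 2)%:E); rewrite /sup_form.
  apply: eq_bigr => k _; rewrite /linear_form.
  by congr (`|_| `^ r); apply: perm_big; rewrite /by_level perm_sort.
rewrite eS in H.
rewrite EFinM muleAC muleC; set c := (2 `^ r) ^+ 2.
have c0 : 0 <= c := sqr_ge0 _.
have hc w : sup_form (tail_weight a lev t rho) r (enum 'I_n) (noise eps w) ^+ 2 <=
    c * running_sup a r (by_level lev) (noise eps w) ^+ 2.
  have h := tail_sup_le a lev (noise eps w) r1 rt rho0 rhoD.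
  rewrite /c -exprMn; apply: lerXn2r; rewrite ?nnegrE; [exact: sup_form_ge0| |exact: h].
  by apply: mulr_ge0; [exact: powR_ge0|exact: running_sup_ge0].
apply: (@le_trans _ _ (c%:E * \int[P]_w (running_sup a r (by_level lev) (noise eps w) ^+ 2)%:E)%E).
  apply: (@integral_le_scale _ _ _ P
    (fun w => sup_form (tail_weight a lev t rho) r (enum 'I_n) (noise eps w) ^+ 2)
    (fun w => running_sup a r (by_level lev) (noise eps w) ^+ 2) c c0 _ _ _ _ hc).
  - by apply: (measurable_funX 2); exact: (measurableT_comp (measurable_sup_form _ r _) mN).
  - by apply: (measurable_funX 2); exact: mM.
  - by move=> w; exact: sqr_ge0.
  - by move=> w; exact: sqr_ge0.
apply: lee_wpmul2l; first by rewrite lee_fin; exact: c0.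
exact: H.
Qed.

(** * Sums of products over the lattice *)

Section LatticeSums.
Context {R : realType} {d : nat} {nn : 'I_d -> nat}.
Implicit Types u v x z : lattice nn.

(** Distributivity for nondependent finite functions, carried over to the
    dependent product by [fprod]. *)
Lemma sum_lattice_prod (F : forall j, 'I_(nn j) -> R) :
  \sum_(x : lattice nn) \prod_(j < d) F j (x j) =
  \prod_(j < d) \sum_(k < nn j) F j k.
Proof.
pose G j := [ffun k : 'I_(nn j) => F j k].
have := @big_fprod R 0 1 *%R +%R 'I_d (fun j => 'I_(nn j)) G.
have E := @bigA_distr_big_dep R 0 1 *%R +%R 'I_d {j : 'I_d & 'I_(nn j)}
  (fun j => tagged_with (fun j => 'I_(nn j)) j) (fun j g => untag 0 (G j) g).
move=> H0; have H := etrans H0 (esym E).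
have {}H : \sum_(t : fprod (fun j : 'I_d => 'I_(nn j) : finType)) \prod_(j < d) G j (t j) =
    \prod_(j < d) \sum_(k < nn j) G j k.
  by rewrite H; apply: eq_bigr => j _; rewrite -(big_tag (fun j k => G j k)).
rewrite -[RHS](_ : \prod_(j < d) \sum_(k < nn j) G j k = _); last first.
  by apply: eq_bigr => j _; apply: eq_bigr => k _; rewrite ffunE.
rewrite -H (reindex (@fprod_of_dffun _ (fun j => 'I_(nn j)))) /=; last first.
  exact/onW_bij/fprod_of_dffun_bij.
apply: eq_bigr => x _; apply: eq_bigr => j _; rewrite fprodE ffunE.
by [].
Qed.

End LatticeSums.

(** * Kernels between harmonic weights and block averages *)

Section BlockKernels.
Context {R : realType} {d : nat} {nn : 'I_d -> nat}.
Local Notation n := (lattice_size nn).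
Variable design : 'I_n -> lattice nn.
Variables x v : lattice nn.

Definition average_kernel (b a z : nat) : R :=
  (a <= z <= b)%N%:R / (b - a).+1%:R.

(** The same weight for all averaging intervals [[c, b]] with [c <= a], yet with
    a sum of squares of the same order [1 / (b - a + 1)] as for the average
    over [[a, b]]: see [sum_harmonic_weight_sqr]. *)
Definition harmonic_weight (b a z : nat) : R :=
  (z <= b)%N%:R / (maxn (b - z).+1 (b - a).+1)%:R.

(** At [k = 0] this does not involve [u], and at [k = d] it averages over the
    block [[u, v]].  Cutting [u] off at [x] gives a sensible kernel for every
    [u], so that suprema can run over the whole lattice. *)
Definition mixed_kernel (k : nat) (u : lattice nn) (i : 'I_n) : R :=
  \prod_(j < d)
    (if (j < k)%N then average_kernel (v j) (minn (u j) (x j)) (design i j)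
     else harmonic_weight (v j) (x j) (design i j)).

(** An average over an interval that extends further to the left is a
    truncation of the harmonic weight times a factor nonincreasing in [z]. *)
Lemma average_kernel_tail (b a c z : nat) : (c <= a)%N ->
  average_kernel b c z =
  harmonic_weight b a z *
   ((maxn (b - z).+1 (b - a).+1)%:R / (maxn (b - c).+1 (b - a).+1)%:R
    * (c <= z)%N%:R).
Proof.
move=> ca; rewrite /average_kernel /harmonic_weight.
have -> : maxn (b - c).+1 (b - a).+1 = (b - c).+1 by lia.
case: (leqP c z) => cz /=; last by rewrite mul0r !mulr0.
have m0 : ((maxn (b - z).+1 (b - a).+1)%:R : R) != 0 by rewrite pnatr_eq0; lia.
by rewrite mulr1 mulrA divfK.
Qed.

(** One more averaged coordinate is an instance of [directional_maximal]. *)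
Lemma mixed_kernelS (k : nat) (kd : (k < d)%N) (j := Ordinal kd) u i :
  mixed_kernel k.+1 u i =
  tail_weight (mixed_kernel k) (fun i => design i j : nat)
    (fun u : lattice nn => minn (u j) (x j))
    (fun z => (maxn (v j - z).+1 (v j - x j).+1)%:R) u i.
Proof.
rewrite /tail_weight /mixed_kernel (bigD1 j) //= [in RHS](bigD1 j) //= ltnS leqnn ltnn.
rewrite (average_kernel_tail _ _ (geq_minr (u j) (x j))).
rewrite [RHS]mulrAC; congr (_ * _).
apply: eq_bigr => j' jj'; rewrite ltnS leq_eqVlt.
by have /negbTE -> : (j' : nat) != k by apply: contra jj' => /eqP e; apply/eqP/val_inj.
Qed.

(** The first [r] terms equal [r ^- 2]; afterwards [1 / (m + 1)^2] is at most
    [1 / m - 1 / (m + 1)] and the sum telescopes. *)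
Lemma sum_harmonic_sqr (r M : nat) : (0 < r)%N ->
  \sum_(m < M) ((maxn m.+1 r)%:R ^- 2 : R) <= 2 / r%:R.
Proof.
move=> r0; have rp : 0 < r%:R :> R by rewrite ltr0n.
have ri : 0 < (r%:R : R)^-1 by rewrite invr_gt0.
(* The partial sums in a form that can be proved by induction. *)
suff H : \sum_(m < M) ((maxn m.+1 r)%:R ^- 2 : R) <=
    if (M <= r)%N then M%:R * r%:R ^- 2 else 2 / r%:R - M%:R^-1.
  apply: (le_trans H); case: leqP => Mr; last first.
    by have : 0 <= (M%:R : R)^-1 by []; lra.
  apply: (@le_trans _ _ (r%:R * r%:R ^- 2)).
    by rewrite ler_wpM2r ?invr_ge0 ?exprn_ge0 ?(ltW rp) // ler_nat.
  have -> : r%:R * r%:R ^- 2 = r%:R^-1 :> R by field; lra.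
  lra.
elim: M => [|M IH]; first by rewrite big_ord0 mul0r.
rewrite big_ord_recr /=.
have [Mr|rM] := leqP M.+1 r.
  move: IH; rewrite ltnW // -natr1 mulrDl mul1r; lra.
have Mp : 0 < M%:R :> R by rewrite ltr0n; lia.
have step : (M.+1%:R ^- 2 : R) <= M%:R^-1 - M.+1%:R^-1.
  rewrite -natr1.
  have -> : M%:R^-1 - (M%:R + 1)^-1 = (M%:R * (M%:R + 1))^-1 :> R by field; lra.
  have h1 : 0 < M%:R * (M%:R + 1) :> R by apply: mulr_gt0 => //; lra.
  have h2 : 0 < (M%:R + 1) ^+ 2 :> R by apply: exprn_gt0; lra.
  by rewrite lef_pV2 ?posrE //; nra.
suff : \sum_(m < M) ((maxn m.+1 r)%:R ^- 2 : R) <= 2 / r%:R - M%:R^-1.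
  by move=> H; apply: (le_trans (lerD H step)); rewrite addrA subrK.
apply: (le_trans IH); case: leqP => // Mr.
have -> : M = r by lia.
by rewrite le_eqVlt; apply/orP; left; apply/eqP; field; lra.
Qed.

Lemma sum_harmonic_weight_sqr (m b a : nat) : (b < m)%N ->
  \sum_(k < m) harmonic_weight b a k ^+ 2 <= 2 / (b - a).+1%:R.
Proof.
move=> bm; rewrite (bigID (fun k : 'I_m => (k < b.+1)%N)) /=.
rewrite [X in _ + X]big1 ?addr0; last first.
  by move=> k /negbTE kb; rewrite /harmonic_weight -ltnS kb mul0r expr0n.
rewrite -(big_ord_widen m (fun k => harmonic_weight b a k ^+ 2) bm).
apply: le_trans (sum_harmonic_sqr b.+1 (ltn0Sn _)).
rewrite (reindex_inj rev_ord_inj) /= le_eqVlt; apply/orP; left; apply/eqP.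
apply: eq_bigr => k _; rewrite /harmonic_weight.
have -> : (b.+1 - k.+1 <= b)%N by lia.
have -> : (b - (b.+1 - k.+1))%N = k by have := ltn_ord k; lia.
by rewrite mul1r exprVn.
Qed.

Hypothesis design_bij : bijective design.

Lemma in_blockE (u w z : lattice nn) :
  (in_block u w z)%:R = \prod_(j < d) (u j <= z j <= w j)%N%:R :> R.
Proof.
rewrite /in_block /lat_le.
have [/andP[/forallP h1 /forallP h2]|h] := boolP (_ && _).
  by rewrite big1 // => j _; rewrite h1 h2.
apply/esym/eqP/prodf_eq0.
have [j hj] : exists j, ~~ (u j <= z j <= w j)%N.
  apply/existsP; rewrite -negb_forall; apply: contra h => /forallP h.
  by apply/andP; split; apply/forallP => j; case/andP: (h j).
by exists j => //; rewrite (negbTE hj).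
Qed.

Lemma sum_interval (m a b : nat) : (b < m)%N -> (a <= b)%N ->
  \sum_(k < m) (a <= k <= b)%N%:R = (b - a).+1%:R :> R.
Proof.
move=> bm ab; rewrite -natr_sum; congr (_%:R).
rewrite -(big_mkord predT (fun k => (a <= k <= b) : nat)) /=.
rewrite (big_cat_nat (n := a)) //=; last lia.
rewrite (big_cat_nat (m := a) (n := b.+1)) //=; last lia.
rewrite big_nat big1 ?add0n; last by move=> k /andP[_ ka]; lia.
rewrite [X in (_ + X)%N]big_nat [X in (_ + X)%N]big1 ?addn0; last first.
  by move=> k /andP[ka _]; lia.
rewrite big_nat (eq_bigr (fun=> 1%N)); last by move=> k hk; lia.
by rewrite -big_nat sum_nat_const_nat; lia.
Qed.

Lemma card_block (u w : lattice nn) : lat_le u w ->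
  #|[pred i : 'I_n | in_block u w (design i)]|%:R =
  \prod_(j < d) (w j - u j).+1%:R :> R.
Proof.
move=> /forallP uw; rewrite -sum1_card natr_sum.
transitivity (\sum_(z : lattice nn | in_block u w z) 1 : R).
  by rewrite [RHS](reindex design) //; exact: onW_bij.
rewrite big_mkcond /=.
transitivity (\sum_(z : lattice nn) \prod_(j < d) (u j <= z j <= w j)%N%:R : R).
  by apply: eq_bigr => z _; rewrite -in_blockE; case: ifP.
rewrite (sum_lattice_prod (fun j k => (u j <= k <= w j)%N%:R)).
by apply: eq_bigr => j _; apply: sum_interval.
Qed.

Lemma mixed_kernel_mean (u : lattice nn) (e : n.-tuple R) :
  lat_le u x -> lat_le x v ->
  linear_form (enum 'I_n) (mixed_kernel d u) e = block_mean design e u v.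
Proof.
move=> /forallP ux /forallP xv.
have uv : lat_le u v by apply/forallP => j; exact: leq_trans (ux j) (xv j).
rewrite /block_mean card_block // big_mkcond mulr_suml /linear_form big_enum /=.
apply: eq_bigr => i _; rewrite /mixed_kernel.
transitivity ((in_block u v (design i))%:R / (\prod_(j < d) (v j - u j).+1%:R) * tnth e i).
  rewrite in_blockE -prodf_div; congr (_ * _); apply: eq_bigr => j _.
  by rewrite ltn_ord /average_kernel (minn_idPl (ux j)).
by case: ifP => _; rewrite ?mul1r ?mul0r // mulrC.
Qed.

Lemma sum_harmonic_weights : lat_le x v ->
  \sum_(i < n) (\prod_(j < d) harmonic_weight (v j) (x j) (design i j)) ^+ 2 <=
  \prod_(j < d) (2 / (v j - x j).+1%:R).
Proof.
move=> /forallP xv.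
have -> : \sum_(i < n) (\prod_(j < d) harmonic_weight (v j) (x j) (design i j)) ^+ 2 =
    \sum_(z : lattice nn) (\prod_(j < d) harmonic_weight (v j) (x j) (z j)) ^+ 2.
  by rewrite [RHS](reindex design) //; exact: onW_bij.
under eq_bigr do rewrite -prodrXl.
rewrite (sum_lattice_prod (fun j k => harmonic_weight (v j) (x j) k ^+ 2)).
apply: ler_prod => j _; rewrite sum_harmonic_weight_sqr // andbT.
by apply: sumr_ge0 => k _; exact: sqr_ge0.
Qed.

End BlockKernels.

(** * Suprema of block means of the noise *)

Definition block_volume (R : realType) (d : nat) (nn : 'I_d -> nat)
  (u v : lattice nn) : R := \prod_(j < d) (v j - u j).+1%:R.

Lemma block_volume_gt0 (R : realType) (d : nat) (nn : 'I_d -> nat)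
  (u v : lattice nn) : 0 < block_volume R u v.
Proof. by apply: prodr_gt0 => j _; rewrite ltr0n. Qed.

(** Each of the [d] passages from harmonic weight to average costs a constant
    factor.  The kernel at the start does not involve [u], so its supremum is a
    single linear form, and its variance is that of the mean over [[x, v]] up
    to the factor [2 ^+ d]. *)
Lemma kernel_moment (R : realType) (r : R) (d : nat) : 1 <= r ->
  exists2 C : R, 0 < C &
  forall (nn : 'I_d -> nat) (design : 'I_(lattice_size nn) -> lattice nn),
  bijective design ->
  forall (dO : measure_display) (Omega : measurableType dO)
    (P : probability Omega R) (eps : 'I_(lattice_size nn) -> {RV P >-> R})
    (sigma : R),
  0 < sigma -> mutually_independent eps ->
  (forall i, \int[P]_w (eps i w)%:E = 0)%E ->
  (forall i, \int[P]_w (`|eps i w| `^ (2 * r))%:E <= (sigma `^ (2 * r))%:E)%E ->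
  forall x v : lattice nn, lat_le x v ->
  (\int[P]_w (sup_form (mixed_kernel design x v d) r
      (enum 'I_(lattice_size nn)) (noise eps w) ^+ 2)%:E <=
    (C * (sigma ^+ 2 / block_volume R x v) `^ r)%:E)%E.
Proof.
move=> r1; have p2 : 2 <= 2 * r by lra.
have [be be1 Hm] := linear_form_moment p2.
pose c := 4 * (2 `^ r) ^+ 2.
have c0 : 0 < c by rewrite /c mulr_gt0 // exprn_gt0 // powR_gt0.
pose b := be * (2 * 2 ^+ d).
have b0 : 0 < b by rewrite /b !mulr_gt0 ?exprn_gt0 //; lra.
exists (c ^+ d * b `^ r); first by rewrite mulr_gt0 ?exprn_gt0 ?powR_gt0.
move=> nn design bd dO Omega P eps sigma s0 ind m0 mp x v xv.
set n := lattice_size nn in design bd eps ind m0 mp *.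
pose E k : \bar R := (\int[P]_w (sup_form (mixed_kernel design x v k) r
      (enum 'I_n) (noise eps w) ^+ 2)%:E)%E.
have Estep k : (k <= d)%N -> (E k <= (c ^+ k)%:E * E 0%N)%E.
  elim: k => [|k IH] kd; first by rewrite expr0 mul1e.
  pose j := Ordinal kd.
  have := @directional_maximal R r _ _ P n eps sigma (lattice nn)
    (mixed_kernel design x v k) (fun i => design i j : nat)
    (fun u : lattice nn => minn (u j) (x j))
    (fun z => (maxn (v j - z).+1 (v j - x j).+1)%:R) r1 s0 ind m0 mp.
  have -> : sup_form (tail_weight (mixed_kernel design x v k)
       (fun i : 'I_n => design i j : nat) (fun u : lattice nn => minn (u j) (x j))
       (fun z => (maxn (v j - z).+1 (v j - x j).+1)%:R)) r (enum 'I_n) =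
    sup_form (mixed_kernel design x v k.+1) r (enum 'I_n).
    apply/funext => e; apply: eq_bigr => u _; congr (`|_| `^ r).
    by apply: eq_bigr => i _; rewrite (mixed_kernelS _ _ _ kd).
  rewrite -/c => H; apply: (le_trans (H _ _ _)).
  - by move=> u; rewrite ltr0n; lia.
  - by move=> i; rewrite ler0n.
  - by move=> i i' ii'; rewrite ler_nat; lia.
  rewrite [in leRHS](exprS c) [in leRHS]EFinM -[leRHS]muleA. apply: lee_wpmul2l; first by rewrite lee_fin ltW.
  by apply: IH; exact: ltnW.
apply: (le_trans (Estep d (leqnn d))).
rewrite -mulrA EFinM; apply: lee_wpmul2l; first by rewrite lee_fin exprn_ge0 // ltW.
have E0 : E 0%N = (\int[P]_w (`|linear_form (enum 'I_n)
   (fun i => \prod_(j < d) harmonic_weight (R:=R) (v j) (x j) (design i j)) (noise eps w)| `^ (2 * r))%:E)%E.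
  apply: eq_integral => w _; congr (_%:E).
  set A := linear_form _ _ _.
  have Au u : linear_form (enum 'I_n) (mixed_kernel design x v 0 u) (noise eps w) = A by [].
  have -> : sup_form (mixed_kernel design x v 0) r (enum 'I_n) (noise eps w) = `|A| `^ r.
    apply/eqP; rewrite eq_le; apply/andP; split; last first.
      by rewrite -(Au x); exact: sup_form_ge.
    by apply: bigmax_le => [|u _]; [exact: powR_ge0|rewrite Au].
  by rewrite -powR_mulrn ?powR_ge0 // -powRrM mulrC.
rewrite E0; have B0 := block_volume_gt0 R x v.
(* Of the order of the variance, so that adding it is harmless. *)
pose eta := 2 ^+ d / block_volume R x v.
have eta0 : 0 < eta by rewrite divr_gt0 ?exprn_gt0.
apply: (le_trans (Hm _ _ _ _ _ _ s0 ind m0 mp _ _ eta (enum_uniq _) eta0)).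
have -> : 2 * r / 2 = r by field.
have rr : 0 <= r by lra.
have SS : \sum_(i <- enum 'I_n) (\prod_(j < d) harmonic_weight (R:=R) (v j) (x j) (design i j)) ^+ 2 <= eta.
  rewrite big_enum /=; apply: (le_trans (sum_harmonic_weights (R:=R) bd xv)).
  by rewrite /eta prodf_div prodr_const card_ord.
rewrite lee_fin -powRM ?(ltW b0) //; last by rewrite divr_ge0 ?sqr_ge0 // ltW.
have S0 : 0 <= \sum_(i <- enum 'I_n) (\prod_(j < d) harmonic_weight (R:=R) (v j) (x j) (design i j)) ^+ 2.
  by apply: sumr_ge0 => i _; exact: sqr_ge0.
apply: ge0_ler_powR => //; rewrite ?nnegrE.
- apply: mulr_ge0; last exact: sqr_ge0.
  by apply: mulr_ge0; [lra | apply: addr_ge0 => //; exact: ltW].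
- apply: mulr_ge0; first exact: ltW.
  by apply: divr_ge0; [exact: sqr_ge0|exact: ltW].
have -> : b * (sigma ^+ 2 / block_volume R x v) = be * (eta + eta) * sigma ^+ 2.
  by rewrite /b /eta; field; rewrite gt_eqF.
rewrite ler_wpM2r ?sqr_ge0 // ler_wpM2l ?lerD2l //; lra.
Qed.

(** * The upper error *)

(** Below the scale [B] the first term dominates, above it the second. *)
Lemma powR_interpolate (R : realType) (q p B c : R) : 0 <= q -> q <= p -> 0 < B ->
  0 <= c -> c `^ q <= B `^ q + B `^ (q - p) * c `^ p.
Proof.
move=> q0 qp B0 c0.
have h1 := powR_ge0 B q; have h2 := powR_ge0 B (q - p); have h3 := powR_ge0 c p.
have [cB|Bc] := leP c B.
  have : c `^ q <= B `^ q by apply: ge0_ler_powR; rewrite ?nnegrE // ltW.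
  by have := mulr_ge0 h2 h3; lra.
have cp : 0 < c by exact: lt_trans Bc.
have -> : c `^ q = c `^ (q - p) * c `^ p.
  by rewrite -powRD ?subrK // (gt_eqF cp) implybT.
have : c `^ (q - p) <= B `^ (q - p).
  rewrite -opprB !powRN lef_pV2 ?posrE ?powR_gt0 //.
  by apply: ge0_ler_powR; rewrite ?nnegrE ?subr_ge0 // ltW.
by move=> h; have := ler_wpM2r h3 h; lra.
Qed.

Lemma powRD_le (R : realType) (q a b : R) : 0 <= q -> 0 <= a -> 0 <= b ->
  (a + b) `^ q <= 2 `^ q * (a `^ q + b `^ q).
Proof.
move=> q0 a0 b0; have ha := powR_ge0 a q; have hb := powR_ge0 b q.
have key u v : 0 <= u -> 0 <= v -> u <= v -> (u + v) `^ q <= 2 `^ q * (u `^ q + v `^ q).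
  move=> u0 v0 uv; have hu := powR_ge0 u q.
  apply: (@le_trans _ _ (2 `^ q * v `^ q)).
    by rewrite -powRM //; apply: ge0_ler_powR; rewrite ?nnegrE //; lra.
  by rewrite ler_wpM2l ?powR_ge0 //; lra.
have [ab|/ltW ba] := leP a b; first exact: key.
by rewrite addrC [X in _ * X]addrC; exact: key.
Qed.

Lemma block_mean_le (R : realType) (d : nat) (nn : 'I_d -> nat)
    (design : 'I_(lattice_size nn) -> lattice nn) (f : lattice nn -> R)
    (e : 'I_(lattice_size nn) -> R) (u v : lattice nn) :
  bijective design -> lat_nondecreasing f -> lat_le u v ->
  block_mean design [tuple f (design i) + e i | i < lattice_size nn] u v <=
  f v + block_mean design [tuple e i | i < lattice_size nn] u v.
Proof.
move=> bd fm uv; rewrite /block_mean.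
have c0 : 0 < #|[pred i : 'I_(lattice_size nn) | in_block u v (design i)]|%:R :> R.
  by rewrite card_block //; exact: block_volume_gt0.
rewrite ler_pdivrMr // mulrDl divfK ?gt_eqF //.
under eq_bigr do rewrite tnth_mktuple.
under [X in _ <= _ + X]eq_bigr do rewrite tnth_mktuple.
rewrite big_split /= lerD2r.
apply: (@le_trans _ _ (\sum_(i < lattice_size nn | in_block u v (design i)) f v)).
  by apply: ler_sum => i /andP[_]; exact: fm.
by rewrite sumr_const mulr_natr.
Qed.

(** Only an upper bound of [h] by some block mean is assumed, so the same
    statement serves the lower error after reflection.  For [q < 2] the noise
    has just two moments; [powR_interpolate] at the noise level [W `^ 2^-1]
    then passes from order [p] to order [q]. *)
Lemma upper_error_moment (R : realType) (q : R) (d : nat) : 1 <= q ->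
  exists2 C : R, 0 < C &
  forall (nn : 'I_d -> nat) (design : 'I_(lattice_size nn) -> lattice nn),
  bijective design ->
  forall (dO : measure_display) (Omega : measurableType dO)
    (P : probability Omega R) (eps : 'I_(lattice_size nn) -> {RV P >-> R})
    (sigma : R),
  0 < sigma -> noise_condition eps q sigma ->
  forall (f : lattice nn -> R), lat_nondecreasing f ->
  forall x v : lattice nn, lat_le x v ->
  forall h : Omega -> R, measurable_fun setT h ->
  (forall w, exists2 u, lat_le u x &
     h w <= block_mean design (observation design eps f w) u v) ->
  (\int[P]_w (Num.max (h w - f x) 0 `^ q)%:E <=
    (C * ((f v - f x) `^ q + (sigma ^+ 2 / block_volume R x v) `^ (q / 2)))%:E)%E.
Proof.
move=> q1; set p := Num.max q 2; set r := p / 2.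
have qp : q <= p by rewrite le_max lexx.
have p2 : 2 <= p by rewrite le_max lexx orbT.
have r1 : 1 <= r by rewrite /r; lra.
have pr : 2 * r = p by rewrite /r; field.
have [C C0 HC] := kernel_moment d r1.
exists (2 `^ q * (1 + C)); first by rewrite mulr_gt0 ?powR_gt0 //; lra.
move=> nn design bd dO Omega P eps sigma s0 [ind m0 mp] f fm x v xv h mh Hh.
have {}m0 i : (\int[P]_w (eps i w)%:E = 0)%E by have := m0 i; rewrite unlock.
have {}mp i : (\int[P]_w (`|eps i w| `^ (2 * r))%:E <= (sigma `^ (2 * r))%:E)%E.
  by have := mp i; rewrite unlock pr.
have {}HC := HC nn design bd dO Omega P eps sigma s0 ind m0 mp x v xv.
set n := lattice_size nn in design bd eps ind m0 mp Hh HC *.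
set W := sigma ^+ 2 / block_volume R x v in HC *.
have W0 : 0 < W by rewrite divr_gt0 ?exprn_gt0 ?block_volume_gt0.
pose S w := sup_form (mixed_kernel design x v d) r (enum 'I_n) (noise eps w).
have S0 w : 0 <= S w by exact: sup_form_ge0.
have mS : measurable_fun setT S.
  exact: (measurableT_comp (measurable_sup_form _ r _) (measurable_noise eps)).
pose B := W `^ 2^-1; have B0 : 0 < B by exact: powR_gt0.
have fvx : 0 <= f v - f x by rewrite subr_ge0 fm.
have pt w : Num.max (h w - f x) 0 `^ q <=
    2 `^ q * ((f v - f x) `^ q + B `^ q) + 2 `^ q * B `^ (q - p) * S w ^+ 2.
  have [u ux hu] := Hh w.
  have uv : lat_le u v.
    by apply/forallP => j; exact: leq_trans (forallP ux j) (forallP xv j).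
  have hb := le_trans hu (block_mean_le (fun i => eps i w) bd fm uv).
  rewrite -/(noise eps w) -(mixed_kernel_mean bd _ ux xv) in hb.
  set L := linear_form _ _ _ in hb.
  have LS : `|L| `^ r <= S w by exact: sup_form_ge.
  (* Z is the supremum of the noise means itself. *)
  pose Z := S w `^ r^-1.
  have Z0 : 0 <= Z by exact: powR_ge0.
  have ZS : Z `^ p = S w ^+ 2.
    by rewrite /Z -powRrM -powR_mulrn // -pr; congr (_ `^ _); field; lra.
  have LZ : L <= Z.
    apply: (le_trans (ler_norm L)).
    have r0 : 0 < r by lra.
    have -> : `|L| = (`|L| `^ r) `^ r^-1 by rewrite -powRrM mulfV ?powRr1 // gt_eqF.
    apply: ge0_ler_powR; rewrite ?nnegrE ?powR_ge0 //; first by rewrite invr_ge0 ltW.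
  have h1 : Num.max (h w - f x) 0 <= (f v - f x) + Z.
    by rewrite ge_max; apply/andP; split; lra.
  apply: (@le_trans _ _ (((f v - f x) + Z) `^ q)).
    apply: ge0_ler_powR; [lra|by rewrite nnegrE le_max lexx orbT| |exact: h1].
    by rewrite nnegrE; apply: addr_ge0.
  apply: (@le_trans _ _ (2 `^ q * ((f v - f x) `^ q + Z `^ q))).
    by apply: powRD_le => //; lra.
  rewrite -mulrA -mulrDr ler_wpM2l ?powR_ge0 // -addrA lerD2l -ZS.
  by apply: powR_interpolate => //; lra.
have k1 : 0 <= 2 `^ q * ((f v - f x) `^ q + B `^ q) by rewrite mulr_ge0 ?addr_ge0 ?powR_ge0.
have k2 : 0 <= 2 `^ q * B `^ (q - p) by rewrite mulr_ge0 ?powR_ge0.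
have mI : measurable_fun setT (fun w => Num.max (h w - f x) 0 `^ q).
  apply: (measurableT_comp (measurable_powR q)); apply: measurable_maxr => //.
  exact: measurable_funB.
have mS2 : measurable_fun setT (fun w => S w ^+ 2) by apply: (measurable_funX 2).
have HI := @integral_le_affine _ _ _ P (fun w => Num.max (h w - f x) 0 `^ q)
  (fun w => S w ^+ 2) _ _ k1 k2 mI mS2 (fun w => powR_ge0 _ _) (fun w => sqr_ge0 _) pt.
apply: (le_trans HI).
apply: (@le_trans _ _ ((2 `^ q * ((f v - f x) `^ q + B `^ q))%:E
    + (2 `^ q * B `^ (q - p))%:E * (C * W `^ r)%:E)%E).
  by rewrite leeD2l // lee_wpmul2l.
have -> : B `^ q = W `^ (q / 2) by rewrite /B -powRrM mulrC.
have E2 : B `^ (q - p) * W `^ r = W `^ (q / 2).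
  rewrite /B -powRrM -powRD ?(gt_eqF W0) ?implybT //; congr (_ `^ _).
  by rewrite /r; field.
rewrite -EFinM -EFinD lee_fin.
have -> : 2 `^ q * B `^ (q - p) * (C * W `^ r) = 2 `^ q * C * W `^ (q / 2) by rewrite -E2; ring.
rewrite -subr_ge0.
have -> : 2 `^ q * (1 + C) * ((f v - f x) `^ q + W `^ (q / 2)) -
   (2 `^ q * ((f v - f x) `^ q + W `^ (q / 2)) + 2 `^ q * C * W `^ (q / 2)) =
   2 `^ q * C * (f v - f x) `^ q by ring.
by rewrite !mulr_ge0 ?powR_ge0 // ltW.
Qed.

(** * The two-sided error *)

Section EstimatorBounds.
Context {R : realType} {d : nat} {nn : 'I_d -> nat}.
Local Notation n := (lattice_size nn).
Variable design : 'I_n -> lattice nn.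
Variable est : n.-tuple R -> lattice nn -> R.
Hypothesis est_block : block_estimator design est.

Lemma lat_le_refl (x : lattice nn) : lat_le x x.
Proof. by apply/forallP => j. Qed.

(** For every fixed [v >= x]: the max-min estimator may take this [v] in its
    inner minimum, the min-max estimator in its outer one. *)
Lemma block_estimator_le y x v : lat_le x v ->
  exists2 u, lat_le u x & est y x <= block_mean design y u v.
Proof.
move=> xv; have [_ /(_ y x) /andP[_ h]] := est_block.
have hmax : est y x <= max_below design y v x.
  apply: (le_trans h); rewrite ge_max; apply/andP; split; last exact: bigmin_le_cond.
  have hu u : lat_le u x -> min_above design y u x <= max_below design y v x.
    move=> ux; apply: (@le_trans _ _ (block_mean design y u v)).
      exact: bigmin_le_cond.
    exact: (le_bigmax_cond _ (fun u => block_mean design y u v)).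
  apply: bigmax_le => [|u]; last exact: hu.
  by apply: hu; exact: lat_le_refl.
suff [u ux eu] : exists2 u, lat_le u x & max_below design y v x = block_mean design y u v.
  by exists u => //; rewrite -eu.
rewrite /max_below; apply: (big_ind (fun m => exists2 u, lat_le u x & m = block_mean design y u v)).
- by exists x => //; exact: lat_le_refl.
- by move=> a b [u ux ->] [u' ux' ->]; case: leP => _; [exists u'|exists u].
- by move=> u ux; exists u.
Qed.

Lemma block_estimator_ge y x u : lat_le u x ->
  exists2 v, lat_le x v & block_mean design y u v <= est y x.
Proof.
move=> ux; have [_ /(_ y x) /andP[h _]] := est_block.
have hmin : min_above design y u x <= est y x.
  apply: le_trans h; rewrite le_min; apply/andP; split.
    exact: (le_bigmax_cond _ (fun u => min_above design y u x)).
  have hv v : lat_le x v -> min_above design y u x <= max_below design y v x.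
    move=> xv; apply: (@le_trans _ _ (block_mean design y u v)).
      exact: bigmin_le_cond.
    exact: (le_bigmax_cond _ (fun u => block_mean design y u v)).
  apply: le_bigmin => [|v]; last exact: hv.
  by apply: hv; exact: lat_le_refl.
suff [v xv ev] : exists2 v, lat_le x v & min_above design y u x = block_mean design y u v.
  by exists v => //; rewrite -ev.
rewrite /min_above; apply: (big_ind (fun m => exists2 v, lat_le x v & m = block_mean design y u v)).
- by exists x => //; exact: lat_le_refl.
- by move=> a b [v xv ->] [v' xv' ->]; case: leP => _; [exists v|exists v'].
- by move=> v xv; exists v.
Qed.

End EstimatorBounds.

Lemma rev_leq (m : nat) (a b : 'I_m) :
  (m - a.+1 <= m - b.+1)%N = (b <= a)%N.
Proof. by have ha := ltn_ord a; have hb := ltn_ord b; apply/idP/idP; lia. Qed.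

Lemma rev_subn (m : nat) (a b : 'I_m) :
  (m - a.+1 - (m - b.+1) = b - a)%N.
Proof. by have ha := ltn_ord a; have hb := ltn_ord b; lia. Qed.

Section Reflection.
Context {R : realType} {d : nat} {nn : 'I_d -> nat}.
Local Notation n := (lattice_size nn).
Implicit Types x u v : lattice nn.

(** Order-reversing.  With [f] replaced by [- f \o mirror] and the data by their
    opposites it exchanges lower and upper errors. *)
Definition mirror x : lattice nn := [ffun j => rev_ord (x j) : 'I_(nn j)].

Lemma mirrorK : involutive mirror.
Proof. by move=> x; apply/ffunP => j; rewrite !ffunE rev_ordK. Qed.

Lemma lat_le_mirror x y : lat_le (mirror x) (mirror y) = lat_le y x.
Proof.
apply: eq_forallb => j; rewrite !ffunE /=.
exact: rev_leq.
Qed.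

Lemma block_volume_mirror x y :
  block_volume R (mirror x) (mirror y) = block_volume R y x.
Proof.
apply: eq_bigr => j _; rewrite !ffunE /=; congr (_.+1%:R).
exact: rev_subn.
Qed.

Lemma in_block_mirror x y z :
  in_block (mirror x) (mirror y) (mirror z) = in_block y x z.
Proof. by rewrite /in_block !lat_le_mirror andbC. Qed.

Lemma block_mean_mirror (design : 'I_n -> lattice nn) (y y' : n.-tuple R) u v :
  (forall i, tnth y' i = - tnth y i) ->
  block_mean (mirror \o design) y' (mirror v) (mirror u) =
  - block_mean design y u v.
Proof.
move=> yy; rewrite /block_mean -mulNr -sumrN; congr (_ / _%:R).
  by apply: eq_big => [i|i _]; [rewrite /= in_block_mirror|rewrite yy].
by apply: eq_card => i; rewrite !inE /= in_block_mirror.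
Qed.

End Reflection.

Lemma noise_conditionN (R : realType) (dO : measure_display)
    (Omega : measurableType dO) (P : probability Omega R) (d : nat)
    (nn : 'I_d -> nat) (eps : 'I_(lattice_size nn) -> {RV P >-> R}) (q sigma : R) :
  noise_condition eps q sigma ->
  noise_condition (fun i => (- (eps i : {mfun Omega >-> R}))%R : {RV P >-> R}) q sigma.
Proof.
move=> [ind m0 mp]; split.
- move=> J A mA.
  have mB i : measurable [set t : R | A i (- t)].
    rewrite -[X in measurable X]setTI.
    exact: (oppr_measurable measurableT (mA i)).
  exact: (ind J (fun i => [set t | A i (- t)]) mB).
- move=> i; have := m0 i; have := mp i; rewrite !unlock => h1 h2.
  have iX : P.-integrable setT (EFin \o eps i).
    by apply: integrable_of_moment h1; rewrite le_max ler1n orbT.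
  rewrite (_ : (fun x => _) = fun w => (- (eps i w)%:E)%E) //.
  rewrite integralN; last exact: integrable_add_def.
  by rewrite h2 oppe0.
- move=> i; have := mp i; rewrite !unlock.
  under [X in _ -> (X <= _)%E]eq_integral do rewrite normrN.
  by [].
Qed.

Lemma measurable_observation (R : realType) (d : nat) (nn : 'I_d -> nat)
    (design : 'I_(lattice_size nn) -> lattice nn) (dO : measure_display)
    (Omega : measurableType dO) (P : probability Omega R)
    (eps : 'I_(lattice_size nn) -> {RV P >-> R}) (f : lattice nn -> R) :
  measurable_fun setT (observation design eps f).
Proof.
apply/measurable_fun_tnthP => i.
apply: (eq_measurable_fun (fun w => f (design i) + eps i w)) => [w _ /=|].
  by rewrite tnth_mktuple.
by apply: measurable_funD => //; exact: measurable_funPT.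
Qed.

(** The upper error goes through [v] and the lower one through [u], by
    [upper_error_moment] for the mirrored design and the opposite noise. *)
Lemma block_error_moment (R : realType) (q : R) (d : nat) : 1 <= q ->
  exists2 C : R, 0 < C &
  forall (nn : 'I_d -> nat) (design : 'I_(lattice_size nn) -> lattice nn),
  bijective design ->
  forall est, block_estimator design est ->
  forall (dO : measure_display) (Omega : measurableType dO)
    (P : probability Omega R) (eps : 'I_(lattice_size nn) -> {RV P >-> R})
    (sigma : R),
  0 < sigma -> noise_condition eps q sigma ->
  forall (f : lattice nn -> R), lat_nondecreasing f ->
  forall u x v : lattice nn, lat_le u x -> lat_le x v ->
  (\int[P]_w (`|est (observation design eps f w) x - f x| `^ q)%:E <=
    (C * (((f v - f x) `^ q + (sigma ^+ 2 / block_volume R x v) `^ (q / 2)) +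
          ((f x - f u) `^ q + (sigma ^+ 2 / block_volume R u x) `^ (q / 2))))%:E)%E.
Proof.
move=> q1; have [C C0 HC] := upper_error_moment d q1.
exists C => // nn design bd est be dO Omega P eps sigma s0 nc f fm u x v ux xv.
pose h w := est (observation design eps f w) x.
have mh : measurable_fun setT h.
  by apply: (measurableT_comp (proj1 be x)); exact: measurable_observation.
have up : (\int[P]_w (Num.max (h w - f x) 0 `^ q)%:E <=
    (C * ((f v - f x) `^ q + (sigma ^+ 2 / block_volume R x v) `^ (q / 2)))%:E)%E.
  apply: (HC _ _ bd _ _ _ _ _ s0 nc f fm x v xv h mh) => w.
  exact: (block_estimator_le be).
have rbd : bijective (@mirror d nn \o design).
  by apply: bij_comp => //; exists (@mirror d nn); exact: mirrorK.
pose f' z := - f (mirror z).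
have fm' : lat_nondecreasing f'.
  by move=> a b ab; rewrite lerN2 fm // lat_le_mirror.
have mh' : measurable_fun setT (fun w => - h w) by exact: measurableT_comp.
have lo : (\int[P]_w (Num.max (- h w - f' (mirror x)) 0 `^ q)%:E <=
    (C * ((f' (mirror u) - f' (mirror x)) `^ q +
      (sigma ^+ 2 / block_volume R (mirror x) (mirror u)) `^ (q / 2)))%:E)%E.
  apply: (HC _ _ rbd _ _ _ _ _ s0 (noise_conditionN nc) f' fm' (mirror x) (mirror u) _
    (fun w => - h w) mh') => [|w]; first by rewrite lat_le_mirror.
  have [v' xv' hv'] := block_estimator_ge be (observation design eps f w) ux.
  exists (mirror v'); first by rewrite lat_le_mirror.
  rewrite (block_mean_mirror design (y := observation design eps f w)); first by rewrite lerN2.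
  by move=> i; rewrite !tnth_mktuple /f' /= mirrorK opprD.
rewrite block_volume_mirror /f' !mirrorK opprK [- f u + f x]addrC in lo.
apply: (@le_trans _ _ (\int[P]_w ((Num.max (h w - f x) 0 `^ q)%:E + (Num.max (- h w + f x) 0 `^ q)%:E))%E).
  apply: ge0_le_integral => //.
  - by apply/measurable_EFinP; apply: measurable_norm_powR; exact: measurable_funB.
  - by apply: emeasurable_funD; apply/measurable_EFinP;
      apply: (measurableT_comp (measurable_powR q)); apply: measurable_maxr => //;
      [exact: measurable_funB|exact: measurable_funD].
  move=> w _; rewrite -EFinD lee_fin -/(h w).
  have A0 := powR_ge0 (Num.max (h w - f x) 0) q.
  have B0 := powR_ge0 (Num.max (- h w + f x) 0) q.
  have [hf|hf] := leP (f x) (h w).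
    rewrite ger0_norm ?subr_ge0 // (max_idPl (_ : 0 <= h w - f x)) ?subr_ge0 //; lra.
  rewrite ltr0_norm ?subr_lt0 // opprB [f x - h w]addrC.
  rewrite (max_idPl (_ : 0 <= - h w + f x)); lra.
have mU : measurable_fun setT (fun w => (Num.max (h w - f x) 0 `^ q)%:E).
  apply/measurable_EFinP; apply: (measurableT_comp (measurable_powR q)).
  by apply: measurable_maxr => //; exact: measurable_funB.
have mL : measurable_fun setT (fun w => (Num.max (- h w + f x) 0 `^ q)%:E).
  apply/measurable_EFinP; apply: (measurableT_comp (measurable_powR q)).
  by apply: measurable_maxr => //; exact: measurable_funD.
have nU w : (0 <= (Num.max (h w - f x) 0 `^ q)%:E)%E by rewrite lee_fin powR_ge0.
have nL w : (0 <= (Num.max (- h w + f x) 0 `^ q)%:E)%E by rewrite lee_fin powR_ge0.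
by rewrite ge0_integralD // mulrDr EFinD leeD.
Qed.

(** * Coordinate shifts *)

(** Truncation makes shifts total.  The default [o] is never returned, it only
    shows that the range is nonempty. *)
Definition clip (m : nat) (o : 'I_m) (k : nat) : 'I_m :=
  insubd o (minn k m.-1).

Lemma clipE (m : nat) (o : 'I_m) (k : nat) : clip o k = minn k m.-1 :> nat.
Proof. by rewrite /clip val_insubd; have := ltn_ord o; case: ifP => //; lia. Qed.

Lemma minn_ord_pred (m : nat) (o : 'I_m) : minn o m.-1 = o.
Proof. by have := ltn_ord o; lia. Qed.

Lemma rev_minn (m : nat) (o : 'I_m) : (m - minn (m - o.+1) m.-1 = o.+1)%N.
Proof. by have := ltn_ord o; lia. Qed.

Lemma sum_ltn_le (N m : nat) : (\sum_(k < N) (k.+1 < m) <= m)%N.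
Proof.
suff : (\sum_(k < N) (k.+1 < m) <= minn N m)%N by lia.
elim: N => [|N IH]; first by rewrite big_ord0.
rewrite big_ord_recr /=; move: IH; set s := bigop _ _ _ => IH.
by case: ltnP => /= h; lia.
Qed.

Section CoordinateUpdates.
Context {R : realType} {d : nat} {nn : 'I_d -> nat}.
Implicit Types (x y : lattice nn) (j : 'I_d) (k m : nat).

Definition upd j k x : lattice nn :=
  [ffun i => (if i == j then clip (x i) k else x i : 'I_(nn i))].

Lemma upd_other j k x i : i != j -> upd j k x i = x i.
Proof. by move=> ij; rewrite ffunE (negbTE ij). Qed.

Lemma upd_same j k x : upd j k x j = minn k (nn j).-1 :> nat.
Proof. by rewrite ffunE eqxx clipE. Qed.

Lemma updK j k x : upd j (x j) (upd j k x) = x.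
Proof.
apply/ffunP => i; apply/val_inj => /=.
have [->|ij] := eqVneq i j; last by rewrite !upd_other.
by rewrite upd_same minn_ord_pred.
Qed.

(** Averaging along the lines in direction [j]: the map exchanging the [j]-th
    coordinate of [x] with [k] is an involution of the index set. *)
Lemma sum_upd (H : lattice nn -> R) j :
  \sum_(x : lattice nn) \sum_(k < nn j) H (upd j k x) =
  (nn j)%:R * \sum_(x : lattice nn) H x.
Proof.
rewrite pair_big /=.
pose phi (p : lattice nn * 'I_(nn j)) := (upd j p.2 p.1, p.1 j).
have phiK : involutive phi.
  move=> [x k]; rewrite /phi /= updK; congr (_, _); apply/val_inj => /=.
  by rewrite upd_same minn_ord_pred.
transitivity (\sum_(p : lattice nn * 'I_(nn j)) H (phi p).1) => //.
rewrite -(reindex_inj (inv_inj phiK) (P := predT) (F := fun p => H p.1)) /=.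
rewrite -(pair_big predT predT (fun x (k : 'I_(nn j)) => H x)) /=.
rewrite mulr_sumr; apply: eq_bigr => x _.
by rewrite sumr_const card_ord mulr_natl.
Qed.

(** Each of the [m] unit shifts telescopes to the total increase. *)
Lemma sum_shift1 (phi : nat -> R) (N m : nat) :
  (forall a b, (a <= b)%N -> (b < N)%N -> phi a <= phi b) -> (0 < N)%N ->
  \sum_(k < N) (phi (minn (k + m) N.-1) - phi k) <= m%:R * (phi N.-1 - phi 0%N).
Proof.
case: N => // N phim _ /=.
(* A single unit shift; the shift by m + 1 is a unit shift of the function
   already shifted by m. *)
have tel (psi : nat -> R) :
    \sum_(k < N.+1) (psi (minn k.+1 N) - psi k) = psi N - psi 0%N.
  rewrite big_ord_recr /= (minn_idPr (leqnSn N)) subrr addr0.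
  rewrite -[RHS](telescope_sumr psi (leq0n N)) big_mkord.
  by apply: eq_bigr => k _; rewrite (minn_idPl (ltn_ord k)).
elim: m => [|m IH].
  rewrite mul0r big1 // => k _; rewrite addn0 (minn_idPl _) ?subrr //.
  by rewrite -ltnS.
have -> : \sum_(k < N.+1) (phi (minn (k + m.+1) N) - phi k) =
   \sum_(k < N.+1) (phi (minn (minn k.+1 N + m) N) - phi (minn (k + m) N)) +
   \sum_(k < N.+1) (phi (minn (k + m) N) - phi k).
  rewrite -big_split /=; apply: eq_bigr => k _.
  have -> : minn (minn k.+1 N + m) N = minn (k + m.+1) N by lia.
  by rewrite addrA subrK.
rewrite (tel (fun k => phi (minn (k + m) N))) -natr1 mulrDl mul1r addrC.
apply: lerD => //; apply: lerD; first by apply: phim; lia.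
by rewrite lerN2; apply: phim; lia.
Qed.

Lemma lat_le_trans (x y z : lattice nn) : lat_le x y -> lat_le y z -> lat_le x z.
Proof.
by move=> /forallP xy /forallP yz; apply/forallP => j; exact: leq_trans (xy j) (yz j).
Qed.

Lemma lat_le_upd j a b x : (a <= b)%N -> lat_le (upd j a x) (upd j b x).
Proof.
move=> ab; apply/forallP => i; have [->|ij] := eqVneq i j.
  by rewrite !upd_same leq_min geq_minr andbT geq_min ab.
by rewrite !upd_other.
Qed.

Definition raise j m x : lattice nn := upd j (x j + m) x.

Lemma lat_le_raise j m x y : lat_le x y -> lat_le (raise j m x) (raise j m y).
Proof.
move=> /forallP xy; apply/forallP => i; have [->|ij] := eqVneq i j.
  by rewrite !upd_same leq_min geq_minr andbT geq_min leq_add2r xy.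
by rewrite !upd_other.
Qed.

Variable hn : forall j, (0 < nn j)%N.

Lemma lat_le_top x : lat_le x (lat_top hn).
Proof. by apply/forallP => j; rewrite ffunE /= -ltnS prednK. Qed.

Lemma lat_le_one x : lat_le (lat_one hn) x.
Proof. by apply/forallP => j; rewrite ffunE. Qed.

(** On every line in direction [j] the weight [g] is constant and [sum_shift1]
    applies; the factor [1 / nn j] comes from averaging over the line. *)
Lemma sum_raise (f g : lattice nn -> R) (A : R) j m :
  lat_nondecreasing f -> f (lat_top hn) - f (lat_one hn) <= A ->
  (forall x, 0 <= g x) -> (forall k x, g (upd j k x) = g x) ->
  \sum_(x : lattice nn) g x * (f (raise j m x) - f x) <=
  m%:R * A / (nn j)%:R * \sum_(x : lattice nn) g x.
Proof.
move=> fm fA g0 gj.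
have n0 : 0 < (nn j)%:R :> R by rewrite ltr0n.
rewrite -(ler_pM2l n0) -sum_upd mulrA mulrCA divff ?gt_eqF // mulr1 mulr_sumr.
apply: ler_sum => x _; under eq_bigr do rewrite gj.
rewrite -mulr_sumr [leRHS]mulrC ler_wpM2l //.
have /= := @sum_shift1 (fun k => f (upd j k x)) (nn j) m.
move=> H; apply: le_trans (le_trans (H _ _) _) => //.
- rewrite le_eqVlt; apply/orP; left; apply/eqP; apply: eq_bigr => k _.
  congr (f _ - _); apply/ffunP => i; apply/val_inj.
  have [->|ij] := eqVneq i j; last by rewrite !upd_other.
  by rewrite /= !upd_same minn_ord_pred -minnA minnn.
- by move=> a b ab _; apply: fm; exact: lat_le_upd.
- rewrite ler_wpM2l //; apply: le_trans fA.
  by apply: lerB; apply: fm; [exact: lat_le_top|exact: lat_le_one].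
Qed.

Definition raise_all (l : seq 'I_d) m x : lattice nn := foldr (fun j => raise j m) x l.

(** Raising several coordinates is a succession of single raises, as the raised
    function is again nondecreasing with no larger total increase. *)
Lemma sum_raise_all (l : seq 'I_d) (f g : lattice nn -> R) (A : R) m :
  lat_nondecreasing f -> f (lat_top hn) - f (lat_one hn) <= A ->
  (forall x, 0 <= g x) -> (forall j k x, j \in l -> g (upd j k x) = g x) ->
  \sum_(x : lattice nn) g x * (f (raise_all l m x) - f x) <=
  m%:R * A * (\sum_(j <- l) (nn j)%:R^-1) * \sum_(x : lattice nn) g x.
Proof.
elim: l f => [|j l IH] f fm fA g0 gl /=.
  by rewrite big_nil mulr0 mul0r big1 // => x _; rewrite subrr mulr0.
pose F x := f (raise j m x).
have Fm : lat_nondecreasing F by move=> x y xy; apply: fm; exact: lat_le_raise.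
have FA : F (lat_top hn) - F (lat_one hn) <= A.
  by apply: le_trans fA; apply: lerB; apply: fm; [exact: lat_le_top|exact: lat_le_one].
have H1 := IH F Fm FA g0 (fun j' k x jl => gl j' k x (@mem_behead _ (j :: l) j' jl)).
have H2 := sum_raise m fm fA g0 (fun k x => gl j k x (mem_head _ _)).
rewrite big_cons mulrDr mulrDl addrC.
apply: le_trans (lerD H1 H2); rewrite -big_split /=.
by apply: ler_sum => x _; rewrite -mulrDr addrA subrK.
Qed.

Lemma raise_allE (l : seq 'I_d) m x j : uniq l ->
  raise_all l m x j = (if j \in l then minn (x j + m) (nn j).-1 else x j) :> nat.
Proof.
elim: l => //= i l IH /andP[il ul]; rewrite inE.
have [ji|ij] /= := eqVneq j i.
  by rewrite ji upd_same -ji IH // ji (negbTE il).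
by rewrite upd_other // IH.
Qed.

(** On every line in direction [j] at most [m] points lie that close to the top. *)
Lemma sum_boundary (g : lattice nn -> R) j m :
  (forall x, 0 <= g x) -> (forall k x, g (upd j k x) = g x) ->
  \sum_(x : lattice nn) g x * (nn j - x j < m)%N%:R <=
  m%:R / (nn j)%:R * \sum_(x : lattice nn) g x.
Proof.
move=> g0 gj; have n0 : 0 < (nn j)%:R :> R by rewrite ltr0n.
rewrite -(ler_pM2l n0) -sum_upd mulrA mulrCA divff ?gt_eqF // mulr1 mulr_sumr.
apply: ler_sum => x _; under eq_bigr do rewrite gj.
rewrite -mulr_sumr [leRHS]mulrC ler_wpM2l // -natr_sum ler_nat.
rewrite (reindex_inj rev_ord_inj) /=.
have -> : (\sum_(k < nn j) (nn j - upd j (nn j - k.+1) x j < m) =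
    \sum_(k < nn j) (k.+1 < m))%N.
  by apply: eq_bigr => k _; rewrite upd_same rev_minn.
exact: sum_ltn_le.
Qed.

End CoordinateUpdates.

(** * Geometric and power sums *)

Section DyadicSums.
Context {R : realType}.
Implicit Types (a b t z w al : R) (L m : nat).

Lemma powR_exprn w al m : 0 <= w -> (w ^+ m) `^ al = (w `^ al) ^+ m.
Proof.
by move=> w0; rewrite -(powR_mulrn m w0) -(powR_mulrn m (powR_ge0 w al)) powRAC.
Qed.

Lemma powR2_gt1 (e : R) : 0 < e -> 1 < 2 `^ e.
Proof.
move=> e0; rewrite /powR pnatr_eq0 /= expR_gt1 mulr_gt0 // ln_gt0 //.
by rewrite ltr1n.
Qed.

Lemma powR2_lt1 (e : R) : e < 0 -> 2 `^ e < 1.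
Proof.
move=> e0; rewrite -[e]opprK powRN invf_lt1 ?powR_gt0 //.
by apply: powR2_gt1; rewrite oppr_gt0.
Qed.

Lemma geometric_le z L : 0 <= z -> z < 1 ->
  \sum_(i < L) z ^+ i <= (1 - z)^-1.
Proof.
move=> z0 z1; have z2 : 0 < 1 - z by lra.
rewrite -[leRHS]mul1r ler_pdivlMr //.
suff -> : (\sum_(i < L) z ^+ i) * (1 - z) = 1 - z ^+ L by rewrite gerBl exprn_ge0.
elim: L => [|L IH]; first by rewrite big_ord0 expr0; ring.
by rewrite big_ord_recr /= mulrDl IH exprS; ring.
Qed.

Lemma geometric_ge w L : 1 < w ->
  \sum_(i < L) w ^+ i <= w ^+ L / (w - 1).
Proof.
move=> w1; have w2 : 0 < w - 1 by lra.
rewrite ler_pdivlMr //.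
suff -> : (\sum_(i < L) w ^+ i) * (w - 1) = w ^+ L - 1 by lra.
elim: L => [|L IH]; first by rewrite big_ord0 expr0; ring.
by rewrite big_ord_recr /= mulrDl IH exprS; ring.
Qed.

(** At the balance point [t * x `^ b = 1] the quantity [x `^ (- a)] equals
    [t `^ (a / b)]; both parts compare with that point. *)
Lemma powR_ratio t x a b : 0 < t -> 0 < b -> 0 <= a -> 0 < x ->
  (1 <= t * x `^ b -> x `^ (- a) <= t `^ (a / b)) /\
  (t * x `^ b <= 1 -> a <= b -> t * x `^ (b - a) <= t `^ (a / b)).
Proof.
move=> t0 b0 a0 x0; have ab0 : 0 <= a / b by rewrite divr_ge0 // ltW.
have xb : 0 < x `^ b by exact: powR_gt0.
have xa : 0 < x `^ a by exact: powR_gt0.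
have e : (t * x `^ b) `^ (a / b) = t `^ (a / b) * x `^ a.
  rewrite powRM ?ltW // -[(x `^ b) `^ _]powRrM; congr (_ * _ `^ _).
  by field; rewrite gt_eqF.
split=> h.
  rewrite powRN -[leLHS]mul1r ler_pdivrMr // -e.
  by rewrite -(powRr0 (t * x `^ b)); exact: ler_powR.
move=> ab; rewrite powRB ?(gt_eqF x0) ?implybT // mulrA ler_pdivrMr // -e.
apply: ger1_powR; first by rewrite mulr_gt0.
by rewrite ler_pdivrMr // mul1r.
Qed.

Section TwoSided.
Variables (a b t : R).
Hypotheses (a0 : 0 < a) (ab : a < b) (t0 : 0 < t).
Let z : R := 2 `^ (- a).
Let w : R := 2 `^ (b - a).
Let T : R := t `^ (a / b).
Let P (i : nat) := 1 <= t * (2 ^+ i) `^ b.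

Let b0 : 0 < b. Proof. exact: lt_trans ab. Qed.
Let two0 i : 0 < (2 : R) ^+ i. Proof. by rewrite exprn_gt0. Qed.

Let Pmono i : P i -> P i.+1.
Proof.
move=> h; apply: (le_trans h); rewrite ler_pM2l ?t0 //.
apply: ge0_ler_powR; rewrite ?nnegrE ?(ltW (two0 _)) ?(ltW b0) //.
by rewrite exprS ler_peMl ?ler1n // ltW.
Qed.

Let z_small i : P i -> z ^+ i <= T.
Proof.
move=> h; rewrite -powR_exprn //.
exact: (proj1 (powR_ratio t0 b0 (ltW a0) (two0 i)) h).
Qed.

Let z01 : 0 <= z /\ z < 1.
Proof.
split; first exact: powR_ge0.
by apply: powR2_lt1; rewrite oppr_lt0.
Qed.

Let w1 : 1 < w.
Proof. by apply: powR2_gt1; rewrite subr_gt0. Qed.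

(** Here [P i] says that [z ^+ i <= t * w ^+ i].  Once true it stays true, and
    the first such term is at most [T]. *)
Lemma large_scales_sum L : \sum_(i < L | P i) z ^+ i <= T / (1 - z).
Proof.
have [z0 z1] := z01; have z2 : 0 < 1 - z by rewrite subr_gt0.
(* The summation may start at any scale, so the induction keeps track of
   whether it has started. *)
have H : (P L -> \sum_(i < L | P i) z ^+ i <= (T - z ^+ L) / (1 - z)) /\
         (~~ P L -> \sum_(i < L | P i) z ^+ i = 0).
  elim: L => [|L [IH1 IH2]].
    split; last by rewrite big_ord0.
    by move=> h; rewrite big_ord0 divr_ge0 ?(ltW z2) // subr_ge0 z_small.
  have [PL|nPL] := boolP (P L).
    split; last by rewrite Pmono.
    move=> _; rewrite big_mkcond big_ord_recr -big_mkcond /= PL.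
    apply: (le_trans (lerD (IH1 PL) (lexx _))).
    by rewrite le_eqVlt; apply/orP; left; apply/eqP; rewrite exprS; field; rewrite gt_eqF.
  have e : \sum_(i < L.+1 | P i) z ^+ i = 0.
    by rewrite big_mkcond big_ord_recr -big_mkcond /= (negbTE nPL) addr0 IH2.
  by split => // h; rewrite e divr_ge0 ?(ltW z2) // subr_ge0 z_small.
have [PL|nPL] := boolP (P L).
  apply: (le_trans (proj1 H PL)); rewrite ler_pM2r ?invr_gt0 //.
  by rewrite gerBl exprn_ge0.
by rewrite (proj2 H nPL) divr_ge0 ?(ltW z2) // powR_ge0.
Qed.

(** The terms grow geometrically, and the last one is at most [T]. *)
Lemma small_scales_sum L : \sum_(i < L | ~~ P i) t * w ^+ i <= w / (w - 1) * T.
Proof.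
have w2 : 0 < w - 1 by rewrite subr_gt0.
have T0 : 0 <= T := powR_ge0 _ _.
elim: L => [|L IH].
  rewrite big_ord0; apply: mulr_ge0 => //; apply: divr_ge0; last exact: ltW.
  exact: powR_ge0.
have [PL|nPL] := boolP (P L).
  by rewrite big_mkcond big_ord_recr -big_mkcond /= PL addr0.
rewrite big_mkcond /=; apply: (@le_trans _ _ (\sum_(i < L.+1) t * w ^+ i)).
  apply: ler_sum => i _; case: ifP => // _.
  by apply: mulr_ge0; [exact: ltW|apply: exprn_ge0; exact: powR_ge0].
rewrite -mulr_sumr; apply: (@le_trans _ _ (t * (w ^+ L.+1 / (w - 1)))).
  by rewrite ler_pM2l ?t0 // geometric_ge.
have -> : t * (w ^+ L.+1 / (w - 1)) = w / (w - 1) * (t * w ^+ L) by rewrite exprS; ring.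
rewrite ler_wpM2l //; first by apply: divr_ge0; [exact: powR_ge0|exact: ltW].
rewrite /w -powR_exprn //.
apply: (proj2 (powR_ratio t0 b0 (ltW a0) (two0 L))); last exact: ltW.
by move: nPL; rewrite /P -ltNge; exact: ltW.
Qed.

End TwoSided.

(** The scale where the two sequences cross decides if [a < b], the scale
    [i = 0] if [b < a]; when [a = b] the second sequence is constant and all
    [L] scales count. *)
Lemma dyadic_min_sum a b : 0 < a -> 0 < b -> exists2 C : R, 0 < C &
  forall t L, 0 <= t ->
  \sum_(i < L) Num.min ((2 `^ (- a)) ^+ i) (t * (2 `^ (b - a)) ^+ i) <=
  C * t `^ Num.min 1 (a / b) * L%:R ^+ (a == b).
Proof.
move=> a0 b0.
have w0 e i : 0 <= (2 `^ e : R) ^+ i by rewrite exprn_ge0 ?powR_ge0.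
have ub t L : \sum_(i < L) Num.min ((2 `^ (- a)) ^+ i) (t * (2 `^ (b - a)) ^+ i) <=
    t * \sum_(i < L) (2 `^ (b - a)) ^+ i.
  by rewrite mulr_sumr; apply: ler_sum => i _; rewrite ge_min lexx orbT.
have [ab|ba|ab] := ltrgtP a b.
- have h1 : 0 < 1 - 2 `^ (- a) :> R.
    by rewrite subr_gt0 powR2_lt1 // oppr_lt0.
  have w1 : 1 < 2 `^ (b - a) :> R.
    by rewrite powR2_gt1 // subr_gt0.
  set w : R := 2 `^ (b - a) in w1 *; set z : R := 2 `^ (- a) in h1 *.
  exists ((1 - z)^-1 + w / (w - 1)).
    by apply: addr_gt0; rewrite ?invr_gt0 // divr_gt0 //; lra.
  move=> t L; rewrite le_eqVlt => /predU1P[<-|t0].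
    rewrite powR0; last by rewrite gt_eqF // lt_min ltr01 divr_gt0.
    rewrite mulr0 mul0r; apply: sumr_le0 => i _.
    by rewrite mul0r ge_min lexx orbT.
  rewrite expr0 mulr1 (min_idPr _); last by rewrite ler_pdivrMr // mul1r ltW.
  rewrite (bigID (fun i : 'I_L => 1 <= t * (2 ^+ i) `^ b)) /= mulrDl.
  apply: lerD.
    rewrite mulrC; apply: le_trans (large_scales_sum a0 ab t0 L).
    by apply: ler_sum => i _; rewrite ge_min lexx.
  apply: le_trans (small_scales_sum a0 ab t0 L).
  by apply: ler_sum => i _; rewrite ge_min lexx orbT.
- have h1 : 0 < 1 - 2 `^ (b - a) :> R.
    by rewrite subr_gt0 powR2_lt1 // subr_lt0.
  exists (1 - 2 `^ (b - a))^-1; first by rewrite invr_gt0.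
  move=> t L t0; rewrite expr0 mulr1 (min_idPl _); last by rewrite ler_pdivlMr // mul1r ltW.
  rewrite powRr1 // mulrC; apply: (le_trans (ub t L)).
  rewrite ler_wpM2l // geometric_le ?powR_ge0 //; lra.
- exists 1 => // t L t0; have := ub t L; rewrite -ab divff ?gt_eqF // minxx powRr1 // mul1r.
  rewrite subrr powRr0 => h; apply: (le_trans h).
  by under eq_bigr do rewrite expr1n; rewrite sumr_const card_ord.
Qed.

Definition power_sum al m : R := \sum_(1 <= k < m.+1) k%:R `^ (- al).

Lemma power_sum_ge0 al m : 0 <= power_sum al m.
Proof. by apply: sumr_ge0 => k _; exact: powR_ge0. Qed.

Lemma powR_anti al x y : 0 <= al -> 0 < x -> x <= y -> y `^ (- al) <= x `^ (- al).
Proof.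
move=> al0 x0 xy; have y0 : 0 < y by exact: lt_le_trans xy.
rewrite !powRN lef_pV2 ?posrE ?powR_gt0 //.
by apply: ge0_ler_powR; rewrite ?nnegrE // ltW.
Qed.

(** Cauchy condensation. *)
Lemma power_sum_dyadic al L : 0 <= al ->
  power_sum al (2 ^ L).-1 <= \sum_(i < L) (2 `^ (1 - al)) ^+ i.
Proof.
move=> al0; rewrite /power_sum prednK ?expn_gt0 //.
elim: L => [|L IH]; first by rewrite big_geq // big_ord0.
rewrite (@big_cat_nat _ _ _ (2 ^ L)) ?expn_gt0 //=; last by rewrite leq_exp2l.
rewrite big_ord_recr /=; apply: lerD => //.
apply: (@le_trans _ _ (\sum_(2 ^ L <= k < 2 ^ L.+1) ((2 ^+ L) `^ (- al) : R))).
  rewrite big_nat [leRHS]big_nat; apply: ler_sum => k /andP[kL _].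
  apply: powR_anti => //.
  by rewrite -natrX ler_nat.
rewrite sumr_const_nat expnS mul2n -addnn addnK -[leLHS]mulr_natl natrX.
rewrite -powR_exprn // powRD; last by rewrite expf_eq0 pnatr_eq0 andbF implybT.
by rewrite powRr1 // exprn_ge0.
Qed.

Lemma power_sum_monotone al m m' : (m <= m')%N -> power_sum al m <= power_sum al m'.
Proof.
move=> mm; rewrite /power_sum (@big_cat_nat _ _ _ m.+1 1 m'.+1) //=.
by rewrite lerDl; apply: sumr_ge0 => k _; exact: powR_ge0.
Qed.

(** Of [K] consecutive stretches of length [M], the first has the largest sum. *)
Lemma power_sum_scale al K M : 0 <= al ->
  power_sum al (K * M) <= K%:R * power_sum al M.
Proof.
move=> al0; elim: K => [|K IH].
  by rewrite mul0n /power_sum big_geq // mul0r.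
have KM : (K * M <= K.+1 * M)%N by rewrite leq_mul2r leqnSn orbT.
rewrite {1}/power_sum (@big_cat_nat _ _ _ (K * M).+1 1 (K.+1 * M).+1) //=.
rewrite -natr1 mulrDl mul1r; apply: lerD => //.
rewrite /power_sum -{1}[(K * M).+1]addn1 addnC.
have -> : (K.+1 * M).+1 = (M.+1 + K * M)%N by rewrite mulSn addSn.
rewrite big_addn addnK big_nat [leRHS]big_nat; apply: ler_sum => k /andP[k1 _].
apply: powR_anti => //; first by rewrite ltr0n.
by rewrite ler_nat leq_addr.
Qed.

(** [L] is the number of binary digits of [m]. *)
Lemma dyadic_level : exists2 C : R, 0 < C &
  forall m n : nat, (0 < m)%N -> (m <= n)%N -> (2 <= n)%N ->
  exists L : nat, [/\ (m < 2 ^ L)%N, (2 ^ L <= 2 * m)%N & L%:R <= C * ln n%:R].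
Proof.
have l2 : 0 < ln 2 :> R by rewrite ln_gt0 // ltr1n.
exists (2 / ln 2); first by rewrite divr_gt0.
move=> m n m0 mn n2; have n0 : 0 < n%:R :> R by rewrite ltr0n; lia.
have n0' : (0 < n)%N by lia.
have /andP[h1 h2] := trunc_log_bounds (ltnSn 1) m0.
exists (trunc_log 2 m).+1; split; [exact: h2|by rewrite expnS leq_mul2l h1 orbT|].
have h3 : (trunc_log 2 m)%:R * ln 2 <= ln n%:R :> R.
  rewrite mulr_natl -lnXn // -natrX ler_ln ?posrE ?ltr0n ?expn_gt0 //.
  by rewrite ler_nat (leq_trans h1).
have h4 : ln 2 <= ln n%:R :> R by rewrite ler_ln ?posrE // ler_nat.
rewrite mulrAC ler_pdivlMr // -natr1 mulrDl mul1r; lra.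
Qed.

(** After condensation the sum is geometric, with ratio larger than, smaller
    than or equal to 1 according to the position of [al] relative to 1. *)
Lemma power_sum_log al : 0 <= al -> exists2 C : R, 0 < C &
  forall m n : nat, (0 < m)%N -> (m <= n)%N -> (2 <= n)%N ->
  power_sum al m <= C * m%:R `^ Num.max 0 (1 - al) * ln n%:R ^+ (al == 1).
Proof.
move=> al0.
have [K K0 Hlev] := dyadic_level.
have ub m L : (m < 2 ^ L)%N -> power_sum al m <= \sum_(i < L) (2 `^ (1 - al)) ^+ i.
  move=> mL; apply: le_trans (power_sum_dyadic L al0); apply: power_sum_monotone.
  by rewrite -ltnS prednK ?expn_gt0.
have [al1|al1|al1] := ltrgtP al 1.
- have w1 : 1 < 2 `^ (1 - al) :> R by rewrite powR2_gt1 // subr_gt0.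
  set w : R := 2 `^ (1 - al) in w1 ub *.
  exists (w / (w - 1)); first by rewrite divr_gt0 //; lra.
  move=> m n m0 mn n2; rewrite expr0 mulr1 (max_idPr _); last by rewrite subr_ge0 ltW.
  have [L [h1 h2 _]] := Hlev m n m0 mn n2.
  apply: (le_trans (ub _ _ h1)); apply: (le_trans (geometric_ge _ w1)).
  rewrite mulrAC ler_pM2r ?invr_gt0 ?subr_gt0 // /w -powR_exprn // -powRM //.
  apply: ge0_ler_powR; rewrite ?nnegrE ?subr_ge0 ?(ltW al1) ?mulr_ge0 ?exprn_ge0 //.
  by rewrite -natrX -natrM ler_nat.
- have h1 : 2 `^ (1 - al) < 1 :> R by rewrite powR2_lt1 // subr_lt0.
  exists (1 - 2 `^ (1 - al))^-1; first by rewrite invr_gt0 subr_gt0.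
  move=> m n m0 mn n2; rewrite expr0 mulr1 (max_idPl _); last by rewrite subr_le0 ltW.
  rewrite powRr0 mulr1; have [L [h2 _ hL]] := Hlev m n m0 mn n2.
  by apply: (le_trans (ub _ _ h2)); rewrite geometric_le // powR_ge0.
- exists K => // m n m0 mn n2; rewrite al1 subrr maxxx powRr0 mulr1 expr1.
  have [L [h2 _ hL]] := Hlev m n m0 mn n2.
  apply: le_trans hL.
  have := ub _ _ h2; rewrite al1 subrr powRr0 => h; apply: (le_trans h).
  by under eq_bigr do rewrite expr1n; rewrite sumr_const card_ord.
Qed.

End DyadicSums.

(** * Corners of dyadic cubes *)

Lemma predn_subS (m : nat) (o : 'I_m) : (m.-1 - o).+1 = (m - o)%N.
Proof. by have := ltn_ord o; lia. Qed.

Lemma clipped_width (m u k : nat) : (0 < k)%N -> (k <= m - u)%N ->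
  (minn (u + k.-1) m.-1 - u).+1 = k.
Proof. by lia. Qed.

Section Selection.
Context {R : realType} {d : nat} {nn : 'I_d -> nat}.
Variables (hn : forall j, (0 < nn j)%N) (S : {set 'I_d}).
Implicit Types (x y v : lattice nn) (f g : lattice nn -> R).

Definition complement_volume x : R := \prod_(j | j \notin S) (nn j - x j)%:R.

(** The value of a function depending on [S] only is not affected, while the
    block above a point becomes as large, and its mean noise as small, as
    possible in the irrelevant directions. *)
Definition fill x : lattice nn :=
  [ffun j => (if j \in S then x j else lat_top hn j : 'I_(nn j))].

Lemma complement_volume_gt0 x : 0 < complement_volume x.
Proof. by apply: prodr_gt0 => j _; rewrite ltr0n subn_gt0. Qed.

Lemma complement_volume_upd j k x : j \in S ->
  complement_volume (upd j k x) = complement_volume x.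
Proof.
move=> jS; apply: eq_bigr => i iS; rewrite upd_other //.
by apply: contraNneq iS => ->.
Qed.

Lemma depends_on_eq f x y : depends_on S f ->
  (forall j, j \in S -> x j = y j) -> f x = f y.
Proof.
move=> [fS fE] xy; rewrite !fE; congr (fS _).
by apply/ffunP => j; rewrite !ffunE xy ?(valP j).
Qed.

Lemma depends_on_fill f x : depends_on S f -> f (fill x) = f x.
Proof.
by move=> fS; apply: depends_on_eq => // j jS; apply/val_inj; rewrite ffunE jS.
Qed.

Lemma lat_le_fill x y : lat_le x y -> lat_le x (fill y).
Proof.
move=> /forallP xy; apply/forallP => j; rewrite ffunE; case: ifP => _ //.
by have /forallP := lat_le_top hn x; exact.
Qed.

Lemma top_width x j : (lat_top hn j - x j).+1 = (nn j - x j)%N.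
Proof. by rewrite ffunE /=; apply: predn_subS. Qed.

Lemma block_volume_fill x y :
  block_volume R x (fill y) =
  (\prod_(j in S) (y j - x j).+1%:R) * complement_volume x.
Proof.
rewrite /block_volume (bigID (mem S)) /=; congr (_ * _); apply: eq_bigr => j jS.
  by rewrite ffunE jS.
by rewrite ffunE (negbTE jS) top_width.
Qed.

Lemma block_volume_top x :
  block_volume R x (lat_top hn) = \prod_(j < d) (nn j - x j)%:R.
Proof. by apply: eq_bigr => j _; rewrite top_width. Qed.

(** Side [2 ^ i] in the directions of [S], so the shift is by [2 ^ i - 1]. *)
Definition cube i x : lattice nn := fill (raise_all (enum S) (2 ^ i).-1 x).

Lemma lat_le_raise_all l m x : lat_le x (raise_all l m x).
Proof.
elim: l => [|j l IH] /=; first exact: lat_le_refl.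
apply: lat_le_trans IH _; apply/forallP => i; rewrite /raise.
have [->|ij] := eqVneq i j; last by rewrite upd_other.
rewrite upd_same leq_min leq_addr /=.
by rewrite -ltnS prednK.
Qed.

Lemma cube_le i x : lat_le x (cube i x).
Proof. by apply: lat_le_fill; exact: lat_le_raise_all. Qed.

(** No truncation occurs in forming the cube, as [cube_volume] requires. *)
Definition room i x : bool := [forall j in S, (2 ^ i <= nn j - x j)%N].

Lemma cube_volume i x : room i x ->
  block_volume R x (cube i x) = (2 ^+ i) ^+ #|S| * complement_volume x.
Proof.
move=> /forall_inP rm; rewrite block_volume_fill; congr (_ * _).
rewrite -prodr_const; apply: eq_bigr => j jS.
rewrite raise_allE ?enum_uniq // mem_enum jS -natrX; congr (_%:R).
by apply: clipped_width (rm j jS); rewrite expn_gt0.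
Qed.

End Selection.

Section FiberBounds.
Context {R : realType} {d : nat} {nn : 'I_d -> nat}.
Variables (hn : forall j, (0 < nn j)%N) (S : {set 'I_d}).
Variables (f tau : lattice nn -> R).
Implicit Types (x y v : lattice nn) (g : lattice nn -> R).

(** Functions of the coordinates outside [S], expressed through the invariance
    that the shift estimates ask for. *)
Definition fiberwise g := forall j k x, j \in S -> g (upd j k x) = g x.

(** The bias of the cube is at most its noise: below, [tau] is the noise of the
    fiber and [h = (2 ^+ i) `^ (- s / 2)] the gain from averaging over [S]. *)
Definition good (h : R) (i : nat) x : bool :=
  room S i x && (f (cube hn S i x) - f x <= tau x * h).

(** A scale is bad if the cube leaves the lattice, which [sum_boundary]
    estimates, or if [f] increases by more than [tau x * h] along it, which
    Markov's inequality reduces to [sum_raise_all]. *)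
Lemma sum_bad_linear (A M h : R) (i : nat) g :
  lat_nondecreasing f -> depends_on S f ->
  f (lat_top hn) - f (lat_one hn) <= A ->
  0 < M -> (forall j, j \in S -> M <= (nn j)%:R) -> 0 < h ->
  (forall x, 0 < tau x) -> fiberwise tau -> (forall x, 0 <= g x) -> fiberwise g ->
  \sum_(x : lattice nn) g x * (~~ good h i x)%:R <=
  \sum_(x : lattice nn) g x * ((2 ^+ i * #|S|%:R / M) * (1 + A / tau x / h)).
Proof.
move=> fm fS fA M0 MS h0 tau0 tauS g0 gS.
have A0 : 0 <= A by apply: le_trans fA; rewrite subr_ge0 fm // lat_le_top.
have sM : \sum_(j in S) (nn j)%:R^-1 <= #|S|%:R / M :> R.
  rewrite mulr_natl -sumr_const; apply: ler_sum => j jS.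
  by rewrite lef_pV2 ?posrE ?MS // ltr0n.
pose g' x := g x / (tau x * h).
have th0 x : 0 < tau x * h by rewrite mulr_gt0.
have g'0 x : 0 <= g' x by rewrite divr_ge0 // ltW.
have g'S j k x : j \in enum S -> g' (upd j k x) = g' x.
  by rewrite mem_enum => jS; rewrite /g' gS // tauS.
have fc x : f (cube hn S i x) = f (raise_all (enum S) (2 ^ i).-1 x).
  exact: depends_on_fill.
have jump0 x : 0 <= f (cube hn S i x) - f x by rewrite subr_ge0 fm // cube_le.
(* The union bound at one point. *)
have pt x : g x * (~~ good h i x)%:R <=
    \sum_(j in S) g x * (nn j - x j < 2 ^ i)%N%:R +
    g' x * (f (raise_all (enum S) (2 ^ i).-1 x) - f x).
  have s0 : 0 <= \sum_(j in S) g x * (nn j - x j < 2 ^ i)%N%:R.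
    by apply: sumr_ge0 => j _; rewrite mulr_ge0.
  have j0 : 0 <= g' x * (f (raise_all (enum S) (2 ^ i).-1 x) - f x).
    by rewrite mulr_ge0 // -fc.
  have [gd|] := boolP (good h i x); first by rewrite mulr0 addr_ge0.
  rewrite mulr1 negb_and => /orP[|].
    rewrite negb_forall => /existsP[j]; rewrite negb_imply -ltnNge => /andP[jS jx].
    apply: (@le_trans _ _ (\sum_(j in S) g x * (nn j - x j < 2 ^ i)%N%:R)); last first.
      by rewrite lerDl.
    rewrite (bigD1 j) //= jx mulr1 lerDl.
    by apply: sumr_ge0 => k _; rewrite mulr_ge0.
  rewrite -ltNge => jump.
  apply: (@le_trans _ _ (g' x * (f (raise_all (enum S) (2 ^ i).-1 x) - f x))); last first.
    by rewrite lerDr.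
  rewrite /g' mulrAC ler_pdivlMr // ler_wpM2l // -fc; exact: ltW.
apply: (le_trans (ler_sum _ (fun x _ => pt x))).
rewrite big_split /= exchange_big /=.
have H1 : \sum_(j in S) \sum_(x : lattice nn) g x * (nn j - x j < 2 ^ i)%N%:R <=
    2 ^+ i * #|S|%:R / M * \sum_(x : lattice nn) g x.
  apply: (@le_trans _ _ (\sum_(j in S) (2 ^+ i / (nn j)%:R) * \sum_(x : lattice nn) g x)).
    apply: ler_sum => j jS; rewrite -natrX.
    by apply: sum_boundary => // k x; exact: gS.
  rewrite -mulr_suml ler_wpM2r ?sumr_ge0 // -mulr_sumr -mulrA.
  by rewrite ler_wpM2l ?exprn_ge0.
have H2 : \sum_(x : lattice nn) g' x * (f (raise_all (enum S) (2 ^ i).-1 x) - f x) <=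
    2 ^+ i * #|S|%:R / M * A * \sum_(x : lattice nn) g' x.
  apply: (le_trans (sum_raise_all (2 ^ i).-1 fm fA g'0 g'S)).
  rewrite ler_wpM2r ?sumr_ge0 // big_enum /= mulrAC ler_wpM2r // -mulrA.
  apply: ler_pM => //; first by apply: sumr_ge0 => j _; rewrite invr_ge0.
  by rewrite -natrX ler_nat leq_pred.
apply: (le_trans (lerD H1 H2)); set K := 2 ^+ i * #|S|%:R / M.
rewrite -[K * A * _]mulrA -mulrDr.
under [leRHS]eq_bigr do rewrite mulrCA.
rewrite -mulr_sumr ler_wpM2l //.
  by rewrite /K !mulr_ge0 ?exprn_ge0 ?invr_ge0 // ltW.
rewrite mulr_sumr -big_split /= le_eqVlt; apply/orP; left; apply/eqP.
apply: eq_bigr => x _; rewrite /g'; field.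
by rewrite (gt_eqF h0) (gt_eqF (tau0 x)).
Qed.

(** The minimum with 1 is taken point by point, so [sum_bad_linear] is applied
    with the weight [g] restricted to the points whose bound is at most 1; the
    restricted weight is again fiberwise. *)
Lemma sum_bad_min (A M h : R) (i : nat) g :
  lat_nondecreasing f -> depends_on S f ->
  f (lat_top hn) - f (lat_one hn) <= A ->
  0 < M -> (forall j, j \in S -> M <= (nn j)%:R) -> 0 < h ->
  (forall x, 0 < tau x) -> fiberwise tau -> (forall x, 0 <= g x) -> fiberwise g ->
  \sum_(x : lattice nn) g x * (~~ good h i x)%:R <=
  \sum_(x : lattice nn) g x *
    Num.min 1 ((2 ^+ i * #|S|%:R / M) * (1 + A / tau x / h)).
Proof.
move=> fm fS fA M0 MS h0 tau0 tauS g0 gS.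
pose be x := (2 ^+ i * #|S|%:R / M) * (1 + A / tau x / h).
(* Where the bound be exceeds 1 it is replaced by the trivial one. *)
pose g' x := g x * (be x <= 1)%R%:R.
have H : \sum_(x : lattice nn) g' x * (~~ good h i x)%:R <=
    \sum_(x : lattice nn) g' x * be x.
  apply: sum_bad_linear => // [x|j k x jS]; first by rewrite mulr_ge0.
  by rewrite /g' /be gS // tauS.
(* Split according to be x <= 1 or 1 < be x. *)
rewrite (eq_bigr (fun x => g' x * (~~ good h i x)%:R +
   g x * (1 < be x)%R%:R * (~~ good h i x)%:R)); last first.
  move=> x _; rewrite /g'; case: (leP (be x) 1) => _ /=;
  by rewrite ?mulr1 ?mulr0 ?mul0r ?addr0 ?add0r.
rewrite [leRHS](eq_bigr (fun x => g' x * be x + g x * (1 < be x)%R%:R)); last first.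
  move=> x _; rewrite /g' -/(be x); by case: (leP (be x) 1) => b1 /=; ring.
rewrite !big_split /= lerD //; apply: ler_sum => x _.
by rewrite ler_piMr ?mulr_ge0 //; case: good.
Qed.

End FiberBounds.

(** * Selection of the upper corner *)

Lemma exists_switch (P : nat -> bool) (L : nat) : P 0%N -> ~~ P L ->
  exists2 i, (i < L)%N & P i && ~~ P i.+1.
Proof.
elim: L => [-> //|L IH] P0 PL.
have [PL'|nPL] := boolP (P L); first by exists L => //; rewrite PL' PL.
by have [i iL Pi] := IH P0 nPL; exists i => //; exact: ltnW.
Qed.

(** According to whether [D * y `^ (s / 2)] is below or above 1, the first or
    the second entry of the minimum is the right one. *)
Lemma scale_tradeoff (R : realType) (q s D y : R) : 1 <= q -> 0 <= s ->
  0 <= D -> 0 < y ->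
  Num.min (D `^ q) (y `^ (- (s * q / 2))) * (1 + D * y `^ (s / 2)) <=
  2 * (D * y `^ (- (s * (q - 1) / 2))).
Proof.
move=> q1 s0 D0 y0.
have ys := powR_gt0 (s / 2) y0.
have Dq := powR_ge0 D q; have Dy : 0 <= D * y `^ (s / 2) by rewrite mulr_ge0 // ltW.
have [u1|u1] := leP (D * y `^ (s / 2)) 1.
  apply: (@le_trans _ _ (D `^ q * 2)).
    apply: ler_pM; rewrite ?le_min ?powR_ge0 ?Dq ?ge_min ?lexx //; lra.
  rewrite mulrC ler_pM2l // -(@mulr_powRB1 _ D q) //; last lra.
  apply: ler_wpM2l => //.
  have -> : y `^ (- (s * (q - 1) / 2)) = ((y `^ (s / 2))^-1) `^ (q - 1).
    by rewrite -powRN -powRrM; congr (_ `^ _); field.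
  apply: ge0_ler_powR; rewrite ?nnegrE ?invr_ge0 ?(ltW ys) ?subr_ge0 //.
  by rewrite -[leRHS]mul1r ler_pdivlMr.
apply: (@le_trans _ _ (y `^ (- (s * q / 2)) * (2 * (D * y `^ (s / 2))))).
  apply: ler_pM; rewrite ?le_min ?powR_ge0 ?Dq ?ge_min ?lexx ?orbT //; lra.
rewrite le_eqVlt; apply/orP; left; apply/eqP.
have -> : y `^ (- (s * (q - 1) / 2)) = y `^ (- (s * q / 2)) * y `^ (s / 2).
  by rewrite -powRD ?(gt_eqF y0) ?implybT //; congr (_ `^ _); field.
ring.
Qed.

(** The left side is the loss at scale [y] times the proportion of points at
    which the scale [2 * y] is bad. *)
Lemma scale_tradeoff_min (R : realType) (q D y M : R) (s : nat) : 1 <= q ->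
  (0 < s)%N -> 0 <= D -> 0 < y -> 0 < M ->
  Num.min (D `^ q) (y `^ (- (s%:R * q / 2))) *
   Num.min 1 ((2 * y * s%:R / M) * (1 + D * (2 * y) `^ (s%:R / 2))) <=
  4 * s%:R * 2 `^ (s%:R / 2) *
   Num.min (y `^ (- (s%:R * q / 2)))
     (D / M * y `^ (1 + s%:R / 2 - s%:R * q / 2)).
Proof.
move=> q1 s0 D0 y0 M0.
have sp : 1 <= s%:R :> R by rewrite ler1n.
have e2 : 1 <= 2 `^ (s%:R / 2) :> R.
  by rewrite -[leLHS](powRr0 2) ler_powR ?ler1n // divr_ge0.
set E : R := 2 `^ (s%:R / 2) in e2 *.
set m := Num.min (D `^ q) _.
have m0 : 0 <= m by rewrite le_min !powR_ge0.
have K1 : 1 <= 4 * s%:R * E by nra.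
rewrite [leRHS]minr_pMr; last by apply: le_trans K1; lra.
rewrite le_min; apply/andP; split.
  apply: (@le_trans _ _ m).
    by rewrite ler_piMr // ge_min lexx.
  apply: (@le_trans _ _ (y `^ (- (s%:R * q / 2)))); first by rewrite ge_min lexx orbT.
  by rewrite ler_peMl ?powR_ge0.
apply: (@le_trans _ _ (m * ((2 * y * s%:R / M) * (1 + D * (2 * y) `^ (s%:R / 2))))).
  by rewrite ler_wpM2l // ge_min lexx orbT.
have K0 : 0 <= 2 * y * s%:R / M by rewrite !mulr_ge0 ?invr_ge0 // ltW.
apply: (@le_trans _ _ ((2 * y * s%:R / M) * E * (m * (1 + D * y `^ (s%:R / 2))))).
  rewrite mulrCA -[leRHS]mulrA ler_wpM2l // mulrCA ler_wpM2l //.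
  rewrite powRM ?(ltW y0) // -/E.
  have := mulr_ge0 D0 (powR_ge0 y (s%:R / 2)); nra.
apply: (@le_trans _ _ ((2 * y * s%:R / M) * E * (2 * (D * y `^ (- (s%:R * (q - 1) / 2)))))).
  rewrite ler_wpM2l ?scale_tradeoff //.
  by rewrite mulr_ge0 // (le_trans _ e2).
rewrite le_eqVlt; apply/orP; left; apply/eqP.
have -> : y `^ (1 + s%:R / 2 - s%:R * q / 2) = y * y `^ (- (s%:R * (q - 1) / 2)).
  rewrite -{2}(powRr1 (ltW y0)) -powRD ?(gt_eqF y0) ?implybT //.
  by congr (_ `^ _); field.
by field; rewrite gt_eqF.
Qed.

Definition bias_variance (R : realType) (d : nat) (nn : 'I_d -> nat) (q sigma : R)
    (f : lattice nn -> R) (x v : lattice nn) : R :=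
  (f v - f x) `^ q + (sigma ^+ 2 / block_volume R x v) `^ (q / 2).

(** The noise of the average over the fiber above [x] in the directions outside [S]. *)
Definition local_noise (R : realType) (d : nat) (nn : 'I_d -> nat) (S : {set 'I_d})
    (sigma : R) (x : lattice nn) : R :=
  (sigma ^+ 2 / complement_volume S x) `^ 2^-1.

Section SelectionBound.
Context {R : realType} {d : nat} {nn : 'I_d -> nat}.
Variables (hn : forall j, (0 < nn j)%N) (S : {set 'I_d}).
Implicit Types (x v : lattice nn) (f : lattice nn -> R) (sigma : R).

Lemma local_noise_gt0 sigma x : 0 < sigma -> 0 < local_noise S sigma x.
Proof.
move=> s0; apply: powR_gt0; apply: divr_gt0; first by rewrite exprn_gt0.
exact: complement_volume_gt0.
Qed.

Lemma local_noiseXq sigma x q : local_noise S sigma x `^ q =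
  (sigma ^+ 2 / complement_volume S x) `^ (q / 2).
Proof. by rewrite /local_noise -powRrM [2^-1 * q]mulrC. Qed.

(** Not moving in the directions of [S] leaves no bias. *)
Lemma select_complement q sigma f x : 0 < q -> depends_on S f ->
  exists2 v, lat_le x v & bias_variance q sigma f x v = local_noise S sigma x `^ q.
Proof.
move=> q0 fS; exists (fill hn S x); first by apply: lat_le_fill; exact: lat_le_refl.
rewrite /bias_variance depends_on_fill // subrr powR0 ?gt_eqF // add0r local_noiseXq.
by rewrite block_volume_fill big1 ?mul1r // => j _; rewrite subnn.
Qed.

Lemma raise_all0 l x : raise_all l 0 x = x.
Proof.
elim: l => //= j l ->; rewrite /raise addn0; apply/ffunP => i; apply/val_inj.
have [->|ij] := eqVneq i j; last by rewrite upd_other.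
by rewrite /= upd_same minn_ord_pred.
Qed.

Lemma room0 x : room S 0 x.
Proof. by apply/forall_inP => j _; rewrite subn_gt0. Qed.

Lemma cube_bias_variance q sigma f x i : 1 <= q -> 0 < sigma ->
  lat_nondecreasing f ->
  good hn S f (local_noise S sigma) ((2 ^+ i) `^ (- (#|S|%:R / 2))) i x ->
  bias_variance q sigma f x (cube hn S i x) <=
  2 * (local_noise S sigma x `^ q * (2 ^+ i) `^ (- (#|S|%:R * q / 2))).
Proof.
move=> q1 s0 fm /andP[rm jump].
have y0 : 0 < 2 ^+ i :> R by rewrite exprn_gt0.
have t0 := local_noise_gt0 x s0.
have cv := complement_volume_gt0 (R := R) S x.
have vs : 0 <= sigma ^+ 2 / complement_volume S x by rewrite divr_ge0 ?sqr_ge0 // ltW.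
set h := (2 ^+ i) `^ (- (#|S|%:R / 2)) in jump.
have hq : h `^ q = (2 ^+ i) `^ (- (#|S|%:R * q / 2)).
  by rewrite /h -powRrM; congr (_ `^ _); field.
rewrite mulr_natl mulr2n /bias_variance lerD //.
  rewrite -hq -powRM ?powR_ge0 //.
  apply: ge0_ler_powR; rewrite ?nnegrE ?mulr_ge0 ?powR_ge0 ?(ltW t0) ?subr_ge0 ?fm ?cube_le //.
  lra.
rewrite cube_volume // local_noiseXq le_eqVlt; apply/orP; left; apply/eqP.
rewrite [_ * complement_volume S x]mulrC invfM mulrA powRM ?invr_ge0 ?exprn_ge0 //.
congr (_ * _).
have i0 : (0 : R) <= 2 ^+ i by rewrite exprn_ge0.
rewrite -(powR_mulrn _ i0) -powRN -powRrM.
by congr (_ `^ _); field.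
Qed.

(** Scale 0 is always good, and the cube of side [2 ^ L] does not fit; take a
    good scale [i] such that [i + 1] is bad.  The bound of
    [cube_bias_variance] at [i] occurs among the terms of the sum.  If [A] is smaller
    than the noise at that scale, take the top of the lattice instead: then the
    bias is at most [A] and the noise is the first term. *)
Lemma select_pointwise q sigma f A L x : 1 <= q -> 0 < sigma ->
  (0 < #|S|)%N -> lat_nondecreasing f -> depends_on S f ->
  f (lat_top hn) - f (lat_one hn) <= A -> (forall j, (nn j < 2 ^ L)%N) ->
  exists2 v, lat_le x v &
  bias_variance q sigma f x v <=
    (sigma ^+ 2 / block_volume R x (lat_top hn)) `^ (q / 2) +
    \sum_(i < L) 2 * (local_noise S sigma x `^ q *
      Num.min ((A / local_noise S sigma x) `^ q) ((2 ^+ i) `^ (- (#|S|%:R * q / 2)))) *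
      (~~ good hn S f (local_noise S sigma)
            ((2 ^+ i.+1) `^ (- (#|S|%:R / 2))) i.+1 x)%:R.
Proof.
move=> q1 s0 S0 fm fS fA nL.
have A0 : 0 <= A by apply: le_trans fA; rewrite subr_ge0 fm // lat_le_top.
set tau := local_noise S sigma; have t0 : 0 < tau x := local_noise_gt0 x s0.
pose P i := good hn S f tau ((2 ^+ i) `^ (- (#|S|%:R / 2))) i x.
have P0 : P 0%N.
  by rewrite /P /good room0 /= depends_on_fill // raise_all0 subrr mulr_ge0 ?powR_ge0 // ltW.
have PL : ~~ P L.
  rewrite /P /good negb_and; apply/orP; left.
  have [j jS] : exists j, j \in S by apply/card_gt0P.
  apply/negP => /forall_inP /(_ j jS); rewrite leqNgt => /negP; apply.
  exact: leq_ltn_trans (leq_subr _ _) (nL j).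
have [i iL /andP[Pi nPi]] := exists_switch P0 PL.
set z : R := (2 ^+ i) `^ (- (#|S|%:R * q / 2)).
have top0 : 0 <= (sigma ^+ 2 / block_volume R x (lat_top hn)) `^ (q / 2) by exact: powR_ge0.
have term0 (k : 'I_L) : 0 <= 2 * (tau x `^ q *
      Num.min ((A / tau x) `^ q) ((2 ^+ k) `^ (- (#|S|%:R * q / 2)))) *
      (~~ P k.+1)%:R.
  by rewrite !mulr_ge0 ?powR_ge0 // le_min !powR_ge0.
have big : 2 * (tau x `^ q * Num.min ((A / tau x) `^ q) z) <=
   \sum_(k < L) 2 * (tau x `^ q *
      Num.min ((A / tau x) `^ q) ((2 ^+ k) `^ (- (#|S|%:R * q / 2)))) *
      (~~ P k.+1)%:R.
  rewrite (bigD1 (Ordinal iL)) //= nPi mulr1 lerDl.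
  by apply: sumr_ge0 => k _; exact: term0.
(* If A is below the noise at scale i, use the whole block above x. *)
have [Az|zA] := leP ((A / tau x) `^ q) z.
  exists (lat_top hn); first exact: lat_le_top.
  rewrite /bias_variance addrC lerD2l; apply: le_trans big.
  rewrite (min_idPl Az) -powRM ?(ltW t0) ?divr_ge0 ?(ltW t0) // [tau x * _]mulrC divfK ?gt_eqF //.
  have : (f (lat_top hn) - f x) `^ q <= A `^ q.
    apply: ge0_ler_powR; rewrite ?nnegrE ?subr_ge0 ?fm ?lat_le_top //; first lra.
    by apply: le_trans fA; rewrite lerD2l lerN2 fm // lat_le_one.
  by have := powR_ge0 A q; lra.
exists (cube hn S i x); first exact: cube_le.
apply: (le_trans (cube_bias_variance q1 s0 fm Pi)).
by apply: le_trans (le_trans big _); rewrite ?(min_idPr (ltW zA)) // lerDr.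
Qed.

End SelectionBound.

(** Summing over the lattice first and over the scales afterwards.  With
    [a = s q / 2] and [b = 1 + s / 2], [scale_tradeoff_min] leaves at scale
    [2 ^+ i] the two sequences of [dyadic_min_sum], for [t = A / (tau x * M)]. *)
Lemma select_sum (R : realType) (q : R) (s : nat) : 1 <= q -> (0 < s)%N ->
  exists2 C : R, 0 < C &
  forall (d : nat) (nn : 'I_d -> nat) (hn : forall j, (0 < nn j)%N)
    (S : {set 'I_d}) (f : lattice nn -> R) (sigma A M : R) (L : nat),
  #|S| = s -> 0 < sigma -> lat_nondecreasing f -> depends_on S f ->
  f (lat_top hn) - f (lat_one hn) <= A ->
  0 < M -> (forall j, j \in S -> M <= (nn j)%:R) -> (forall j, (nn j < 2 ^ L)%N) ->
  exists2 v : lattice nn -> lattice nn, (forall x, lat_le x (v x)) &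
  \sum_(x : lattice nn) bias_variance q sigma f x (v x) <=
    \sum_(x : lattice nn) (sigma ^+ 2 / block_volume R x (lat_top hn)) `^ (q / 2) +
    C * (\sum_(x : lattice nn) local_noise S sigma x `^ q *
           (A / local_noise S sigma x / M) `^ Num.min 1 (q * s%:R / (s%:R + 2)))
      * L%:R ^+ (q * s%:R / (s%:R + 2) == 1).
Proof.
move=> q1 s0; have sp : 0 < s%:R :> R by rewrite ltr0n.
set a : R := s%:R * q / 2; set b : R := 1 + s%:R / 2.
have a0 : 0 < a by rewrite /a !mulr_gt0 //; lra.
have b0 : 0 < b by rewrite /b; lra.
have ab : a / b = q * s%:R / (s%:R + 2) by rewrite /a /b; field; lra.
have [K K0 HK] := dyadic_min_sum a0 b0.
set B : R := 4 * s%:R * 2 `^ (s%:R / 2).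
have B0 : 0 < B by rewrite /B !mulr_gt0 // powR_gt0.
exists (2 * B * K); first by rewrite !mulr_gt0.
move=> d nn hn S f sigma A M L Ss sg0 fm fS fA M0 MS nL.
have A0 : 0 <= A by apply: le_trans fA; rewrite subr_ge0 fm // lat_le_top.
have S0 : (0 < #|S|)%N by rewrite Ss.
set tau := local_noise (nn := nn) S sigma.
have t0 x : 0 < tau x := local_noise_gt0 S x sg0.
have /choice[v Hv] : forall x, exists v, lat_le x v /\ bias_variance q sigma f x v <=
    (sigma ^+ 2 / block_volume R x (lat_top hn)) `^ (q / 2) +
    \sum_(i < L) 2 * (tau x `^ q *
      Num.min ((A / tau x) `^ q) ((2 ^+ i) `^ (- (#|S|%:R * q / 2)))) *
      (~~ good hn S f tau ((2 ^+ i.+1) `^ (- (#|S|%:R / 2))) i.+1 x)%:R.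
  move=> x; have [v xv Hv] := select_pointwise x q1 sg0 S0 fm fS fA nL.
  by exists v.
exists v => [x|]; first by have [] := Hv x.
apply: (le_trans (ler_sum _ (fun x _ => proj2 (Hv x)))).
rewrite big_split /= lerD2l exchange_big /=.
pose y i : R := 2 ^+ i; have y0 i : 0 < y i by rewrite exprn_gt0.
have tauS : fiberwise S tau.
  by move=> j k x jS; rewrite /tau /local_noise complement_volume_upd.
(* The loss at scale i, over the points at which the scale i + 1 is bad. *)
have level (i : 'I_L) : \sum_(x : lattice nn) 2 * (tau x `^ q *
      Num.min ((A / tau x) `^ q) ((2 ^+ i) `^ (- (#|S|%:R * q / 2)))) *
      (~~ good hn S f tau ((2 ^+ i.+1) `^ (- (#|S|%:R / 2))) i.+1 x)%:R <=
    \sum_(x : lattice nn) (2 * B) * (tau x `^ q *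
      Num.min ((2 `^ (- a)) ^+ i) (A / tau x / M * (2 `^ (b - a)) ^+ i)).
  have h0 : 0 < (2 ^+ i.+1) `^ (- (#|S|%:R / 2)) :> R by rewrite powR_gt0 // exprn_gt0.
  pose g x := 2 * (tau x `^ q *
      Num.min ((A / tau x) `^ q) ((2 ^+ i) `^ (- (#|S|%:R * q / 2)))).
  have g0 x : 0 <= g x by rewrite !mulr_ge0 ?powR_ge0 // le_min !powR_ge0.
  have gS : fiberwise S g by move=> j k x jS; rewrite /g tauS.
  apply: (le_trans (sum_bad_min i.+1 fm fS fA M0 MS h0 t0 tauS g0 gS)).
  apply: ler_sum => x _; rewrite /g -[leLHS]mulrA -[leRHS]mulrA ler_pM2l //.
  rewrite -[leLHS]mulrA [leRHS]mulrCA ler_wpM2l ?powR_ge0 //.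
  have D0 : 0 <= A / tau x by rewrite divr_ge0 // ltW.
  have := scale_tradeoff_min q1 s0 D0 (y0 i) M0.
  rewrite -!powR_exprn // Ss -/a /y -/B.
  have -> : ((2 ^+ i.+1) `^ (- (s%:R / 2)))^-1 = (2 * 2 ^+ i) `^ (s%:R / 2) :> R.
    by rewrite powRN invrK exprS.
  rewrite exprS.
  have -> : 1 + s%:R / 2 - a = b - a by [].
  by [].
apply: (le_trans (ler_sum _ (fun i _ => level i))).
rewrite exchange_big /= mulr_sumr mulr_suml; apply: ler_sum => x _.
have D0 : 0 <= A / tau x / M by rewrite !divr_ge0 // ltW.
have := HK (A / tau x / M) L D0.
have -> : (a == b) = (q * s%:R / (s%:R + 2) == 1).
  by rewrite -ab; apply/eqP/eqP => [->|/divr1_eq ->//]; rewrite divff ?gt_eqF.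
rewrite ab => HKx.
rewrite -mulr_sumr -mulr_sumr.
have BB : 0 <= 2 * B by rewrite mulr_ge0 // ltW.
apply: le_trans (ler_wpM2l BB (ler_wpM2l (powR_ge0 (tau x) q) HKx)) _.
by rewrite le_eqVlt; apply/orP; left; apply/eqP; ring.
Qed.

(** * From selection to risk *)

Definition sparse_monotone (R : realType) (d : nat) (nn : 'I_d -> nat)
    (hn : forall j, (0 < nn j)%N) (S : {set 'I_d}) (A : R) (f : lattice nn -> R) :=
  [/\ lat_nondecreasing f, depends_on S f & f (lat_top hn) - f (lat_one hn) <= A].

Lemma mirror_top (d : nat) (nn : 'I_d -> nat) (hn : forall j, (0 < nn j)%N) :
  mirror (lat_top hn) = lat_one hn /\ mirror (lat_one hn) = lat_top hn.
Proof.
have e : mirror (lat_top hn) = lat_one hn.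
  apply/ffunP => j; apply/val_inj; rewrite !ffunE /=.
  by rewrite prednK // subnn.
by split => //; rewrite -e mirrorK.
Qed.

Lemma sparse_monotone_mirror (R : realType) (d : nat) (nn : 'I_d -> nat)
    (hn : forall j, (0 < nn j)%N) (S : {set 'I_d}) (A : R) (f : lattice nn -> R) :
  sparse_monotone hn S A f -> sparse_monotone hn S A (fun x => - f (mirror x)).
Proof.
move=> [fm fS fA]; split.
- by move=> x y xy; rewrite lerN2 fm // lat_le_mirror.
- exists (fun z => - (projT1 (cid fS)) [ffun j => rev_ord (z j)]) => x.
  have := projT2 (cid fS); move: (projT1 _) => fS' ->; congr (- fS' _).
  by apply/ffunP => j; rewrite !ffunE.
- have [-> ->] := mirror_top hn; by rewrite opprK addrC.
Qed.

(** The class is stable under [f |-> - f \o mirror], and upper corners selected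
    for the mirrored function are lower corners for [f]. *)
Lemma risk_le (R : realType) (q : R) (d : nat) : 1 <= q ->
  exists2 C : R, 0 < C &
  forall (nn : 'I_d -> nat) (hn : forall j, (0 < nn j)%N)
    (design : 'I_(lattice_size nn) -> lattice nn),
  bijective design ->
  forall est, block_estimator design est ->
  forall (dO : measure_display) (Omega : measurableType dO)
    (P : probability Omega R) (eps : 'I_(lattice_size nn) -> {RV P >-> R})
    (sigma : R),
  0 < sigma -> noise_condition eps q sigma ->
  forall (S : {set 'I_d}) (A U : R),
  (forall f, sparse_monotone hn S A f ->
     exists2 v : lattice nn -> lattice nn, (forall x, lat_le x (v x)) &
       \sum_(x : lattice nn) bias_variance q sigma f x (v x) <= U) ->
  forall f, sparse_monotone hn S A f ->
  (risk design eps q est f <= (C * U / (lattice_size nn)%:R)%:E)%E.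
Proof.
move=> q1; have [C C0 HC] := block_error_moment d q1.
exists (C * 2); first by rewrite mulr_gt0.
move=> nn hn design bd est be dO Omega P eps sigma s0 nc S A U Hsel f fcls.
have [v xv Hv] := Hsel f fcls.
have [v' xv' Hv'] := Hsel _ (sparse_monotone_mirror fcls).
have [fm _ _] := fcls.
pose u x := mirror (v' (mirror x)).
have ux x : lat_le (u x) x by rewrite -[x in X in lat_le _ X]mirrorK lat_le_mirror.
have eu x : bias_variance q sigma (fun x => - f (mirror x)) (mirror x) (v' (mirror x)) =
    (f x - f (u x)) `^ q + (sigma ^+ 2 / block_volume R (u x) x) `^ (q / 2).
  rewrite /bias_variance /= mirrorK opprK [- _ + _]addrC -/(u x); congr (_ + (_ / _) `^ _).
  by rewrite -(block_volume_mirror x (u x)) /u mirrorK.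
have pt i := HC nn design bd est be dO Omega P eps sigma s0 nc f fm
   (u (design i)) (design i) (v (design i)) (ux _) (xv _).
rewrite /risk; apply: (@le_trans _ _
  (((lattice_size nn)%:R^-1)%:E * \sum_(i < lattice_size nn)
    (C * (bias_variance q sigma f (design i) (v (design i)) +
          bias_variance q sigma (fun x => - f (mirror x)) (mirror (design i))
             (v' (mirror (design i)))))%:E)%E).
  apply: lee_wpmul2l; first by rewrite lee_fin invr_ge0.
  by apply: lee_sum => i _; rewrite eu unlock; exact: pt.
rewrite sumEFin -EFinM lee_fin mulrC ler_wpM2r ?invr_ge0 //.
rewrite -mulr_sumr big_split /= -mulrA ler_pM2l // mulrC mulr_natr mulr2n.
have r1 (F : lattice nn -> R) : \sum_(i < lattice_size nn) F (design i) = \sum_(x : lattice nn) F x.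
  by rewrite [RHS](reindex design) //; exact: onW_bij.
rewrite (r1 (fun x => bias_variance q sigma f x (v x))).
rewrite (r1 (fun x => bias_variance q sigma (fun x => - f (mirror x)) (mirror x) (v' (mirror x)))).
apply: lerD => //; apply: le_trans Hv'.
by rewrite [leRHS](reindex_inj (inv_inj (@mirrorK _ nn))).
Qed.

(** * Noise sums in product form *)

Lemma powR_prod (R : realType) (I : finType) (P : pred I) (F : I -> R) (e : R) :
  (forall i, P i -> 0 <= F i) ->
  (\prod_(i | P i) F i) `^ e = \prod_(i | P i) F i `^ e.
Proof.
move=> F0.
suff [_ ->] : 0 <= \prod_(i | P i) F i /\
    (\prod_(i | P i) F i) `^ e = \prod_(i | P i) F i `^ e by [].
apply: (big_rec2 (fun x y => 0 <= x /\ x `^ e = y)); first by rewrite powR1.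
move=> i x y Pi [x0 <-]; split; first by rewrite mulr_ge0 // F0.
by rewrite powRM // F0.
Qed.

Section NoiseSums.
Context {R : realType} {d : nat} {nn : 'I_d -> nat}.
Variables (hn : forall j, (0 < nn j)%N) (S : {set 'I_d}).
Local Notation n := (lattice_size nn).

Lemma sum_rev_powR (m : nat) (al : R) :
  \sum_(k < m) (m - k)%:R `^ (- al) = power_sum al m.
Proof.
rewrite /power_sum big_add1 /= big_mkord (reindex_inj rev_ord_inj) /=.
by apply: eq_bigr => k _; rewrite subKn.
Qed.

Lemma lattice_size_split :
  n%:R = \prod_(j in S) (nn j)%:R * \prod_(j | j \notin S) (nn j)%:R :> R.
Proof. by rewrite /lattice_size natr_prod (bigID (mem S)). Qed.

Lemma sigma_sub_powR (sigma e : R) : 0 < sigma ->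
  sigma_sub nn S sigma `^ e =
  sigma `^ e * \prod_(j | j \notin S) (nn j)%:R `^ (- (e / 2)).
Proof.
move=> s0; rewrite /sigma_sub.
have p0 : 0 <= \prod_(j | j \notin S) (nn j)%:R :> R by exact: prodr_ge0.
rewrite powRM ?invr_ge0 ?sqrtr_ge0 ?ltW //; congr (_ * _).
rewrite -powR12_sqrt // -powRN -powRrM powR_prod //.
by apply: eq_bigr => j _; congr (_ `^ _); ring.
Qed.

(** The base of the power in [Lambda1] (for [al = q / 2]), with the side [m] in
    place of [n ^ (1/d)]. *)
Definition harmonic_ratio (al : R) (m : nat) : R :=
  power_sum al m / m%:R `^ (1 - al).

Lemma unfold_ratio (al : R) (m : nat) : (0 < m)%N ->
  power_sum al m = m%:R * (m%:R `^ (- al) * harmonic_ratio al m).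
Proof.
move=> m0; have mp : 0 < m%:R :> R by rewrite ltr0n.
rewrite /harmonic_ratio mulrA.
have -> : m%:R * m%:R `^ (- al) = m%:R `^ (1 - al) :> R.
  by rewrite -{1}(powRr1 (ltW mp)) -powRD ?(gt_eqF mp) ?implybT.
by rewrite mulrC divfK // gt_eqF // powR_gt0.
Qed.

(** The summand is a product over the coordinates outside [S]; the coordinates
    in [S] contribute their lengths. *)
Lemma sum_local_noise (sigma e : R) : 0 < sigma ->
  \sum_(x : lattice nn) local_noise S sigma x `^ e =
  n%:R * sigma_sub nn S sigma `^ e *
  \prod_(j | j \notin S) harmonic_ratio (e / 2) (nn j).
Proof.
move=> s0.
have -> : \sum_(x : lattice nn) local_noise S sigma x `^ e =
   sigma `^ e * \sum_(x : lattice nn) \prod_(j < d)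
     (if j \in S then 1 else (nn j - x j)%:R `^ (- (e / 2))).
  rewrite mulr_sumr; apply: eq_bigr => x _.
  rewrite local_noiseXq /complement_volume powRM ?sqr_ge0 //; last first.
    by rewrite invr_ge0; apply: prodr_ge0.
  rewrite -powR_mulrn ?(ltW s0) // -powRrM; congr (_ `^ _ * _); first by field.
  rewrite -powR_inv1 ?prodr_ge0 // -powRrM powR_prod // big_mkcond /=.
  by apply: eq_bigr => j _; case: (j \in S) => //=; congr (_ `^ _); ring.
rewrite (sum_lattice_prod (fun j k => if j \in S then 1 else (nn j - k)%:R `^ (- (e / 2)))).
rewrite (bigID (mem S)) /=.
have -> : \prod_(j in S) \sum_(k < nn j) (if j \in S then 1 else (nn j - k)%:R `^ (- (e / 2)))
    = \prod_(j in S) (nn j)%:R :> R.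
  by apply: eq_bigr => j jS; rewrite jS sumr_const card_ord.
have -> : \prod_(j | j \notin S) \sum_(k < nn j) (if j \in S then 1 else (nn j - k)%:R `^ (- (e / 2)))
    = \prod_(j | j \notin S) ((nn j)%:R * ((nn j)%:R `^ (- (e / 2)) * harmonic_ratio (e / 2) (nn j))) :> R.
  apply: eq_bigr => j /negbTE jS; rewrite jS sum_rev_powR unfold_ratio //.
rewrite sigma_sub_powR // lattice_size_split !big_split /=; ring.
Qed.

Lemma sum_full_noise (sigma e : R) : 0 < sigma ->
  \sum_(x : lattice nn) (sigma ^+ 2 / block_volume R x (lat_top hn)) `^ (e / 2) =
  n%:R * sigma_sub nn S sigma `^ e *
  \prod_(j | j \notin S) harmonic_ratio (e / 2) (nn j) *
  \prod_(j in S) (power_sum (e / 2) (nn j) / (nn j)%:R).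
Proof.
move=> s0.
have -> : \sum_(x : lattice nn) (sigma ^+ 2 / block_volume R x (lat_top hn)) `^ (e / 2) =
   sigma `^ e * \sum_(x : lattice nn) \prod_(j < d) (nn j - x j)%:R `^ (- (e / 2)).
  rewrite mulr_sumr; apply: eq_bigr => x _.
  rewrite block_volume_top powRM ?sqr_ge0 //; last first.
    by rewrite invr_ge0; apply: prodr_ge0.
  rewrite -powR_mulrn ?(ltW s0) // -powRrM; congr (_ `^ _ * _); first by field.
  rewrite -powR_inv1 ?prodr_ge0 // -powRrM powR_prod //.
  by apply: eq_bigr => j _; congr (_ `^ _); ring.
rewrite (sum_lattice_prod (fun j k => (nn j - k)%:R `^ (- (e / 2)))).
rewrite (bigID (mem S)) /=.
have -> : \prod_(j in S) \sum_(k < nn j) (nn j - k)%:R `^ (- (e / 2))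
    = \prod_(j in S) ((nn j)%:R * (power_sum (e / 2) (nn j) / (nn j)%:R)) :> R.
  apply: eq_bigr => j _; rewrite sum_rev_powR [RHS]mulrC divfK //.
  by rewrite pnatr_eq0 -lt0n.
have -> : \prod_(j | j \notin S) \sum_(k < nn j) (nn j - k)%:R `^ (- (e / 2))
    = \prod_(j | j \notin S) ((nn j)%:R * ((nn j)%:R `^ (- (e / 2)) * harmonic_ratio (e / 2) (nn j))) :> R.
  by apply: eq_bigr => j _; rewrite sum_rev_powR unfold_ratio.
rewrite sigma_sub_powR // lattice_size_split !big_split /=; ring.
Qed.

End NoiseSums.

(** * Side lengths of comparable size *)

Lemma powR_comparable (R : realType) (K x y e : R) : 1 <= K -> 0 < x -> 0 < y ->
  x <= K * y -> y <= K * x -> x `^ e <= K `^ `|e| * y `^ e.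
Proof.
move=> K1 x0 y0 xy yx; have K0 : 0 < K by lra.
have [e0|e0] := leP 0 e.
  rewrite ger0_norm // -powRM ?(ltW K0) ?(ltW y0) //.
  by apply: ge0_ler_powR; rewrite ?nnegrE ?mulr_ge0 // ltW.
have H : y `^ (- e) <= K `^ (- e) * x `^ (- e).
  rewrite -powRM ?(ltW K0) ?(ltW x0) //.
  by apply: ge0_ler_powR; rewrite ?nnegrE ?mulr_ge0 ?oppr_ge0 // ltW.
rewrite ltr0_norm //; have e' z : z `^ e = (z `^ (- e))^-1 by rewrite -powRN opprK.
rewrite [x `^ e]e' [y `^ e]e' ler_pdivlMr ?powR_gt0 // mulrC.
by rewrite ler_pdivrMr ?powR_gt0.
Qed.

Lemma root_nX (R : realType) (d n : nat) : (0 < d)%N -> root_n R d n ^+ d = n%:R.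
Proof.
move=> d0; rewrite /root_n -powR_mulrn ?powR_ge0 // -powRrM mulVf ?powRr1 //.
by rewrite pnatr_eq0 -lt0n.
Qed.

(** The product of the sides is the [d]-th power of [root_n], so a side cannot
    be small when all the others are at most a constant times [root_n]. *)
Lemma side_comparable (R : realType) (d : nat) (nn : 'I_d -> nat) (c : R)
    (K := Num.max 1 c ^+ d) :
  (forall j, (0 < nn j)%N) -> (0 < d)%N -> (1 <= lattice_size nn)%N ->
  (\max_(j < d) nn j)%N%:R <= c * root_n R d (lattice_size nn) ->
  1 <= root_n R d (lattice_size nn) /\
  forall j, (nn j)%:R <= K * root_n R d (lattice_size nn) /\
            root_n R d (lattice_size nn) <= K * (nn j)%:R.
Proof.
move=> hn d0 n1 hmax; set n := lattice_size nn in n1 hmax *.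
set N := root_n R d n in hmax *; set c1 := Num.max 1 c in K *.
have c1_1 : 1 <= c1 by rewrite le_max lexx.
have N1 : 1 <= N.
  by rewrite -(powRr0 n%:R); apply: ler_powR; rewrite ?ler1n ?invr_ge0.
have nc j : (nn j)%:R <= c1 * N.
  apply: (@le_trans _ _ (c * N)).
    by apply: le_trans hmax; rewrite ler_nat; exact: (leq_bigmax j).
  by rewrite ler_wpM2r // ?le_max ?lexx ?orbT //; lra.
have KE : K = c1 * c1 ^+ d.-1 by rewrite -exprS prednK.
have cd : 1 <= c1 ^+ d.-1 by exact: exprn_ege1.
split => // j; split.
  apply: (le_trans (nc j)); rewrite KE ler_wpM2r //; first lra.
  by rewrite ler_peMr //; lra.
(* All sides but one are at most c1 * N. *)
have H : n%:R <= (nn j)%:R * (c1 * N) ^+ d.-1.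
  rewrite /n /lattice_size natr_prod (bigD1 j) //= ler_wpM2l //.
  apply: (@le_trans _ _ (\prod_(i < d | i != j) (c1 * N))).
    by apply: ler_prod => i _; rewrite nc andbT.
  by rewrite prodr_const cardC1 card_ord.
have N0 : 0 < N ^+ d.-1 by rewrite exprn_gt0 //; lra.
rewrite -(ler_pM2r N0) -exprS prednK // root_nX //; apply: (le_trans H).
rewrite exprMn mulrA ler_wpM2r ?(ltW N0) // mulrC KE ler_wpM2r //.
by rewrite ler_peMl //; lra.
Qed.

(** The numerators are compared by [power_sum_scale], as [m] is at most a
    constant multiple of the integer part of [N]. *)
Lemma ratio_comparable (R : realType) (al K : R) : 0 <= al -> 1 <= K ->
  exists2 C : R, 0 < C &
  forall (N : R) (m : nat), 1 <= N -> (0 < m)%N ->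
    m%:R <= K * N -> N <= K * m%:R ->
  harmonic_ratio al m <= C * (power_sum al (Num.truncn N) / N `^ (1 - al)).
Proof.
move=> al0 K1.
pose B := (Num.truncn (2 * K)).+1; have B0 : 0 < B%:R :> R by rewrite ltr0n.
exists (B%:R * K `^ `|al - 1|); first by rewrite mulr_gt0 // powR_gt0; lra.
move=> N m N1 m0 mN Nm; have mp : 0 < m%:R :> R by rewrite ltr0n.
have N0 : 0 < N by lra.
set M := Num.truncn N.
have M1 : (0 < M)%N by rewrite truncn_gt0.
have NM : N <= 2 * M%:R.
  have h : N < M.+1%:R by exact: truncnS_gt.
  have h1 : 1 <= M%:R :> R by rewrite ler1n.
  by rewrite -natr1 in h; lra.
have mB : (m <= B * M)%N.
  rewrite -(ler_nat R) natrM.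
  have h : 2 * K < B%:R by exact: truncnS_gt.
  have h1 : 1 <= M%:R :> R by rewrite ler1n.
  apply: (le_trans mN); apply: (@le_trans _ _ (K * (2 * M%:R))); first by rewrite ler_wpM2l //; lra.
  by rewrite mulrA [K * 2]mulrC ler_wpM2r //; lra.
have h1 : power_sum al m <= B%:R * power_sum al M.
  exact: le_trans (power_sum_monotone _ mB) (power_sum_scale B M al0).
have h2 : (m%:R `^ (1 - al))^-1 <= K `^ `|al - 1| * (N `^ (1 - al))^-1.
  by rewrite -!powRN opprB; exact: powR_comparable.
rewrite /harmonic_ratio.
have -> : B%:R * K `^ `|al - 1| * (power_sum al M / N `^ (1 - al)) =
   (B%:R * power_sum al M) * (K `^ `|al - 1| * (N `^ (1 - al))^-1) by ring.
by apply: ler_pM => //; rewrite ?power_sum_ge0 ?invr_ge0 ?powR_ge0.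
Qed.

(** The gain of [sum_full_noise] over [sum_local_noise] in one direction of [S]. *)
Lemma side_log (R : realType) (al K : R) : 0 <= al -> 1 <= K ->
  exists2 C : R, 0 < C &
  forall (N : R) (m n : nat), 1 <= N -> (0 < m)%N -> (m <= n)%N -> (2 <= n)%N ->
    m%:R <= K * N -> N <= K * m%:R ->
  power_sum al m / m%:R <= C * (N `^ (- Num.min 1 al) * ln n%:R ^+ (al == 1)).
Proof.
move=> al0 K1; have [C C0 HC] := power_sum_log al0.
exists (C * K `^ `|- Num.min 1 al|); first by rewrite mulr_gt0 // powR_gt0; lra.
move=> N m n N1 m0 mn n2 mN Nm; have mp : 0 < m%:R :> R by rewrite ltr0n.
have ln0 : 0 <= ln n%:R :> R by rewrite ln_ge0 // ler1n; lia.
have h := powR_comparable (- Num.min 1 al) K1 mp (lt_le_trans ltr01 N1) mN Nm.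
apply: (@le_trans _ _ (C * (m%:R `^ (- Num.min 1 al)) * ln n%:R ^+ (al == 1))); last first.
  have -> : C * K `^ `|- Num.min 1 al| * (N `^ (- Num.min 1 al) * ln n%:R ^+ (al == 1)) =
    C * (K `^ `|- Num.min 1 al| * N `^ (- Num.min 1 al)) * ln n%:R ^+ (al == 1) by ring.
  by rewrite ler_wpM2r ?exprn_ge0 // ler_pM2l.
rewrite ler_pdivrMr //; apply: (le_trans (HC m n m0 mn n2)).
rewrite le_eqVlt; apply/orP; left; apply/eqP.
have -> : m%:R `^ Num.max 0 (1 - al) = m%:R `^ (- Num.min 1 al) * m%:R :> R.
  rewrite -{3}(powRr1 (ltW mp)) -powRD ?(gt_eqF mp) ?implybT //; congr (_ `^ _).
  by case: (leP 1 al) => h1; case: (leP 0 (1 - al)) => h2; lra.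
ring.
Qed.

(** * The rate of the selection bound *)

Lemma prodr_le_expr (R : realType) (d : nat) (P : pred 'I_d) (F : 'I_d -> R) (B : R) :
  (forall j, P j -> 0 <= F j <= B) ->
  \prod_(j | P j) F j <= B ^+ #|P|.
Proof. by move=> FB; rewrite -prodr_const; apply: ler_prod. Qed.

Lemma card_complement (d : nat) (S : {set 'I_d}) :
  #|[pred j | j \notin S]| = (d - #|S|)%N.
Proof.
have h : (#|S| + #|~: S| = d)%N by rewrite cardsC card_ord.
have -> : #|[pred j | j \notin S]| = #|~: S| by apply: eq_card => j; rewrite !inE.
lia.
Qed.

Lemma harmonic_ratio_ge0 (R : realType) (al : R) m : 0 <= harmonic_ratio al m.
Proof. by rewrite divr_ge0 ?power_sum_ge0 ?powR_ge0. Qed.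

Lemma half_eq1 (R : realType) (q : R) : (q / 2 == 1) = (q == 2).
Proof. by apply/eqP/eqP => h; lra. Qed.

Lemma root_n_powR_exp (R : realType) (d n s : nat) (mu : R) :
  (root_n R d n `^ (- mu)) ^+ s = (n%:R `^ (s%:R / d%:R)) `^ (- mu).
Proof.
rewrite -(powR_mulrn s (powR_ge0 (root_n R d n) (- mu))) /root_n.
by rewrite -!powRrM; congr (_ `^ _); ring.
Qed.

(** The smaller of the two entries of [select_rate] decides which selection is
    used.  For the second entry, [select_sum] leaves the sum of
    [tau `^ q * (A / tau / M) `^ ka], and [tau `^ (q - ka)] is again a power of
    [local_noise]; its exponent accounts for [Lambda2_exp]. *)
Lemma selection_rate (R : realType) (q c : R) (d s : nat) : 1 <= q -> (0 < s)%N ->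
  exists2 C : R, 0 < C &
  forall (nn : 'I_d -> nat) (hn : forall j, (0 < nn j)%N)
    (n := lattice_size nn),
  (2 <= n)%N -> (\max_(j < d) nn j)%N%:R <= c * root_n R d n ->
  forall (S : {set 'I_d}) (sigma D : R), #|S| = s -> 0 < sigma -> 0 <= D ->
  forall f, sparse_monotone hn S (D * sigma_sub nn S sigma) f ->
  exists2 v : lattice nn -> lattice nn, (forall x, lat_le x (v x)) &
    \sum_(x : lattice nn) bias_variance q sigma f x (v x) <=
    C * (n%:R * (sigma_sub nn S sigma `^ q * select_rate d n s q D)).
Proof.
move=> q1 s0; have sp : 0 < s%:R :> R by rewrite ltr0n.
pose K := Num.max 1 c ^+ d.
have K1 : 1 <= K by apply: exprn_ege1; rewrite le_max lexx.
have Kp : 0 < K by lra.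
have q20 : 0 <= q / 2 by lra.
set ka := Num.min 1 (q * s%:R / (s%:R + 2)).
have ka1 : ka <= 1 by rewrite ge_min lexx.
have ka0 : 0 < ka by rewrite lt_min ltr01 divr_gt0 ?mulr_gt0 //; lra.
(* The power of local_noise that remains has exponent q - ka = 2 eta. *)
pose eta := (q - ka) / 2; have eta0 : 0 <= eta by rewrite /eta; lra.
have Eeta : - Lambda2_exp s q = eta.
  rewrite /Lambda2_exp /eta /ka; set sr := s%:R.
  have e : q * sr / (sr + 2) = q - 2 * (q / (sr + 2)) by field; rewrite /sr; lra.
  rewrite e; set z := q / (sr + 2).
  by case: (leP 1 (q - 2 * z)) => h1; case: (leP ((1 - q) / 2) (- z)) => h2; lra.
have [C1 C10 H1] := ratio_comparable q20 K1.
have [C2 C20 H2] := ratio_comparable eta0 K1.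
have [C3 C30 H3] := side_log q20 K1.
have [C4 C40 H4] := select_sum q1 s0.
have [C5 C50 H5] := @dyadic_level R.
set I := (q * s%:R / (s%:R + 2) == 1 :> R) in H4.
(* T1 bounds the selection in the irrelevant directions only, T2 the noise of
   the whole block and T3 the contribution of the cubes. *)
pose T1 := C1 ^+ (d - s); have T10 : 0 < T1 by rewrite exprn_gt0.
pose T2 := C1 ^+ (d - s) * C3 ^+ s; have T20 : 0 < T2 by rewrite mulr_gt0 ?exprn_gt0.
pose T3 := C4 * K `^ ka * C2 ^+ (d - s) * C5 ^+ I.
have T30 : 0 < T3 by rewrite !mulr_gt0 ?exprn_gt0 ?powR_gt0.
exists (T1 + T2 + T3); first by rewrite !addr_gt0.
move=> nn hn n n2 hmax S sigma D Ss sg0 D0 f [fm fS fA].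
have d0 : (0 < d)%N.
  by have h := max_card (mem S); rewrite card_ord Ss in h; exact: leq_trans s0 h.
have n1 : (1 <= n)%N by exact: ltnW.
have [N1 HN] := side_comparable hn d0 n1 hmax.
set N := root_n R d n in hmax N1 HN; have N0 : 0 < N by lra.
set M := Num.truncn N.
have lnn0 : 0 <= ln n%:R :> R by rewrite ln_ge0 // ler1n.
set ss := sigma_sub nn S sigma in fA *.
have ss0 : 0 < ss.
  by rewrite divr_gt0 // sqrtr_gt0; apply: prodr_gt0 => j _; rewrite ltr0n.
have nR : 0 < n%:R :> R by rewrite ltr0n.
have cS : #|[pred j | j \notin S]| = (d - s)%N by rewrite card_complement Ss.
have prod_ratio al Cr (Hr : forall m, (0 < m)%N -> m%:R <= K * N -> N <= K * m%:R ->
     harmonic_ratio al m <= Cr * (power_sum al M / N `^ (1 - al))) :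
   \prod_(j | j \notin S) harmonic_ratio al (nn j) <=
   Cr ^+ (d - s) * (power_sum al M / N `^ (1 - al)) ^+ (d - s).
  rewrite -exprMn -cS; apply: prodr_le_expr => j _.
  by have [? ?] := HN j; rewrite harmonic_ratio_ge0 Hr.
have R1 := prod_ratio (q / 2) C1 (fun m m0 => H1 N m N1 m0).
have R2 := prod_ratio eta C2 (fun m m0 => H2 N m N1 m0).
have L1E : Lambda1 d n s q = (power_sum (q / 2) M / N `^ (1 - q / 2)) ^+ (d - s) by [].
have L2E : Lambda2 d n s q =
   (power_sum eta M / N `^ (1 - eta)) ^+ (d - s) * ln n%:R ^+ I.
  by rewrite /Lambda2 -/I /power_sum -Eeta opprK [1 + _]addrC.
have L10 : 0 <= Lambda1 d n s q.
  by rewrite L1E exprn_ge0 // divr_ge0 ?power_sum_ge0 ?powR_ge0.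
have L20 : 0 <= Lambda2 d n s q.
  by rewrite L2E mulr_ge0 ?exprn_ge0 // divr_ge0 ?power_sum_ge0 ?powR_ge0.
have base0 : 0 <= n%:R * ss `^ q by rewrite mulr_ge0 ?powR_ge0 // ltW.
rewrite /select_rate -/N -/ka.
set second := Lambda2 d n s q * _ + _.
have second0 : 0 <= second.
  apply: addr_ge0; first by apply: mulr_ge0 => //; exact: powR_ge0.
  apply: mulr_ge0; last exact: exprn_ge0.
  by apply: mulr_ge0 => //; exact: powR_ge0.
have [L1s|sL1] := leP (Lambda1 d n s q) second.
  have /choice[v Hv] : forall x, exists v, lat_le x v /\
      bias_variance q sigma f x v = local_noise S sigma x `^ q.
    by move=> x; have [|v xv vE] := select_complement hn (q := q) sigma x _ fS; [lra|exists v].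
  exists v => [x|]; first by have [] := Hv x.
  rewrite (eq_bigr (fun x => local_noise S sigma x `^ q)); last by move=> x _; have [] := Hv x.
  rewrite sum_local_noise //.
  apply: (@le_trans _ _ (n%:R * ss `^ q * (T1 * Lambda1 d n s q))).
    by rewrite ler_wpM2l // L1E.
  rewrite -subr_ge0.
  have -> : (T1 + T2 + T3) * (n%:R * (ss `^ q * Lambda1 d n s q)) -
     n%:R * ss `^ q * (T1 * Lambda1 d n s q) =
     (T2 + T3) * (n%:R * ss `^ q * Lambda1 d n s q) by ring.
  by rewrite mulr_ge0 ?(mulr_ge0 base0) //; lra.
have m0 : (0 < \max_(j < d) nn j)%N.
  by apply: leq_trans (hn (Ordinal d0)) _; exact: (leq_bigmax (Ordinal d0)).
have mn : (\max_(j < d) nn j <= n)%N.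
  apply/bigmax_leqP => j _; rewrite /n /lattice_size (bigD1 j) //= leq_pmulr //.
  by rewrite prodn_cond_gt0.
have [L [nL _ LC]] := H5 (\max_(j < d) nn j)%N n m0 mn n2.
have nLj j : (nn j < 2 ^ L)%N by apply: leq_ltn_trans nL; exact: (leq_bigmax j).
have NK0 : 0 < N / K by rewrite divr_gt0.
have NKj j : j \in S -> N / K <= (nn j)%:R.
  by move=> _; rewrite ler_pdivrMr // mulrC; have [_ ->] := HN j.
have [v xv Hv] := H4 d nn hn S f sigma (D * ss) (N / K) L Ss sg0 fm fS fA NK0 NKj nLj.
exists v => //; apply: (le_trans Hv).
set mu := Num.min 1 (q / 2).
have bq := half_eq1 q.
have Nmu : (N `^ (- mu)) ^+ s = (n%:R `^ (s%:R / d%:R)) `^ (- mu) := root_n_powR_exp d n s mu.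
have full : \sum_(x : lattice nn) (sigma ^+ 2 / block_volume R x (lat_top hn)) `^ (q / 2) <=
   T2 * (n%:R * ss `^ q * (Lambda1 d n s q * (n%:R `^ (s%:R / d%:R)) `^ (- mu) *
      ln n%:R ^+ (s * (q == 2)))).
  rewrite (sum_full_noise hn S) // -/n -/ss.
  have side : \prod_(j in S) (power_sum (q / 2) (nn j) / (nn j)%:R) <=
      (C3 * (N `^ (- mu) * ln n%:R ^+ (q == 2))) ^+ s.
    rewrite -Ss; apply: prodr_le_expr => j jS; have [a1 a2] := HN j.
    rewrite divr_ge0 ?power_sum_ge0 //= -bq; apply: H3 => //.
    by apply: leq_trans mn; exact: (leq_bigmax j).
  have side0 : 0 <= \prod_(j in S) (power_sum (q / 2) (nn j) / (nn j)%:R).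
    by apply: prodr_ge0 => j _; rewrite divr_ge0 ?power_sum_ge0.
  apply: (@le_trans _ _ (n%:R * ss `^ q * (C1 ^+ (d - s) * Lambda1 d n s q) *
     (C3 * (N `^ (- mu) * ln n%:R ^+ (q == 2))) ^+ s)).
    apply: ler_pM => //.
      by rewrite mulr_ge0 // prodr_ge0 // => j _; exact: harmonic_ratio_ge0.
    by rewrite ler_wpM2l // L1E.
  rewrite !exprMn Nmu -exprM mulnC /T2 le_eqVlt; apply/orP; left; apply/eqP; ring.
have tail : C4 * (\sum_(x : lattice nn) local_noise S sigma x `^ q *
     (D * ss / local_noise S sigma x / (N / K)) `^ ka) * L%:R ^+ I <=
   T3 * (n%:R * ss `^ q * (Lambda2 d n s q * (D / N) `^ ka)).
  have -> : \sum_(x : lattice nn) local_noise S sigma x `^ q *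
     (D * ss / local_noise S sigma x / (N / K)) `^ ka =
     (D / N) `^ ka * K `^ ka * ss `^ ka *
       \sum_(x : lattice nn) local_noise S sigma x `^ (q - ka).
    rewrite mulr_sumr; apply: eq_bigr => x _.
    have t0 := local_noise_gt0 S x sg0.
    have -> : D * ss / local_noise S sigma x / (N / K) =
       (D / N) * K * ss * (local_noise S sigma x)^-1.
      by field; rewrite !gt_eqF.
    have DN : 0 <= D / N by rewrite divr_ge0 // ltW.
    have DK : 0 <= D / N * K by rewrite mulr_ge0 // ltW.
    have DS : 0 <= D / N * K * ss by rewrite mulr_ge0 // ltW.
    rewrite (powRM _ DS) ?invr_ge0 ?(ltW t0) // (powRM _ DK (ltW ss0)) (powRM _ DN (ltW Kp)).
    rewrite -(powR_inv1 (ltW t0)) -powRrM mulN1r.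
    rewrite mulrCA -powRD ?(gt_eqF t0) ?implybT // mulrC; congr (_ `^ _ * _); ring.
  rewrite sum_local_noise // -/n -/ss -/eta.
  have ssq : ss `^ q = ss `^ ka * ss `^ (q - ka).
    by rewrite -powRD ?(gt_eqF ss0) ?implybT //; congr (_ `^ _); ring.
  have LI : L%:R ^+ I <= C5 ^+ I * ln n%:R ^+ I :> R.
    by rewrite -exprMn; apply: lerXn2r; rewrite ?nnegrE ?mulr_ge0 // ltW.
  set Z := (D / N) `^ ka * K `^ ka * ss `^ ka.
  have Z0 : 0 <= Z by rewrite !mulr_ge0 ?powR_ge0.
  set Y := n%:R * ss `^ (q - ka); have Y0 : 0 <= Y by rewrite mulr_ge0 ?powR_ge0 // ltW.
  apply: (@le_trans _ _ (C4 * (Z * (Y * (C2 ^+ (d - s) *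
      (power_sum eta M / N `^ (1 - eta)) ^+ (d - s)))) * (C5 ^+ I * ln n%:R ^+ I))).
    apply: ler_pM => //; rewrite ?exprn_ge0 //.
      apply: mulr_ge0; first exact: ltW.
      apply: mulr_ge0 => //; apply: mulr_ge0 => //; apply: prodr_ge0 => j _.
      exact: harmonic_ratio_ge0.
    by rewrite ler_pM2l // ler_wpM2l // ler_wpM2l.
  by rewrite L2E ssq /T3 /Z /Y le_eqVlt; apply/orP; left; apply/eqP; ring.
apply: (le_trans (lerD full tail)).
rewrite -subr_ge0.
set X1 := Lambda1 d n s q * _ * _; set X2 := Lambda2 d n s q * _.
have X10 : 0 <= X1.
  apply: mulr_ge0; last exact: exprn_ge0.
  by apply: mulr_ge0 => //; exact: powR_ge0.
have X20 : 0 <= X2 by apply: mulr_ge0 => //; exact: powR_ge0.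
have -> : (T1 + T2 + T3) * (n%:R * (ss `^ q * second)) -
   (T2 * (n%:R * ss `^ q * X1) + T3 * (n%:R * ss `^ q * X2)) =
   n%:R * ss `^ q * (T1 * (X1 + X2) + T2 * X2 + T3 * X1).
  by rewrite /second -/X1 -/X2; ring.
apply: mulr_ge0 => //.
by rewrite !addr_ge0 // mulr_ge0 ?addr_ge0 // ltW.
Qed.

(** * Uniformity in the set of relevant variables *)

Lemma select_rate_ge0 (R : realType) (d n s : nat) (q D : R) : (0 < n)%N ->
  0 <= select_rate d n s q D.
Proof.
move=> n0; have l0 : 0 <= ln n%:R :> R by rewrite ln_ge0 // ler1n.
have L1 : 0 <= Lambda1 d n s q :> R.
  by apply: exprn_ge0; apply: divr_ge0; [apply: sumr_ge0 => j _|]; exact: powR_ge0.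
have L2 : 0 <= Lambda2 d n s q :> R.
  apply: mulr_ge0; last exact: exprn_ge0.
  by apply: exprn_ge0; apply: divr_ge0; [apply: sumr_ge0 => j _|]; exact: powR_ge0.
rewrite /select_rate le_min L1 /=; apply: addr_ge0.
  by apply: mulr_ge0 => //; exact: powR_ge0.
apply: mulr_ge0; last exact: exprn_ge0.
by apply: mulr_ge0 => //; exact: powR_ge0.
Qed.

Lemma sigma_sub_gt0 (R : realType) (d : nat) (nn : 'I_d -> nat) (S : {set 'I_d})
    (sigma : R) : (forall j, (0 < nn j)%N) -> 0 < sigma -> 0 < sigma_sub nn S sigma.
Proof.
move=> hn s0; rewrite divr_gt0 // sqrtr_gt0.
by apply: prodr_gt0 => j _; rewrite ltr0n.
Qed.

(** A sum of finitely many constants. *)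
Lemma uniform_constant (R : realType) (P : nat -> R -> Prop) (d : nat) :
  (forall s C C', P s C -> C <= C' -> P s C') ->
  (forall s, (0 < s)%N -> exists2 C, 0 < C & P s C) ->
  exists2 C, 0 < C & forall s, (0 < s <= d)%N -> P s C.
Proof.
move=> Pm Pe; elim: d => [|d [C C0 IH]].
  by exists 1 => // s; case: s.
have [C' C'0 HC'] := Pe d.+1 isT.
exists (C + C'); first by rewrite addr_gt0.
move=> s /andP[s0]; rewrite leq_eqVlt => /predU1P[->|sd].
  by apply: Pm HC' _; rewrite lerDr ltW.
by apply: Pm (IH s _) _; [rewrite s0|rewrite lerDl ltW].
Qed.

Lemma risk_rate (R : realType) (q c : R) (d : nat) : 1 <= q ->
  exists2 C : R, 0 < C &
  forall (nn : 'I_d -> nat) (hn : forall j, (0 < nn j)%N)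
    (n := lattice_size nn),
  (2 <= n)%N -> (\max_(j < d) nn j)%N%:R <= c * root_n R d n ->
  forall (design : 'I_n -> lattice nn), bijective design ->
  forall (est : n.-tuple R -> lattice nn -> R), block_estimator design est ->
  forall (dO : measure_display) (Omega : measurableType dO)
    (P : probability Omega R) (eps : 'I_n -> {RV P >-> R}) (sigma : R),
  0 < sigma -> noise_condition eps q sigma ->
  forall (S : {set 'I_d}) (D : R), (0 < #|S|)%N -> 0 <= D ->
  forall f, select_class hn S sigma D f ->
  (risk design eps q est f <=
    (C * (sigma_sub nn S sigma `^ q * select_rate d n #|S| q D))%:E)%E.
Proof.
move=> q1; have [C0 C00 HC0] := risk_le d q1.
pose Q (s : nat) (C : R) := forall (nn : 'I_d -> nat) (hn : forall j, (0 < nn j)%N)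
    (n := lattice_size nn),
  (2 <= n)%N -> (\max_(j < d) nn j)%N%:R <= c * root_n R d n ->
  forall (S : {set 'I_d}) (sigma D : R), #|S| = s -> 0 < sigma -> 0 <= D ->
  forall f, sparse_monotone hn S (D * sigma_sub nn S sigma) f ->
  exists2 v : lattice nn -> lattice nn, (forall x, lat_le x (v x)) &
    \sum_(x : lattice nn) bias_variance q sigma f x (v x) <=
    C * (n%:R * (sigma_sub nn S sigma `^ q * select_rate d n s q D)).
have [C C_0 HC] : exists2 C, 0 < C & forall s, (0 < s <= d)%N -> Q s C.
  apply: uniform_constant => [s C C' HC CC' nn hn n n2 hm S sigma D Ss s0 D0 f cf|s s0].
    have [v xv Hv] := HC nn hn n2 hm S sigma D Ss s0 D0 f cf; exists v => //.
    apply: (le_trans Hv); apply: ler_wpM2r => //; apply: mulr_ge0 => //.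
    apply: mulr_ge0; first exact: powR_ge0.
    by apply: select_rate_ge0; exact: ltnW.
  exact: selection_rate.
exists (C0 * C); first by rewrite mulr_gt0.
move=> nn hn n n2 hm design bd est be dO Omega P eps sigma s0 nc S D S0 D0 f [fm fS fD].
have ss0 := sigma_sub_gt0 S hn s0.
have sd : (0 < #|S| <= d)%N.
  by rewrite S0 /=; have h := max_card (mem S); rewrite card_ord in h.
have n0 : 0 < n%:R :> R by rewrite ltr0n; exact: ltnW.
have H := HC0 nn hn design bd est be dO Omega P eps sigma s0 nc S
  (D * sigma_sub nn S sigma)
  (C * (n%:R * (sigma_sub nn S sigma `^ q * select_rate d n #|S| q D)))
  (HC _ sd nn hn n2 hm S sigma D erefl s0 D0) f.
have cf : sparse_monotone hn S (D * sigma_sub nn S sigma) f.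
  by split => //; move: fD; rewrite /Delta ler_pdivrMr.
apply: (le_trans (H cf)); rewrite lee_fin le_eqVlt; apply/orP; left; apply/eqP.
by rewrite -/n; field; rewrite gt_eqF.
Qed.

(** By [side_comparable], since [sigma_sub] involves [d - #|S|] of the sides. *)
Lemma sigma_sub_le (R : realType) (c : R) (d : nat) :
  exists2 C : R, 0 < C &
  forall (nn : 'I_d -> nat) (n := lattice_size nn),
  (forall j, (0 < nn j)%N) -> (0 < d)%N -> (1 <= n)%N ->
  (\max_(j < d) nn j)%N%:R <= c * root_n R d n ->
  forall (S : {set 'I_d}) (sigma : R), 0 < sigma ->
  sigma_sub nn S sigma <=
    C * (sigma / n%:R `^ ((1 - #|S|%:R / d%:R) / 2)).
Proof.
pose K := Num.max 1 c ^+ d.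
have K1 : 1 <= K by apply: exprn_ege1; rewrite le_max lexx.
pose B := K `^ `|- (1 / 2)|.
have B1 : 1 <= B by rewrite /B -(powRr0 K); apply: ler_powR.
exists (B ^+ d); first by apply: exprn_gt0; exact: lt_le_trans B1.
move=> nn n hn d0 n1 hm S sigma s0.
have [N1 HN] := side_comparable hn d0 n1 hm.
set N := root_n R d n in hm N1 HN; have N0 : 0 < N by lra.
have n0 : 0 < n%:R :> R by rewrite ltr0n.
rewrite -[leLHS]powRr1; last by apply: ltW; exact: sigma_sub_gt0.
rewrite sigma_sub_powR // powRr1 ?(ltW s0) //.
rewrite [leRHS]mulrCA; apply: ler_wpM2l; first exact: ltW.
have H : \prod_(j | j \notin S) (nn j)%:R `^ (- (1 / 2)) <=
    (B * N `^ (- (1 / 2))) ^+ (d - #|S|) :> R.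
  rewrite -card_complement; apply: prodr_le_expr => j _; rewrite powR_ge0 /=.
  have [a1 a2] := HN j; apply: powR_comparable => //.
  by rewrite ltr0n.
apply: (le_trans H); rewrite exprMn.
have Sd : (#|S| <= d)%N by have h := max_card (mem S); rewrite card_ord in h.
have -> : (N `^ (- (1 / 2))) ^+ (d - #|S|) = (n%:R `^ ((1 - #|S|%:R / d%:R) / 2))^-1.
  rewrite root_n_powR_exp -powRN -powRrM; congr (_ `^ _).
  by rewrite natrB //; field; rewrite pnatr_eq0 -lt0n.
apply: ler_wpM2r; first by rewrite invr_ge0 powR_ge0.
by apply: ler_weXn2l => //; exact: leq_subr.
Qed.

(** * The quadratic risk *)

(** For [al < 1] the power sum is of the order of the integral. *)
Lemma harmonic_ratio_le (R : realType) (al : R) : 0 <= al -> al < 1 ->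
  exists2 C : R, 0 < C & forall N : R, 1 <= N ->
  power_sum al (Num.truncn N) / N `^ (1 - al) <= C.
Proof.
move=> al0 al1; have [C C0 HC] := power_sum_log al0.
exists C => // N N1; have N0 : 0 < N by lra.
set M := Num.truncn N; have M1 : (0 < M)%N by rewrite truncn_gt0.
have MN : M%:R <= N by rewrite truncn_le ltW.
have := HC M (M + 2)%N M1 (leq_addr _ _) (leq_addl _ _).
rewrite (lt_eqF al1) expr0 mulr1 (max_idPr _); last by rewrite subr_ge0 ltW.
move=> h; rewrite ler_pdivrMr ?powR_gt0 //; apply: (le_trans h).
by rewrite ler_pM2l //; apply: ge0_ler_powR; rewrite ?nnegrE ?subr_ge0 // ltW.
Qed.

Definition quadratic_rate (R : realType) (d n s : nat) (D : R) : R :=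
  if (2 <= s)%N then
    Num.min (ln n%:R ^+ (d - s))
      (D * n%:R `^ (- d%:R^-1) * ln n%:R ^+ (s == 2%N)
       + n%:R `^ (- (s%:R / d%:R)) * ln n%:R ^+ d)
  else
    Num.min (ln n%:R ^+ (d - 1))
      ((D / n%:R `^ d%:R^-1) `^ (2 / 3)
       + n%:R `^ (- d%:R^-1) * ln n%:R ^+ d).

(** [Lambda1] is a power of a harmonic sum.  The exponent in [Lambda2] is
    [- 1/2] if [s >= 2] and [- 2/3] if [s = 1]; both exceed [- 1], so [Lambda2]
    is bounded apart from the logarithm that it carries for [s = 2]. *)
Lemma select_rate_two (R : realType) (d : nat) :
  exists2 C : R, 0 < C &
  forall (n s : nat) (D : R), (2 <= n)%N -> (1 <= s <= d)%N -> 0 <= D ->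
  select_rate d n s 2 D <= C * quadratic_rate d n s D.
Proof.
have [C1 C10 H1] := @power_sum_log R 1 ler01.
have [C2 C20 H2] := @harmonic_ratio_le R (1 / 2) ltac:(lra) ltac:(lra).
have [C3 C30 H3] := @harmonic_ratio_le R (2 / 3) ltac:(lra) ltac:(lra).
pose B1 := (1 + C1) ^+ d; pose B2 := (1 + C2 + C3) ^+ d.
have B10 : 1 <= B1 by apply: exprn_ege1; lra.
have B20 : 1 <= B2 by apply: exprn_ege1; lra.
exists (B1 + B2); first lra.
move=> n s D n2 /andP[s1 sd] D0.
have d0 : (0 < d)%N by exact: leq_trans s1 sd.
have n1 : 1 <= n%:R :> R by rewrite ler1n; exact: ltnW.
have l0 : 0 <= ln n%:R :> R by rewrite ln_ge0.
set N := root_n R d n.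
have N1 : 1 <= N by rewrite -(powRr0 n%:R); apply: ler_powR => //; rewrite invr_ge0.
have N0 : 0 < N by lra.
set M := Num.truncn N.
have M0 : (0 < M)%N by rewrite truncn_gt0.
have Mn : (M <= n)%N.
  rewrite -(ler_nat R); apply: (@le_trans _ _ N); first by rewrite truncn_le ltW.
  by rewrite -(root_nX R n d0) -/N; apply: ler_eXnr.
have L1 : Lambda1 d n s (2 : R) <= B1 * ln n%:R ^+ (d - s).
  have h : power_sum 1 M <= C1 * ln n%:R.
    by have := H1 M n M0 Mn n2; rewrite subrr maxxx powRr0 mulr1 eqxx expr1.
  have -> : Lambda1 d n s (2 : R) = power_sum 1 M ^+ (d - s).
    have h1 : 2 / 2 = 1 :> R by rewrite divff ?pnatr_eq0.
    rewrite /Lambda1 /power_sum.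
    rewrite h1 subrr powRr0 divr1.
    by rewrite -/N -/M.
  apply: (@le_trans _ _ ((C1 * ln n%:R) ^+ (d - s))).
    by apply: lerXn2r; rewrite ?nnegrE ?power_sum_ge0 // mulr_ge0 // ltW.
  rewrite exprMn; apply: ler_wpM2r; first exact: exprn_ge0.
  apply: (@le_trans _ _ ((1 + C1) ^+ (d - s))).
    by apply: lerXn2r; rewrite ?nnegrE ?addr_ge0 ?lerDr // ltW.
  by apply: ler_weXn2l; [lra|exact: leq_subr].
have L2 (al : R) (h : power_sum al M / N `^ (1 - al) <= C2 + C3) :
    (power_sum al M / N `^ (1 - al)) ^+ (d - s) <= B2.
  apply: (@le_trans _ _ ((1 + C2 + C3) ^+ (d - s))).
    apply: lerXn2r; rewrite ?nnegrE ?divr_ge0 ?power_sum_ge0 ?powR_ge0 //; first lra.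
    lra.
  by apply: ler_weXn2l; [lra|exact: leq_subr].
(* The logarithms of Lambda1 and of the second entry combine. *)
have lnS : ln n%:R ^+ (d - s) * ln n%:R ^+ s = ln n%:R ^+ d :> R.
  by rewrite -exprD subnK.
have ND x : (D / N) `^ x >= 0 by exact: powR_ge0.
have e2 : Num.min 1 (2 / 2) = 1 :> R by rewrite divff ?pnatr_eq0 // minxx.
have second_part : Lambda1 d n s (2 : R) * (n%:R `^ (s%:R / d%:R)) `^ (- Num.min 1 (2 / 2)) *
     ln n%:R ^+ (s * (2 == 2 :> R)) <=
   B1 * (n%:R `^ (- (s%:R / d%:R)) * ln n%:R ^+ d).
  rewrite e2 eqxx muln1 -powRrM mulrN1 -lnS.
  apply: (@le_trans _ _ (B1 * ln n%:R ^+ (d - s) * n%:R `^ (- (s%:R / d%:R)) * ln n%:R ^+ s)).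
    apply: ler_wpM2r; first exact: exprn_ge0.
    by apply: ler_wpM2r; first exact: powR_ge0.
  by rewrite le_eqVlt; apply/orP; left; apply/eqP; ring.
have Z0 : 0 <= n%:R `^ (- (s%:R / d%:R)) * ln n%:R ^+ d :> R.
  by apply: mulr_ge0; [exact: powR_ge0|exact: exprn_ge0].
have comb (a b a' b' : R) : a <= B1 * a' -> b <= B2 * b' + B1 * (n%:R `^ (- (s%:R / d%:R)) * ln n%:R ^+ d) ->
    0 <= a' -> 0 <= b' ->
    Num.min a b <= (B1 + B2) * Num.min a' (b' + n%:R `^ (- (s%:R / d%:R)) * ln n%:R ^+ d).
  move=> ha hb a0 b0; set Z := n%:R `^ _ * _ in Z0 hb *.
  rewrite minr_pMr; last lra.
  rewrite le_min !ge_min; apply/andP; split; apply/orP; [left|right]; nra.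
rewrite /select_rate /quadratic_rate -/N.
have [s2|s2] := leqP 2 s.
  have sR : 2 <= s%:R :> R by rewrite (ler_nat R 2).
  have k1 : Num.min 1 (2 * s%:R / (s%:R + 2)) = 1 :> R.
    by rewrite (min_idPl _) // ler_pdivlMr; lra.
  have I2 : (2 * s%:R / (s%:R + 2) == 1 :> R) = (s == 2%N).
    rewrite -(eqr_nat R); apply/eqP/eqP => [h|->]; last by field.
    have : 2 * s%:R / (s%:R + 2) * (s%:R + 2) = s%:R + 2 :> R by rewrite h mul1r.
    by rewrite divfK ?gt_eqF; lra.
  have ex : Lambda2_exp s (2 : R) = - (1 / 2).
    rewrite /Lambda2_exp (min_idPl _); first by field.
    by rewrite lerNr ler_pdivrMr; lra.
  apply: comb => //; last 2 first.
  - exact: exprn_ge0.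
  - by rewrite !mulr_ge0 ?powR_ge0 ?exprn_ge0.
  apply: lerD => //; rewrite k1 powRr1; last by rewrite divr_ge0 // ltW.
  rewrite /Lambda2 -/N -/M I2 ex [_ + 1]addrC.
  rewrite -!mulrA; apply: ler_pM.
  - by apply: exprn_ge0; apply: divr_ge0; [exact: power_sum_ge0|exact: powR_ge0].
  - by rewrite mulr_ge0 ?exprn_ge0 // divr_ge0 // ltW.
  - by apply: (L2 (1 / 2)); have := H2 N N1; lra.
  - by rewrite /N /root_n -powRN mulrC -mulrA.
have {}s1 : s = 1%N by apply/eqP; rewrite eqn_leq s1 andbT -ltnS.
subst s.
have k1 : Num.min 1 (2 * 1%:R / (1%:R + 2)) = 2 / 3 :> R.
  by rewrite (min_idPr _) ?ler_pdivrMr; [congr (_ / _)| |]; lra.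
have I2 : (2 * 1%:R / (1%:R + 2) == 1 :> R) = false.
  by rewrite lt_eqF // ltr_pdivrMr; lra.
have ex : Lambda2_exp 1 (2 : R) = - (2 / 3).
  have e3 : 1%:R + 2 = 3 :> R by lra.
  by rewrite /Lambda2_exp e3 (min_idPr _); lra.
rewrite -[d%:R^-1 in X in _ <= X]mul1r.
apply: comb => //; last 2 first.
- exact: exprn_ge0.
- exact: powR_ge0.
apply: lerD; last exact: second_part.
rewrite k1.
rewrite /Lambda2 -/N -/M I2 ex expr0 mulr1 [_ + 1]addrC.
rewrite mul1r; apply: ler_wpM2r => //.
by apply: (L2 (2 / 3)); have := H3 N N1; lra.
Qed.

Theorem theorem5 (R : realType) (d : nat) (c : R) :
  exists Cd : R, 0 < Cd /\
  forall q : R, 1 <= q ->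
  exists Cqd : R, 0 < Cqd /\
  forall (nn : 'I_d -> nat) (hn : forall j, (0 < nn j)%N)
    (n := lattice_size nn),
    (2 <= n)%N ->
    (\max_(j < d) nn j)%N%:R <= c * n%:R `^ d%:R^-1 ->
  forall (design : 'I_n -> lattice nn), bijective design ->
  forall (est : n.-tuple R -> lattice nn -> R), block_estimator design est ->
  forall (dO : measure_display) (Omega : measurableType dO)
    (P : probability Omega R) (eps : 'I_n -> {RV P >-> R}) (sigma : R),
    0 < sigma -> noise_condition eps q sigma ->
  forall (S : {set 'I_d}) (s := #|S|) (Dstar : R),
    (1 <= s <= d)%N -> 0 <= Dstar ->
  [/\ sigma_sub nn S sigma <= Cd * (sigma / n%:R `^ ((1 - s%:R / d%:R) / 2)),
      (ereal_sup [set risk design eps q est f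
                    | f in select_class hn S sigma Dstar]
        <= (Cqd * (sigma_sub nn S sigma `^ q * select_rate d n s q Dstar))%:E)%E
    & q = 2 ->
      forall f : lattice nn -> R, select_class hn S sigma Dstar f ->
      (risk design eps 2%R est f <=
        (Cd * (sigma ^+ 2 * n%:R `^ (s%:R / d%:R - 1) *
          (if (2 <= s)%N then
             Num.min (ln n%:R ^+ (d - s))
               (Dstar * n%:R `^ (- d%:R^-1) * ln n%:R ^+ (s == 2%N)
                + n%:R `^ (- (s%:R / d%:R)) * ln n%:R ^+ d)
           else
             Num.min (ln n%:R ^+ (d - 1))
               ((Dstar / n%:R `^ d%:R^-1) `^ (2 / 3)
                + n%:R `^ (- d%:R^-1) * ln n%:R ^+ d))))%:E)%E].
Proof.
have [Cs Cs0 Hs] := sigma_sub_le c d.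
have [Cr Cr0 Hr] := @risk_rate R 2 c d ltac:(lra).
have [Ct Ct0 Ht] := select_rate_two R d.
exists (Cs + Cr * (Cs ^+ 2 * Ct)); split.
  by rewrite addr_gt0 // !mulr_gt0 // exprn_gt0.
move=> q q1; have [Cq Cq0 Hq] := risk_rate c d q1.
exists Cq; split => // nn hn n n2 hm design bd est be dO Omega P eps sigma s0 nc S s D sd D0.
have S0 : (0 < #|S|)%N by case/andP: sd.
have d0 : (0 < d)%N by case/andP: sd => h1 h2; exact: leq_trans h1 h2.
have n1 : (1 <= n)%N by exact: ltnW.
have ss := Hs nn hn d0 n1 hm S sigma s0.
have np : 0 < n%:R :> R by rewrite ltr0n.
have T0 : 0 <= sigma / n%:R `^ ((1 - s%:R / d%:R) / 2).
  by rewrite divr_ge0 ?powR_ge0 // ltW.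
split.
- apply: (le_trans ss); apply: ler_wpM2r => //; rewrite lerDl.
  by rewrite !mulr_ge0 ?exprn_ge0 // ltW.
- apply: ge_ereal_sup => _ [f cf <-].
  exact: (Hq nn hn n2 hm design bd est be dO Omega P eps sigma s0 nc S D S0 D0 f cf).
move=> q2 f cf; rewrite q2 in nc.
apply: (le_trans (Hr nn hn n2 hm design bd est be dO Omega P eps sigma s0 nc S D S0 D0 f cf)).
rewrite lee_fin -/(quadratic_rate d n s D).
have rt := Ht n s D n2 sd D0.
have r0 : 0 <= select_rate d n s 2 D by exact: select_rate_ge0.
have qr0 : 0 <= quadratic_rate d n s D by rewrite -(pmulr_rge0 _ Ct0); exact: le_trans rt.
have sq : sigma_sub nn S sigma `^ 2 <= Cs ^+ 2 * (sigma ^+ 2 * n%:R `^ (s%:R / d%:R - 1)).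
  have p0 : 0 <= sigma_sub nn S sigma by apply: ltW; exact: sigma_sub_gt0.
  rewrite powR_mulrn //.
  have -> : sigma ^+ 2 * n%:R `^ (s%:R / d%:R - 1) =
      (sigma / n%:R `^ ((1 - s%:R / d%:R) / 2)) ^+ 2.
    rewrite exprMn -powRN -[(_ `^ _) ^+ 2]powR_mulrn ?powR_ge0 // -powRrM.
    by congr (_ * _ `^ _); field; rewrite pnatr_eq0 -lt0n.
  rewrite -exprMn; apply: lerXn2r; rewrite ?nnegrE //.
  by apply: mulr_ge0 => //; exact: ltW.
set W := sigma ^+ 2 * _ in sq *.
have W0 : 0 <= W by apply: mulr_ge0; [exact: sqr_ge0|exact: powR_ge0].
apply: (@le_trans _ _ (Cr * (Cs ^+ 2 * W * (Ct * quadratic_rate d n s D)))).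
  rewrite ler_pM2l //; apply: ler_pM => //; exact: powR_ge0.
rewrite -subr_ge0.
have -> : (Cs + Cr * (Cs ^+ 2 * Ct)) * (W * quadratic_rate d n s D) -
  Cr * (Cs ^+ 2 * W * (Ct * quadratic_rate d n s D)) =
  Cs * (W * quadratic_rate d n s D) by ring.
by rewrite !mulr_ge0 // ltW.
Qed.
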